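(* There exist constants $c_1, c_2, c_3$ such that for every graph $H$ and every $p = \Omega\left(n^{-1/m_H^{\star}}\right)$, the $(\mathcal{G}_{n,p}, \rho_H)$-quality control problem satisfies the following: (1) it is solvable with $O(p^{-c_1 \Delta(H)})$ adjacency matrix queries to the input graph $G$; (2) when $p$ is additionally $\Omega\left((\log(n)/n)^{1/(4\sigma(H)-1)}\right)$, it is also solvable in $O(p^{-c_3 \Delta(H)})$ time and queries; (3) no algorithm solves this problem with $o(p^{-c_2 \Delta(H)})$ queries.
   Context: Quality control: let $\mathcal{X}$ be a set, $\rho:\mathcal{X}\to\mathbb{R}_{\ge 0}$, $\varepsilon>0$ a fixed small constant, and $\mathcal{D}$ a distribution on $\mathcal{X}$ with $\Pr_{x\sim\mathcal{D}}[|\rho(x)-1|\le\varepsilon]\ge 9/10$. A (randomized) $(\mathcal{D},\rho)$-quality control algorithm $A$ must satisfy: (i) $\Pr_{x\sim\mathcal{D},R}[A(x)=\textsc{Accept}]\ge 2/3$, where $R$ is the algorithm's internal randomness; (ii) for every $x$ with $|\rho(x)-1|>\varepsilon$, $\Pr_R[A(x)=\textsc{Reject}]\ge 2/3$. Inputs are graphs on vertex set $[n]$ accessed via adjacency matrix queries ($(u,v)\mapsto 1$ iff $\{u,v\}$ is an edge). $\mathcal{G}_{n,p}$ is the Erdős–Rényi distribution. For a graph $H$ (the motif, on a constant number $k$ of vertices), $C_H(G)$ is the number of injective maps $\psi:V(H)\to V(G)$ such that $\{\psi(u),\psi(v)\}\in E(G)$ iff $\{u,v\}\in E(H)$ (labeled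 induced copies), and $\rho_H(G)=C_H(G)/\mathbb{E}_{G'\sim\mathcal{G}_{n,p}}[C_H(G')]$. $\Delta(H)$ is the maximum degree of $H$. $m_H := \max_{F\subseteq H} e(F)/v(F)$, and $m_H^\star$ is the maximum of $m_{H'}$ over all graphs $H'$ on the same vertex set as $H$ whose edge set contains that of $H$. $L(H)$ is the line graph of $H$ (vertices are edges of $H$, adjacent if they share an endpoint), and $\sigma(H)=\min\{(\text{max-deg}(L(H))+4)/2,\ (D(L(H))+6)/2\}$ where $D(\cdot)$ denotes degeneracy. The accuracy $\varepsilon$ is treated as a constant.
   Formalization: Unless H is complete, p is assumed bounded away from 1 for large n (if p→1 along a subsequence, (1) fails: G_{n,p} cannot be told from K_n with O(1) queries); H has at least 2 vertices, so that n^{-1/m*} is defined; the 9/10 concentration condition on ρ_H is assumed for large n. *)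

(* Defs.v *)
From mathcomp Require Import all_boot all_order all_algebra.
From mathcomp Require Import interval_inference reals.
Set Implicit Arguments.
Unset Strict Implicit.
Unset Printing Implicit Defensive.
Import Order.TTheory GRing.Theory Num.Theory.
Local Open Scope ring_scope.

Definition pairs_of (V : finType) : {set {set V}} := [set e : {set V} | #|e| == 2%N].

(* A simple graph on V is its edge set, a set of 2-element subsets of V. *)
Definition sgraph (V : finType) := {E : {set {set V}} | E \subset pairs_of V}.

Definition edges (V : finType) (G : sgraph V) : {set {set V}} := val G.

(* For u = v this is false, since [set u; u] has one element. *)
Definition adj (V : finType) (G : sgraph V) : rel V :=
  fun u v => [set u; v] \in edges G.

Definition complete (V : finType) (G : sgraph V) : Prop :=
  edges G = pairs_of V.

Definition degree (V : finType) (r : rel V) (v : V) : nat := #|[set w | r v w]|.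

Definition maxdeg (V : finType) (r : rel V) : nat := (\max_(v : V) degree r v)%N.

Definition degenerate (V : finType) (r : rel V) (d : nat) : bool :=
  [forall S : {set V}, (S != set0) ==>
    [exists v in S, (#|[set w in S | r v w]| <= d)%N]].

Lemma degenerate_ex (V : finType) (r : rel V) : exists d, degenerate r d.
Proof.
exists #|V|; apply/forallP => S; apply/implyP => /set0Pn[v vS].
by apply/existsP; exists v; rewrite vS max_card.
Qed.

Definition degeneracy (V : finType) (r : rel V) : nat :=
  ex_minn (degenerate_ex r).

Definition line_rel (V : finType) (H : sgraph V) : rel {e | e \in edges H} :=
  fun e f => (e != f) && (val e :&: val f != set0).

Section Densities.
Variables (R : realType) (V : finType).

Definition sigma (H : sgraph V) : R :=
  Num.min (((maxdeg (@line_rel V H))%:R + 4) / 2)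
          (((degeneracy (@line_rel V H))%:R + 6) / 2).

(* A subgraph F of H with nonempty vertex set U: a set F of edges of H, all
   contained in U. *)
Definition m_dens (H : sgraph V) : R :=
  \big[Num.max/0]_(U : {set V} | U != set0)
    \big[Num.max/0]_(F : {set {set V}} |
        (F \subset edges H) && (F \subset powerset U))
      (#|F|%:R / #|U|%:R).

Definition m_star (H : sgraph V) : R :=
  \big[Num.max/0]_(H' : sgraph V | edges H \subset edges H') m_dens H'.

End Densities.

Definition count_copies (V W : finType) (H : sgraph V) (G : sgraph W) : nat :=
  #|[set psi : {ffun V -> W} | injectiveb psi &&
      [forall u, forall v, adj G (psi u) (psi v) == adj H u v]]|.

(* The probability of the graph G under G_{n,p}. *)
Definition Gnp (R : realType) (n : nat) (p : R) (G : sgraph 'I_n) : R :=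
  \prod_(e in pairs_of 'I_n) (if e \in edges G then p else 1 - p).

Definition rho (R : realType) (V : finType) (H : sgraph V) (n : nat) (p : R)
    (G : sgraph 'I_n) : R :=
  (count_copies H G)%:R /
  (\sum_(G' : sgraph 'I_n) Gnp p G' * (count_copies H G')%:R).

Section QualityControl.
Variables (R : realType) (X : finType).

(* The condition on D under which the (D, rho)-quality control problem is
   defined. *)
Definition qc_problem (D q : X -> R) (eps : R) : Prop :=
  9 / 10 <= \sum_(x | `|q x - 1| <= eps) D x.

(* An algorithm is represented by [out x b], the probability over its internal
   randomness that it answers b on input x (true is Accept, false is Reject). *)
Definition qc_solves (D q : X -> R) (eps : R) (out : X -> bool -> R) : Prop :=
  2 / 3 <= \sum_x D x * out x true /\
  (forall x, eps < `|q x - 1| -> 2 / 3 <= out x false).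

End QualityControl.

Section QueryAlgorithms.
Variables (R : realType) (V : finType).

(* Adaptive randomized algorithms with adjacency matrix queries. Computation and
   coins (of any bias, in any number) are free. *)
Inductive qalg : Type :=
| Answer of bool
| Flip of {i01 R} & (bool -> qalg)
| Ask of V & V & (bool -> qalg).

Fixpoint qalg_out (t : qalg) (G : sgraph V) (b : bool) : R :=
  match t with
  | Answer a => (a == b)%:R
  | Flip r k => r%:num * qalg_out (k true) G b +
                (1 - r%:num) * qalg_out (k false) G b
  | Ask u v k => qalg_out (k (adj G u v)) G b
  end.

(* Worst case over the inputs and the coins. *)
Fixpoint qalg_queries (t : qalg) : nat :=
  match t with
  | Answer _ => 0
  | Flip _ k => maxn (qalg_queries (k true)) (qalg_queries (k false))
  | Ask _ _ k => (maxn (qalg_queries (k true)) (qalg_queries (k false))).+1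
  end.

End QueryAlgorithms.

(* Randomized word RAM with adjacency matrix queries. Register operands are
   addresses in memory; [ILoad d x] is M[d] := M[M[x]], [IStore d x] is
   M[M[d]] := M[x], [IRand d x] draws M[d] uniformly from {0, ..., M[x] - 1},
   [IJlt x y l] jumps to instruction l if M[x] < M[y], and [IQuery d x y] sets
   M[d] to the adjacency bit of the vertices M[x] and M[y] (0 if one of them is
   not a vertex). Subtraction is truncated at 0 and division by 0 gives 0. *)
Inductive instr : Type :=
| IConst (d c : nat)
| IAdd (d x y : nat)
| ISub (d x y : nat)
| IMul (d x y : nat)
| IDiv (d x y : nat)
| ILoad (d x : nat)
| IStore (d x : nat)
| IJlt (x y l : nat)
| IRand (d x : nat)
| IQuery (d x y : nat)
| IHalt (b : bool).

Definition upd (M : nat -> nat) (d v : nat) : nat -> nat :=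
  fun i => if i == d then v else M i.

Definition query_bit (n : nat) (G : sgraph 'I_n) (x y : nat) : bool :=
  match insub x, insub y with
  | Some u, Some v => adj G u v
  | _, _ => false
  end.

Section Ram.
Variables (R : realType) (prog : seq instr) (W n : nat) (G : sgraph 'I_n).

(* The probability that the program answers b within t steps, when started at
   instruction pc with memory M. Every instruction takes one step, so a bound on
   the number of steps is also a bound on the number of queries. Words are
   naturals below W. *)
Fixpoint ram_out (t pc : nat) (M : nat -> nat) (b : bool) : R :=
  match t with
  | 0 => 0
  | t'.+1 =>
    let next d v := ram_out t' pc.+1 (upd M d (v %% W)%N) b in
    match onth prog pc with
    | None => 0
    | Some i =>
      match i with
      | IConst d c => next d c
      | IAdd d x y => next d (M x + M y)%N
      | ISub d x y => next d (M x - M y)%N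
      | IMul d x y => next d (M x * M y)%N
      | IDiv d x y => next d (M x %/ M y)%N
      | ILoad d x => next d (M (M x))
      | IStore d x => next (M d) (M x)
      | IJlt x y l => ram_out t' (if (M x < M y)%N then l else pc.+1) M b
      | IRand d x =>
          (\sum_(j < maxn (M x) 1) next d j) / (maxn (M x) 1)%:R
      | IQuery d x y => next d (nat_of_bool (query_bit G (M x) (M y)))
      | IHalt a => (a == b)%:R
      end
    end
  end.

End Ram.

(* A RAM algorithm is a program with two constants: words have
   word_mul * O(log n) bits, and p is given up to an additive 1 / n^prec. *)
Record ram_alg := RamAlg { code : seq instr; word_mul : nat; prec : nat }.

Definition word_bound (A : ram_alg) (n : nat) : nat :=
  (2 ^ (word_mul A * (trunc_log 2 n).+1))%N.

Definition ram_init (R : realType) (A : ram_alg) (n : nat) (p : R)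
    : nat -> nat :=
  fun i => match i with
  | 0 => (n %% word_bound A n)%N
  | 1 => (Num.truncn (p * n%:R ^+ prec A) %% word_bound A n)%N
  | _ => 0%N
  end.

Definition ram_run (R : realType) (A : ram_alg) (n : nat) (p : R) (t : nat)
    (G : sgraph 'I_n) (b : bool) : R :=
  ram_out R (code A) (word_bound A n) G t 0 (ram_init A n p) b.

(* On every input graph, every run of A halts with an answer within t steps. *)
Definition ram_halts (R : realType) (A : ram_alg) (n : nat) (p : R) (t : nat)
    : Prop :=
  forall G : sgraph 'I_n, ram_run A p t G true + ram_run A p t G false = 1.

Definition query_solvable (R : realType) (V : finType) (H : sgraph V)
    (eps : R) (n : nat) (p : R) (q : nat) : Prop :=
  exists2 t : qalg R 'I_n, (qalg_queries t <= q)%N &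
    qc_solves (Gnp p) (rho H p) eps (qalg_out t).

Definition ram_solves (R : realType) (V : finType) (H : sgraph V)
    (eps : R) (n : nat) (p : R) (A : ram_alg) (t : nat) : Prop :=
  ram_halts A n p t /\
  qc_solves (@Gnp R n p) (rho H p) eps (ram_run A p t).

(* Main.v *)
(* Let B(x,y) = A(x,y) - p off the diagonal and B(x,x) = 0, where A is the adjacency
   matrix, and let S be the sum of B(x,y)B(x',y)B(x,y')B(x',y') over all quadruples.

   Upper bounds. If S is at most c p^(2b) n^4, then rho_H is within eps of 1: by
   Cauchy-Schwarz, replacing the edge {u,v} of a subgraph F of H by its density p
   costs (S / n^4)^(1/4) times the geometric mean of the counts of F - u and F - v,
   which is affordable when deg_F(u) + deg_F(v) <= b.  Peeling edges in degeneracy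
   order of the line graph gives b <= degeneracy(L(H)) + 2, and also b <= 2 Delta;
   the non-edges are peeled last, when no edge is left to pay for.  Under G_{n,p} the
   mean of S is at most 2 n^3.  Hence averaging O(p^(-4b)) samples of a product of
   four entries of B decides the problem as soon as n p^(2b) is large; otherwise
   n <= O(p^(-2b)) and the whole graph can be queried.  In the setting of part (2),
   2b <= 4 sigma - 1 makes n p^(2b) tend to infinity.

   Lower bound. If H has a vertex v of degree Delta, redefine the neighbourhoods of
   a random block of s = O(1 + n p^Delta) vertices.  For the right common
   neighbourhood each of them extends a constant fraction of the copies of H - v that
   extend to copies of H, so rho_H exceeds 1 + eps, while q queries meet the block
   with probability O(q s / n).  That there are enough copies of H - v follows from
   the concentration of rho_H, which is a hypothesis, and a first moment bound on
   pairs of copies of H that differ only in v, by Cauchy-Schwarz.  When p is bounded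
   away from 0 an algorithm with o(1) queries makes none. *)

(* The error of one peeling step must be small against p^m, where m is the number of edges of F. The
   counts of F - u and F - v are of order p^(m - deg u) and p^(m - deg v) times the number of maps,
   so their geometric mean exceeds p^m by a factor p^(-(deg u + deg v)/2), which (S / n^4)^(1/4) has
   to cancel; this fixes the bound c p^(2b) n^4 on S. These counts are bounded by the same peeling,
   with 2p in place of p to absorb the errors. The edge {u,v} is counted at both of its ends, whence
   the 2 in degeneracy(L(H)) + 2.

   In the lower bound the queries meet the block with probability O(q / n + q p^Delta). For q =
   o(p^(-Delta/2)) the second term is harmless, and the first one needs p^Delta n^2 bounded below.
   Here the hypothesis on m_H^star enters: the complete graph shows that m_H^star >= (k - 1)/2, so
   p^(k-1) n^2 is bounded below, and Delta <= k - 1. Hence c_2 = 1/2. *)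
Require Import Defs.
From mathcomp Require Import all_boot all_order all_algebra.
From mathcomp Require Import interval_inference reals.
From mathcomp Require Import ring lra zify.
Set Implicit Arguments.
Unset Strict Implicit.
Unset Printing Implicit Defensive.
Import Order.TTheory GRing.Theory Num.Theory.
Local Open Scope ring_scope.

(** * The random graph *)

Section RandomGraph.
Variables (R : realType) (n : nat) (p : R).
Local Notation graph := (sgraph 'I_n).
Local Notation pairs := (pairs_of 'I_n).

Definition mean (f : graph -> R) : R := \sum_(G : graph) Gnp p G * f G.

(** The states of distinct pairs are independent: expanding the product on the right gives one term
    for each set of pairs, that is for each graph. *)
Lemma mean_prod (g : {set 'I_n} -> bool -> R) :
  mean (fun G => \prod_(e in pairs) g e (e \in edges G)) =
  \prod_(e in pairs) (p * g e true + (1 - p) * g e false).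
Proof.
(* Outside [pairs] the two factors are 0 and 1, so the expansion may run over all sets of sets, and
   only the edge sets of graphs survive. *)
pose F e := if e \in pairs then p * g e true else 0.
pose K e := if e \in pairs then (1 - p) * g e false else 1.
transitivity (\prod_e (F e + K e)); last first.
  rewrite [RHS]big_mkcond; apply: eq_bigr => e _.
  by rewrite /F /K; case: ifP => // _; rewrite add0r.
pose T (E : {set {set 'I_n}}) := \prod_e (if e \in E then F e else K e).
have -> : \prod_e (F e + K e) = \sum_(E : {set {set 'I_n}}) T E.
  transitivity (\prod_e \sum_(b : bool) (if b then F e else K e)).
    by apply: eq_bigr => e _; rewrite big_bool.
  rewrite bigA_distr_bigA (reindex (fun E : {set {set 'I_n}} => finfun (mem E))) /=.
    by apply: eq_bigr => E _; apply: eq_bigr => e _; rewrite ffunE.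
  exists (fun f : {ffun {set 'I_n} -> bool} => [set e | f e]) => [E|f] _.
    by apply/setP => e; rewrite inE ffunE.
  by apply/ffunP => e; rewrite ffunE /= inE.
rewrite (bigID (fun E : {set {set 'I_n}} => E \subset pairs)) /=.
rewrite [X in _ = _ + X]big1 => [|E /subsetPn[e eE eP]]; last first.
  by rewrite /T (bigD1 e) //= eE /F (negbTE eP) mul0r.
rewrite addr0 /mean.
transitivity (\sum_(G : graph) T (edges G)); last first.
  rewrite (reindex_omap (val : graph -> {set {set 'I_n}}) insub) => [|E EP]; last first.
    by rewrite insubT.
  by apply: eq_bigl => -[E EP]; rewrite /= insubT EP /= eqxx.
apply: eq_bigr => G _; rewrite /Gnp -big_split /= [LHS]big_mkcond /T.
apply: eq_bigr => e _; rewrite /F /K /edges.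
have := valP G => /= /subsetP /(_ e).
by case: ifP => [_ _|_ H]; case: ifP => // /H.
Qed.

Lemma mean_prod_on (S : {set {set 'I_n}}) (g : {set 'I_n} -> bool -> R) :
  S \subset pairs ->
  mean (fun G => \prod_(e in S) g e (e \in edges G)) =
  \prod_(e in S) (p * g e true + (1 - p) * g e false).
Proof.
move=> SP; pose h e b := if e \in S then g e b else 1.
have E F : \prod_(e in S) F e = \prod_(e in pairs) (if e \in S then F e else 1) :> R.
  rewrite -big_mkcondr; apply: eq_bigl => e.
  by case: (boolP (e \in S)) => [/(subsetP SP)->|]; rewrite ?andbF.
rewrite E; transitivity (\prod_(e in pairs) (p * h e true + (1 - p) * h e false)).
  by rewrite -mean_prod; apply: eq_bigr => G _; rewrite E.
by apply: eq_bigr => e _; rewrite /h; case: ifP => // _; rewrite !mulr1 addrC subrK.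
Qed.

Lemma mean_cst (c : R) : mean (fun=> c) = c.
Proof.
have := mean_prod_on (fun _ _ => 1) (sub0set pairs).
rewrite !big_set0 /mean => E; rewrite -mulr_suml -[RHS]mul1r; congr (_ * _).
by rewrite -[RHS]E; apply: eq_bigr => G _; rewrite mulr1.
Qed.

Lemma mean_sum (I : finType) (P : pred I) (f : I -> graph -> R) :
  mean (fun G => \sum_(i | P i) f i G) = \sum_(i | P i) mean (f i).
Proof.
by rewrite /mean exchange_big; apply: eq_bigr => G _; rewrite mulr_sumr.
Qed.

Lemma meanZ c (f : graph -> R) : mean (fun G => c * f G) = c * mean f.
Proof. by rewrite /mean mulr_sumr; apply: eq_bigr => G _; rewrite mulrCA. Qed.

Lemma meanD (f g : graph -> R) : mean (fun G => f G + g G) = mean f + mean g.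
Proof. by rewrite /mean -big_split; apply: eq_bigr => G _; rewrite mulrDr. Qed.

Lemma eq_mean (f g : graph -> R) : f =1 g -> mean f = mean g.
Proof. by move=> E; apply: eq_bigr => G _; rewrite E. Qed.

Lemma mean_indic (P : pred graph) :
  mean (fun G => (P G)%:R) = \sum_(G | P G) Gnp p G.
Proof.
by rewrite [RHS]big_mkcond; apply: eq_bigr => G _; case: (P G); rewrite ?mulr1 ?mulr0.
Qed.

Lemma mean_subset (S : {set {set 'I_n}}) : S \subset pairs ->
  mean (fun G => (S \subset edges G)%:R) = p ^+ #|S|.
Proof.
move=> SP; rewrite -prodr_const; transitivity (\prod_(e in S) (p * true%:R + (1 - p) * false%:R)).
  rewrite -(@mean_prod_on S (fun _ b => b%:R)) //; apply: eq_mean => G.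
  have [/subsetP SG|/subsetPn[e eS eG]] := boolP (S \subset edges G).
    by rewrite big1 // => e /SG ->.
  by rewrite (bigD1 e) //= (negbTE eG) mul0r.
by apply: eq_bigr => e _; rewrite mulr1 mulr0 addr0.
Qed.

Hypothesis p01 : 0 <= p <= 1.

Lemma Gnp_ge0 (G : graph) : 0 <= Gnp p G.
Proof.
case/andP: p01 => p0 p1; apply: prodr_ge0 => e _; case: ifP => // _; lra.
Qed.

Lemma le_mean (f g : graph -> R) : (forall G, f G <= g G) -> mean f <= mean g.
Proof. by move=> H; apply: ler_sum => G _; rewrite ler_wpM2l ?Gnp_ge0. Qed.

Lemma markov_mean (f : graph -> R) (t : R) : (forall G, 0 <= f G) ->
  t * mean (fun G => (t < f G)%R%:R) <= mean f.
Proof.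
move=> f0; rewrite -meanZ; apply: le_mean => G.
by case: ltP => [/ltW|]; rewrite ?mulr1 ?mulr0.
Qed.

End RandomGraph.

(** * Copies of H and their expected number *)

Section Copies.
Variables (R : realType) (V W : finType) (H : sgraph V).

Definition copy (G : sgraph W) (psi : {ffun V -> W}) : bool :=
  injectiveb psi && [forall u, forall v, adj G (psi u) (psi v) == adj H u v].

Lemma count_copiesE (G : sgraph W) : count_copies H G = #|[set psi | copy G psi]|.
Proof. by []. Qed.

Lemma in_pairs (T : finType) (u v : T) : ([set u; v] \in pairs_of T) = (u != v).
Proof. by rewrite inE cards2; case: (u != v). Qed.

Lemma pairsP (T : finType) (e : {set T}) :
  reflect (exists2 x : T * T, x.1 != x.2 & e = [set x.1; x.2]) (e \in pairs_of T).
Proof.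
rewrite inE; apply: (iffP (cards2P e)) => [[x [y [xy ->]]]|[[x y] /= xy ->]].
  by exists (x, y).
by exists x, y.
Qed.

Lemma edges_pairs (T : finType) (G : sgraph T) : edges G \subset pairs_of T.
Proof. exact: (valP G). Qed.

Lemma imset2set (psi : V -> W) u v : psi @: [set u; v] = [set psi u; psi v].
Proof. by rewrite imsetU !imset_set1. Qed.

Lemma adj_irr (T : finType) (G : sgraph T) u : adj G u u = false.
Proof.
apply/negbTE/negP => /(subsetP (edges_pairs G)).
by rewrite in_pairs eqxx.
Qed.

Lemma copyE (G : sgraph W) (psi : {ffun V -> W}) :
  copy G psi = injectiveb psi &&
    [forall e in pairs_of V, (psi @: e \in edges G) == (e \in edges H)].
Proof.
rewrite /copy; congr (_ && _); apply/forallP/forallP => E.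
  move=> e; apply/implyP => /pairsP[[u v] /= _ ->].
  by have /forallP/(_ v) := E u; rewrite /adj imset2set.
move=> u; apply/forallP => v; have [->|uv] := eqVneq u v; first by rewrite !adj_irr.
by have := E [set u; v]; rewrite in_pairs uv imset2set.
Qed.

(** Makes injectivity a condition on each pair separately, so that the indicator of a copy becomes a
    product over pairs in [copy_prod]. *)
Lemma injectiveb_pairs (psi : {ffun V -> W}) :
  injectiveb psi = [forall e in pairs_of V, psi @: e \in pairs_of W].
Proof.
apply/injectiveP/forallP => [I e|I u v].
  by apply/implyP; rewrite !inE card_imset.
apply: contra_eq => uv; have := I [set u; v].
by rewrite in_pairs uv imset2set in_pairs.
Qed.

Lemma prod_indic (I : finType) (P Q : pred I) :
  \prod_(i | P i) (Q i)%:R = [forall (i | P i), Q i]%:R :> R.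
Proof.
case: (boolP [forall (i | P i), Q i]) => [/forallP A|].
  by rewrite big1 // => i Pi; have /implyP/(_ Pi) := A i => ->.
rewrite negb_forall => /existsP[i]; rewrite negb_imply => /andP[Pi Qi].
by rewrite (bigD1 i) //= (negbTE Qi) mul0r.
Qed.

Lemma copy_prod (G : sgraph W) (psi : {ffun V -> W}) :
  (copy G psi)%:R = \prod_(e in pairs_of V)
   ((psi @: e \in pairs_of W) && ((psi @: e \in edges G) == (e \in edges H)))%:R :> R.
Proof.
rewrite prod_indic copyE injectiveb_pairs; congr (_ %:R); congr nat_of_bool.
apply/andP/forallP => [[/forallP A /forallP B] e|A].
  by apply/implyP => eP; have := A e; have := B e; rewrite eP /= => -> ->.
by split; apply/forallP => e; apply/implyP => eP;
  have := A e; rewrite eP /= => /andP[].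
Qed.

End Copies.

Definition pinj (V W : finType) : nat := #|[set psi : {ffun V -> W} | injectiveb psi]|.

Section MeanCopies.
Variables (R : realType) (V : finType) (H : sgraph V) (n : nat) (p : R).

Definition copy_prob : R :=
  p ^+ #|edges H| * (1 - p) ^+ #|pairs_of V :\: edges H|.

Lemma prod_edges (x y : R) :
  \prod_(e in pairs_of V) (if e \in edges H then x else y) =
  x ^+ #|edges H| * y ^+ #|pairs_of V :\: edges H|.
Proof.
rewrite (bigID (mem (edges H))) /= -!prodr_const; congr (_ * _).
  apply: eq_big => [e|e /andP[_ ->] //]; rewrite /= andbC.
  by case: (boolP (e \in edges H)) => // /(subsetP (edges_pairs H)).
by apply: eq_big => [e|e /andP[_ /negbTE->] //]; rewrite in_setD andbC.
Qed.

Lemma mean_copies :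
  mean p (fun G : sgraph 'I_n => (count_copies H G)%:R) = copy_prob * (pinj V 'I_n)%:R.
Proof.
transitivity (\sum_(psi : {ffun V -> 'I_n}) mean p (fun G => (copy H G psi)%:R)).
  rewrite -mean_sum; apply: eq_mean => G; rewrite count_copiesE -sum1_card natr_sum.
  by rewrite big_mkcond; apply: eq_bigr => psi _; rewrite inE; case: copy.
rewrite /pinj mulr_natr -sumr_const [RHS]big_mkcond; apply: eq_bigr => psi _.
rewrite inE; case: ifP => [/injectiveP I|NI]; last first.
  rewrite -[RHS](mean_cst n p); apply: eq_mean => G.
  by rewrite /copy NI.
have SP : [set psi @: (e : {set V}) | e in pairs_of V] \subset pairs_of 'I_n.
  by apply/subsetP => _ /imsetP[e eP ->]; move: eP; rewrite !inE card_imset.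
have IN : {in pairs_of V &, injective (fun e : {set V} => psi @: e)}.
  by move=> e f _ _; exact: imset_inj.
(* The requirement on a pair of ['I_n] is read off its preimage under [psi], which is unique because
   [psi] is injective. *)
pose g (e' : {set 'I_n}) b : R :=
  ([exists e in pairs_of V, (e' == psi @: e) && (e \in edges H)] == b)%:R.
have gE e b : e \in pairs_of V -> g (psi @: e) b = ((e \in edges H) == b)%:R.
  move=> eP; rewrite /g; do 3 f_equal; apply/existsP/idP => [[f /and3P[fP /eqP E fH]]|eH].
    by rewrite (imset_inj I E).
  by exists e; rewrite eP eqxx.
transitivity (\prod_(e in pairs_of V) (if e \in edges H then p else 1 - p)); last exact: prod_edges.
transitivity (\prod_(e in pairs_of V) (p * g (psi @: e) true + (1 - p) * g (psi @: e) false)); last first.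
  by apply: eq_bigr => e eP; rewrite !gE //; case: (_ \in _); rewrite /= ?mulr1 ?mulr0 ?addr0 ?add0r.
rewrite -(big_imset (fun e => p * g e true + (1 - p) * g e false) IN) /=.
rewrite -mean_prod_on //; apply: eq_mean => G; rewrite copy_prod.
rewrite (big_imset (fun e => g e (e \in edges G)) IN) /=.
apply: eq_bigr => e eP; rewrite gE // eq_sym.
by rewrite (subsetP SP) // imset_f.
Qed.

End MeanCopies.

(** * Counting copies in pseudorandom graphs *)

Section CauchySchwarz.
Variable R : realType.

Lemma sum_cauchy_schwarz (I : finType) (a b : I -> R) :
  (\sum_i a i * b i) ^+ 2 <= (\sum_i a i ^+ 2) * (\sum_i b i ^+ 2).
Proof.
have : 0 <= \sum_i \sum_j (a i * b j - a j * b i) ^+ 2.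
  by apply: sumr_ge0 => i _; apply: sumr_ge0 => j _; apply: sqr_ge0.
suff -> : \sum_i \sum_j (a i * b j - a j * b i) ^+ 2 =
   2 * ((\sum_i a i ^+ 2) * (\sum_i b i ^+ 2) - (\sum_i a i * b i) ^+ 2) by lra.
transitivity (\sum_i \sum_j (a i ^+ 2 * b j ^+ 2 + b i ^+ 2 * a j ^+ 2
     - 2 * (a i * b i) * (a j * b j))).
  by apply: eq_bigr => i _; apply: eq_bigr => j _; ring.
under eq_bigr do rewrite big_split big_split /= sumrN -!mulr_sumr.
rewrite !big_split /= sumrN -!mulr_suml -mulr_sumr; ring.
Qed.

Lemma sum_sqrt_le (I : finType) (a b : I -> R) :
  (forall i, 0 <= a i) -> (forall i, 0 <= b i) ->
  \sum_i Num.sqrt (a i * b i) <= Num.sqrt ((\sum_i a i) * (\sum_i b i)).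
Proof.
move=> a0 b0.
have L0 : 0 <= \sum_i Num.sqrt (a i * b i) by apply: sumr_ge0 => i _; apply: sqrtr_ge0.
rewrite -(ger0_norm L0) -sqrtr_sqr ler_wsqrtr //.
have := sum_cauchy_schwarz (fun i => Num.sqrt (a i)) (fun i => Num.sqrt (b i)).
under eq_bigr do rewrite -sqrtrM //.
by under [X in _ <= X * _]eq_bigr do rewrite sqr_sqrtr //;
   under [X in _ <= _ * X]eq_bigr do rewrite sqr_sqrtr //.
Qed.

Variables (W : finType) (B : W -> W -> R).

(** The trace of [(B B^T)^2], that is the fourth power of the Schatten 4-norm of [B]. *)
Definition c4 : R :=
  \sum_x \sum_x' \sum_y \sum_y' B x y * B x' y * B x y' * B x' y'.

Lemma c4E : c4 = \sum_y \sum_y' (\sum_x B x y * B x y') ^+ 2.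
Proof.
rewrite /c4; under eq_bigr do rewrite exchange_big.
rewrite exchange_big; apply: eq_bigr => y _.
under eq_bigr do rewrite exchange_big.
rewrite exchange_big; apply: eq_bigr => y' _.
rewrite expr2 mulr_suml; apply: eq_bigr => x _.
by rewrite mulr_sumr; apply: eq_bigr => x' _; ring.
Qed.

Lemma c4_ge0 : 0 <= c4.
Proof.
by rewrite c4E; apply: sumr_ge0 => y _; apply: sumr_ge0 => y' _; apply: sqr_ge0.
Qed.

(** Cauchy-Schwarz twice: over [x] it separates [f] from [Z]; then [Z], expanded over pairs
    [(y, y')], is a sum of codegrees times [g y * g y'], and the squares of the codegrees sum to
    [c4] by [c4E]. *)
Lemma bilinear_c4 (f g : W -> R) :
  (\sum_x \sum_y B x y * f x * g y) ^+ 4 <=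
  c4 * ((\sum_x f x ^+ 2) * (\sum_y g y ^+ 2)) ^+ 2.
Proof.
set F := \sum_x f x ^+ 2; set K := \sum_y g y ^+ 2.
pose Z := \sum_x (\sum_y B x y * g y) ^+ 2.
have F0 : 0 <= F by apply: sumr_ge0 => x _; apply: sqr_ge0.
have Z0 : 0 <= Z by apply: sumr_ge0 => x _; apply: sqr_ge0.
have H1 : (\sum_x \sum_y B x y * f x * g y) ^+ 2 <= F * Z.
  have -> : \sum_x \sum_y B x y * f x * g y = \sum_x f x * (\sum_y B x y * g y).
    by apply: eq_bigr => x _; rewrite mulr_sumr; apply: eq_bigr => y _; ring.
  exact: sum_cauchy_schwarz.
have H2 : Z ^+ 2 <= c4 * K ^+ 2.
  have ZE : Z = \sum_(q : W * W) (\sum_x B x q.1 * B x q.2) * (g q.1 * g q.2).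
    rewrite -(pair_bigA _ (fun y y' => (\sum_x B x y * B x y') * (g y * g y'))) /=.
    under [RHS]eq_bigr do under eq_bigr do rewrite mulr_suml.
    under [RHS]eq_bigr do rewrite exchange_big.
    rewrite [RHS]exchange_big; apply: eq_bigr => x _.
    rewrite expr2 mulr_suml; apply: eq_bigr => y _; rewrite mulr_sumr.
    by apply: eq_bigr => y' _; ring.
  rewrite ZE; apply: le_trans (sum_cauchy_schwarz _ _) _.
  rewrite le_eqVlt; apply/orP; left; apply/eqP; congr (_ * _).
    by rewrite c4E (pair_bigA _ (fun y y' => (\sum_x B x y * B x y') ^+ 2)).
  rewrite -(pair_bigA _ (fun y y' => (g y * g y') ^+ 2)) /= expr2 mulr_suml.
  by apply: eq_bigr => y _; rewrite mulr_sumr; apply: eq_bigr => y' _; ring.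
rewrite (_ : 4%N = (2 * 2)%N) // exprM.
apply: le_trans (_ : (F * Z) ^+ 2 <= _); first by rewrite ler_pXn2r ?nnegrE ?sqr_ge0 ?mulr_ge0.
by rewrite !exprMn [leRHS]mulrCA ler_wpM2l ?sqr_ge0.
Qed.

Lemma bilinear_le (f g : W -> R) :
  `|\sum_x \sum_y B x y * f x * g y| <=
  Num.sqrt (Num.sqrt c4) * Num.sqrt ((\sum_x f x ^+ 2) * (\sum_y g y ^+ 2)).
Proof.
have := bilinear_c4 f g; set S := \sum_x _.
set D : R := (\sum_x f x ^+ 2) * _ => H.
have D0 : 0 <= D by rewrite mulr_ge0 ?sumr_ge0 // => x _; apply: sqr_ge0.
rewrite -sqrtrM ?sqrtr_ge0 // -sqrtr_sqr ler_wsqrtr //.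
rewrite -[leLHS]ger0_norm ?sqr_ge0 // -sqrtr_sqr -[in leRHS](ger0_norm D0) -(sqrtr_sqr D).
by rewrite -sqrtrM ?c4_ge0 // ler_wsqrtr // -exprM.
Qed.

End CauchySchwarz.

Section Resampling.
Variables (R : pzSemiRingType) (V W : finType).

Definition setf (psi : {ffun V -> W}) (u : V) (x : W) : {ffun V -> W} :=
  [ffun w => if w == u then x else psi w].

Lemma setf_same psi u x : setf psi u x u = x.
Proof. by rewrite ffunE eqxx. Qed.

Lemma setf_other psi u x w : w != u -> setf psi u x w = psi w.
Proof. by rewrite ffunE => /negbTE->. Qed.

Lemma setf_setf psi u x y : setf (setf psi u x) u y = setf psi u y.
Proof. by apply/ffunP => w; rewrite !ffunE; case: eqP. Qed.

Lemma setf_id psi u : setf psi u (psi u) = psi.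
Proof. by apply/ffunP => w; rewrite !ffunE; case: eqP => [->|]. Qed.

Lemma imset_setf psi u x (e : {set V}) : u \notin e -> setf psi u x @: e = psi @: e.
Proof.
move=> ue; apply: eq_in_imset => w we; rewrite setf_other //.
by apply: contraNneq ue => <-.
Qed.

(* Replaces a sum over maps by a sum in which the value at one vertex is drawn anew,
   so that the rest of the map can be held fixed without restricting its domain. *)
Lemma sum_resample (h : {ffun V -> W} -> R) u :
  \sum_psi \sum_x h (setf psi u x) = #|W|%:R * \sum_psi h psi.
Proof.
rewrite mulr_natl -sumr_const exchange_big pair_bigA [RHS]pair_bigA /=.
rewrite (reindex_onto (fun q : W * {ffun V -> W} => (q.2 u, setf q.2 u q.1))
           (fun q => (q.2 u, setf q.2 u q.1))) /=.
  apply: eq_big => [[x psi]|[x psi] _] /=.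
    by rewrite setf_same setf_setf setf_id eqxx.
  by rewrite setf_setf setf_id.
by case=> x psi _ /=; rewrite setf_same setf_setf setf_id.
Qed.

End Resampling.

Section Cut.
Variables (R : realType) (V W : finType) (B : {set W} -> R).
Variables (h : {set V} -> {set W} -> R) (F : {set {set V}}) (u v : V).
Hypotheses (h01 : forall f e, 0 <= h f e <= 1) (uv : u != v).
Hypotheses (FP : F \subset pairs_of V) (eF : [set u; v] \notin F) (W0 : (0 < #|W|)%N).

Let pr (P : pred {set V}) (psi : {ffun V -> W}) : R :=
  \prod_(f in F | P f) h f (psi @: f).

Let pr_ge0 P psi : 0 <= pr P psi.
Proof. by apply: prodr_ge0 => f _; case/andP: (h01 f (psi @: f)). Qed.

Let pr_le1 P psi : pr P psi <= 1.
Proof. by apply: prodr_ile1 => f _. Qed.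

Let pr_setf (P : pred {set V}) psi w x : (forall f, P f -> w \notin f) -> pr P (setf psi w x) = pr P psi.
Proof. by move=> H; apply: eq_bigr => f /andP[_ /H wf]; rewrite imset_setf. Qed.

(** Fix the map off [u] and [v]. As the pair [[set u; v]] is not in [F], every factor sees at most
    one of the two values, so the sum over these values is a bilinear form in [B] and [bilinear_le]
    applies. Cauchy-Schwarz over the rest of the map gives the geometric mean. *)
Lemma cut_bound :
  `|\sum_(psi : {ffun V -> W}) B (psi @: [set u; v]) * \prod_(f in F) h f (psi @: f)| <=
  Num.sqrt (Num.sqrt (c4 (fun x y => B [set x; y]))) / #|W|%:R *
  Num.sqrt ((\sum_(psi : {ffun V -> W}) \prod_(f in F | v \notin f) h f (psi @: f)) *
            (\sum_(psi : {ffun V -> W}) \prod_(f in F | u \notin f) h f (psi @: f))).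
Proof.
set L := Num.sqrt (Num.sqrt _); set n : R := #|W|%:R.
have n0 : 0 < n by rewrite ltr0n.
pose P0 (f : {set V}) := (u \notin f) && (v \notin f).
pose Pu (f : {set V}) := u \in f.
pose Pv (f : {set V}) := v \in f.
have FE f : f \in F -> ~~ (Pu f && Pv f).
  move=> fF; apply/negP => /andP[uf vf]; case/negP: eF.
  have /eqP -> // : [set u; v] == f.
  rewrite eqEcard cards2 uv; apply/andP; split; last first.
    by have := subsetP FP _ fF; rewrite inE => /eqP->.
  by apply/subsetP => w; rewrite !inE => /orP[] /eqP->.
have prE (psi : {ffun V -> W}) : \prod_(f in F) h f (psi @: f) =
    pr P0 psi * pr [pred f | Pu f && (v \notin f)] psi * pr [pred f | Pv f && (u \notin f)] psi.
  rewrite (bigID Pu) /= [X in _ * X](bigID Pv) /= mulrA mulrC mulrA.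
  congr (_ * _ * _).
  + by apply: eq_bigl => f; rewrite /P0 /Pu /Pv; case: (f \in F).
  + apply: eq_bigl => f; rewrite /= /Pv; case: (boolP (f \in F)) => // /FE.
    by rewrite /Pu /Pv; case: (u \in f); case: (v \in f).
  + by apply: eq_bigl => f; rewrite /= /Pv /Pu; case: (f \in F) => //=; rewrite andbC.
have prv (psi : {ffun V -> W}) : \prod_(f in F | v \notin f) h f (psi @: f) =
    pr P0 psi * pr [pred f | Pu f && (v \notin f)] psi.
  rewrite (bigID Pu) /= mulrC; congr (_ * _); apply: eq_bigl => f; rewrite /P0 /Pu /=;
  by case: (f \in F); case: (u \in f); case: (v \in f).
have pru (psi : {ffun V -> W}) : \prod_(f in F | u \notin f) h f (psi @: f) =
    pr P0 psi * pr [pred f | Pv f && (u \notin f)] psi.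
  rewrite (bigID Pv) /= mulrC; congr (_ * _); apply: eq_bigl => f; rewrite /P0 /Pv /=;
  by case: (f \in F); case: (u \in f); case: (v \in f).
set Qu := pr [pred f | Pu f && (v \notin f)] in prE prv.
set Qv := pr [pred f | Pv f && (u \notin f)] in prE pru.
set S := \sum_psi _; set U := \sum_psi _; set U' := \sum_(psi : {ffun V -> W}) _.
have SE : n ^+ 2 * S = \sum_psi \sum_x \sum_y pr P0 psi *
      (B [set x; y] * Qu (setf psi u x) * Qv (setf psi v y)).
  rewrite expr2 -mulrA /S -(sum_resample _ v) -(sum_resample _ u).
  apply: eq_bigr => psi _; apply: eq_bigr => x _; apply: eq_bigr => y _.
  rewrite prE imset2set setf_same setf_other // setf_same.
  rewrite [pr P0 _]pr_setf; last by move=> f /andP[].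
  rewrite [pr P0 _]pr_setf; last by move=> f /andP[].
  rewrite [Qu _]pr_setf; last by move=> f /andP[].
  suff -> : Qv (setf (setf psi u x) v y) = Qv (setf psi v y) by rewrite -/Qu; ring.
  have -> : setf (setf psi u x) v y = setf (setf psi v y) u x.
    apply/ffunP => w; rewrite !ffunE; case: eqP => // ->; rewrite eq_sym.
    by rewrite (negbTE uv).
  by rewrite [Qv _]pr_setf // => f /andP[].
pose al (psi : {ffun V -> W}) := \sum_x pr P0 psi * Qu (setf psi u x).
pose be (psi : {ffun V -> W}) := \sum_y pr P0 psi * Qv (setf psi v y).
have al0 (psi : {ffun V -> W}) : 0 <= al psi by apply: sumr_ge0 => x _; apply: mulr_ge0; apply: pr_ge0.
have be0 (psi : {ffun V -> W}) : 0 <= be psi by apply: sumr_ge0 => x _; apply: mulr_ge0; apply: pr_ge0.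
have sumal : \sum_psi al psi = n * U.
  rewrite -(sum_resample _ u); apply: eq_bigr => psi _; apply: eq_bigr => x _.
  by rewrite prv [pr P0 (setf _ _ _)]pr_setf // => f /andP[].
have sumbe : \sum_psi be psi = n * U'.
  rewrite -(sum_resample _ v); apply: eq_bigr => psi _; apply: eq_bigr => x _.
  by rewrite pru [pr P0 (setf _ _ _)]pr_setf // => f /andP[].
have sq1 (t : R) : 0 <= t -> t <= 1 -> t ^+ 2 <= t.
  by move=> t0 t1; rewrite expr2 -[leRHS]mulr1 ler_wpM2l.
have : `|n ^+ 2 * S| <= \sum_psi L * Num.sqrt (al psi * be psi).
  rewrite SE; apply: le_trans (ler_norm_sum _ _ _) _; apply: ler_sum => psi _.
  under eq_bigr do rewrite -mulr_sumr.
  rewrite -mulr_sumr normrM (ger0_norm (pr_ge0 _ _)).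
  apply: le_trans (ler_wpM2l (pr_ge0 _ _) (bilinear_le _ _ _)) _.
  rewrite mulrCA ler_wpM2l ?sqrtr_ge0 //.
  rewrite -{1}(ger0_norm (pr_ge0 P0 psi)) -sqrtr_sqr -sqrtrM ?sqr_ge0 // ler_wsqrtr //.
  rewrite expr2 mulrACA; apply: ler_pM.
  + by rewrite mulr_ge0 ?pr_ge0 // sumr_ge0 // => x _; rewrite sqr_ge0.
  + by rewrite mulr_ge0 ?pr_ge0 // sumr_ge0 // => x _; rewrite sqr_ge0.
  + by rewrite mulr_sumr ler_sum // => x _; rewrite ler_wpM2l ?pr_ge0 //; apply: sq1; [apply: pr_ge0|apply: pr_le1].
  + by rewrite mulr_sumr ler_sum // => x _; rewrite ler_wpM2l ?pr_ge0 //; apply: sq1; [apply: pr_ge0|apply: pr_le1].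
rewrite -mulr_sumr normrM ger0_norm ?sqr_ge0 // => H.
have H2 : n ^+ 2 * `|S| <= L * (n * Num.sqrt (U * U')).
  apply: le_trans H _; rewrite ler_wpM2l ?sqrtr_ge0 //.
  apply: le_trans (sum_sqrt_le al0 be0) _; rewrite sumal sumbe mulrACA -expr2.
  by rewrite sqrtrM ?sqr_ge0 // sqrtr_sqr gtr0_norm.
rewrite mulrAC ler_pdivlMr // -(ler_pM2l n0).
have -> : n * (`|S| * n) = n ^+ 2 * `|S| by ring.
by have -> : n * (L * Num.sqrt (U * U')) = L * (n * Num.sqrt (U * U')) by ring.
Qed.

End Cut.

Lemma ler_prod_sub (R : realType) (I : finType) (P Q : pred I) (w c : I -> R) :
  (forall i, 0 <= w i <= 1) -> (forall i, Q i -> P i && (w i <= c i)) ->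
  \prod_(i | P i) w i <= \prod_(i | Q i) c i.
Proof.
move=> w01 H; rewrite (bigID Q) /= -[leRHS]mulr1; apply: ler_pM.
- by apply: prodr_ge0 => i _; case/andP: (w01 i).
- by apply: prodr_ge0 => i _; case/andP: (w01 i).
- rewrite (eq_bigl Q) => [|i]; last by case: (boolP (Q i)) => [/H /andP[->]|]; rewrite ?andbF.
  by apply: ler_prod => i /H /andP[_ ->]; case/andP: (w01 i) => ->.
- exact: prodr_ile1.
Qed.

Lemma hom_step_arith (R : realType) (q M S h eta p : R) :
  0 <= M -> 0 <= eta <= 1 -> 0 <= p -> 0 <= q ->
  h <= p * (q * M) -> S <= eta / 2 * (2 * p * q) * M -> h + S <= 2 * p * q * M.
Proof.
move=> M0 /andP[eta0 e1] p0 q0 H5 H4.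
have Q1 : 0 <= p * (q * M) by rewrite !mulr_ge0.
have Q2 : eta * (p * (q * M)) <= p * (q * M) by rewrite ler_piMl.
have E : eta / 2 * (2 * p * q) * M = eta * (p * (q * M)) by field.
rewrite E in H4.
have -> : 2 * p * q * M = 2 * (p * (q * M)) by ring.
lra.
Qed.

Lemma pattern_step_arith (R : realType) (q M j eta p : R) :
  0 <= M -> 0 <= q -> 0 <= j -> 0 <= eta -> 0 <= p ->
  p * (j * eta * q * M) + eta * (2 * p * q) * M <= (j + 1) * eta * (2 * p * q) * M.
Proof.
move=> *; rewrite -subr_ge0 (_ : _ - _ = j * eta * (p * q) * M); last by ring.
by rewrite !mulr_ge0.
Qed.

Definition deg_in (V : finType) (F : {set {set V}}) (u : V) : nat :=
  #|[set f in F | u \in f]|.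

(** Degeneracy of the line graph in disguise: the sum of the two degrees exceeds by 2 the number of
    edges of [F] adjacent to [[set u; v]]. *)
Definition sparse_edges (V : finType) (H : sgraph V) (b : nat) : Prop :=
  forall F : {set {set V}}, F \subset edges H -> F != set0 ->
  exists u v, [/\ u != v, [set u; v] \in F & (deg_in F u + deg_in F v <= b)%N].

Section Counting.
Variables (R : realType) (V W : finType) (H : sgraph V) (G : sgraph W).
Variables (p eta : R) (b : nat).

Definition centered (e : {set W}) : R :=
  if e \in pairs_of W then (e \in edges G)%:R - p else 0.

Definition c4_graph : R := c4 (fun x y => centered [set x; y]).

Hypotheses (p01 : 0 <= p <= 1) (eta01 : 0 <= eta <= 1) (W0 : (0 < #|W|)%N).
Hypothesis sparse : sparse_edges H b.
Hypothesis c4_small : c4_graph <= eta ^+ 4 * p ^+ (2 * b) * #|W|%:R ^+ 4.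

Let lam : R := Num.sqrt (Num.sqrt c4_graph) / #|W|%:R.
Let N : R := #|W|%:R ^+ #|V|.
Let n0 : 0 < #|W|%:R :> R. Proof. by rewrite ltr0n. Qed.
Let p0 : 0 <= p. Proof. by case/andP: p01. Qed.
Let e0 : 0 <= eta. Proof. by case/andP: eta01. Qed.
Let N0 : 0 <= N. Proof. by rewrite exprn_ge0 // ltW. Qed.
Let lam0 : 0 <= lam. Proof. by rewrite divr_ge0 ?sqrtr_ge0 // ltW. Qed.

(** Stated for the square because [b] may be odd, when [p ^ (b / 2)] is not an integer power. *)
Lemma lam_sqr_le : lam ^+ 2 <= eta ^+ 2 * p ^+ b.
Proof.
rewrite /lam expr_div_n sqr_sqrtr ?sqrtr_ge0 // ler_pdivrMr ?exprn_gt0 //.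
have D0 : 0 <= eta ^+ 2 * p ^+ b * #|W|%:R ^+ 2.
  by rewrite !mulr_ge0 ?exprn_ge0 // ltW.
rewrite -(ger0_norm D0) -sqrtr_sqr ler_wsqrtr // (le_trans c4_small) //.
by rewrite (mulnC 2%N) exprM le_eqVlt; apply/orP; left; apply/eqP; ring.
Qed.

Lemma lam_le : lam <= eta.
Proof.
rewrite -(ler_pXn2r (n := 2)) ?nnegrE //; apply: le_trans lam_sqr_le _.
by rewrite ler_piMr ?sqr_ge0 // exprn_ile1 //; case/andP: p01.
Qed.

(** The exponent of [p] is [(b + a1 + a2) / 2], at least [m] because [d1 + d2 <= b]. The exponent of
    2 is [(a1 + a2) / 2], at most [m - 1] because [d1] and [d2] are positive. This saves the factor
    1/2, which leaves room for the main term [p * (2 * p) ^ (m - 1)] in [hom_le]. *)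
Lemma error_bound (m a1 d1 a2 d2 : nat) (U1 U2 : R) :
  (a1 + d1 = m)%N -> (a2 + d2 = m)%N -> (0 < d1)%N -> (0 < d2)%N -> (d1 + d2 <= b)%N ->
  0 <= U1 <= (2 * p) ^+ a1 * N -> 0 <= U2 <= (2 * p) ^+ a2 * N ->
  lam * Num.sqrt (U1 * U2) <= eta / 2 * (2 * p) ^+ m * N.
Proof.
move=> E1 E2 d10 d20 db.
have [X1 X2 X3] : [/\ (m + m <= b + (a1 + a2))%N, (a1 + a2 <= m + m - 2)%N &
    (m + m = (m + m - 2) + 2)%N].
  by move: E1 E2 d10 d20 db; clear; split; lia.
move=> /andP[U10 U1l] /andP[U20 U2l].
have M0 : 0 <= eta / 2 * (2 * p) ^+ m * N by rewrite !mulr_ge0 ?exprn_ge0 ?mulr_ge0 ?invr_ge0.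
rewrite -(ger0_norm lam0) -sqrtr_sqr -sqrtrM ?sqr_ge0 // -(ger0_norm M0) -sqrtr_sqr.
rewrite ler_wsqrtr //.
apply: le_trans (_ : eta ^+ 2 * p ^+ b * (((2 * p) ^+ a1 * N) * ((2 * p) ^+ a2 * N)) <= _).
  by rewrite ler_pM ?sqr_ge0 ?mulr_ge0 ?lam_sqr_le // ler_pM.
have -> : eta ^+ 2 * p ^+ b * ((2 * p) ^+ a1 * N * ((2 * p) ^+ a2 * N)) =
    (eta ^+ 2 * N ^+ 2) * (p ^+ (b + (a1 + a2)) * 2 ^+ (a1 + a2)).
  by rewrite !exprMn !exprD; ring.
have -> : (eta / 2 * (2 * p) ^+ m * N) ^+ 2 =
    (eta ^+ 2 * N ^+ 2) * (p ^+ (m + m) * (2 ^+ (m + m) / 4)).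
  by rewrite !exprMn !exprD; field.
rewrite ler_wpM2l ?mulr_ge0 ?sqr_ge0 // ler_pM ?exprn_ge0 //.
  by case/andP: p01 => _ p1; rewrite ler_wiXn2l.
have -> : 2 ^+ (m + m) / 4 = 2 ^+ (m + m - 2) :> R.
  by rewrite {1}X3 exprD; field.
by rewrite ler_weXn2l // ler1n.
Qed.

Definition hom (F : {set {set V}}) : R :=
  \sum_(psi : {ffun V -> W}) \prod_(f in F) (psi @: f \in edges G)%:R.

Let deg_inC (F : {set {set V}}) v : (#|[set f in F | v \notin f]| + deg_in F v = #|F|)%N.
Proof.
rewrite -(cardsID [set f : {set V} | v \in f] F) addnC; congr (_ + _)%N;
by apply: eq_card => f; rewrite !inE // andbC.
Qed.

Let deg_in_gt0 (F : {set {set V}}) (e : {set V}) v : e \in F -> v \in e -> (0 < deg_in F v)%N.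
Proof. by move=> eF ve; apply/card_gt0P; exists e; rewrite inE eF. Qed.

Let hom_ge0 F : 0 <= hom F.
Proof. by apply: sumr_ge0 => psi _; apply: prodr_ge0 => f _. Qed.

(* No injectivity is required of the maps: on the diagonal A = 0 <= p, which is the
   right direction for an upper bound. *)
Lemma hom_le (F : {set {set V}}) : F \subset edges H -> hom F <= (2 * p) ^+ #|F| * N.
Proof.
have [m] := ubnP #|F|; elim: m => // m IH in F *; rewrite ltnS => Fm FE.
have [->|F0] := eqVneq F set0.
  rewrite /hom cards0 expr0 mul1r; under eq_bigr do rewrite big_set0.
  by rewrite sumr_const card_ffun natrX.
have [u [v [uv eF db]]] := sparse FE F0.
set e := [set u; v] in eF.
have ue : u \in e by rewrite !inE eqxx.
have ve : v \in e by rewrite !inE eqxx orbT.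
have FP : F :\ e \subset pairs_of V.
  apply: subset_trans (edges_pairs H); apply: subset_trans FE; exact: subD1set.
have sub w : [set f in F | w \notin f] \subset edges H.
  by apply: subset_trans FE; apply/subsetP => f; rewrite inE => /andP[].
have D w : w \in e -> forall psi : {ffun V -> W},
   \prod_(f in F :\ e | w \notin f) (psi @: f \in edges G)%:R =
   \prod_(f in [set f in F | w \notin f]) (psi @: f \in edges G)%:R :> R.
  move=> we psi; apply: eq_bigl => f; rewrite !inE.
  by case: eqP => [->|]; rewrite ?we ?andbF.
have dv w : w \in e -> hom [set f in F | w \notin f] <=
    (2 * p) ^+ #|[set f in F | w \notin f]| * N.
  move=> we; apply: IH; last exact: sub.
  by move: (deg_inC F w) (deg_in_gt0 eF we) Fm; clear; lia.
have homD w : w \in e -> hom [set f in F | w \notin f] =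
    \sum_(psi : {ffun V -> W}) \prod_(f in F :\ e | w \notin f) (psi @: f \in edges G)%:R.
  by move=> we; apply: eq_bigr => psi _; rewrite D.
have CB : `|\sum_(psi : {ffun V -> W}) centered (psi @: e) *
       \prod_(f in F :\ e) (psi @: f \in edges G)%:R| <=
    lam * Num.sqrt (hom [set f in F | v \notin f] * hom [set f in F | u \notin f]).
  rewrite !homD //; apply: (cut_bound centered (h := fun _ e' => (e' \in edges G)%:R)) => //.
    by move=> f e'; case: (_ \in _); rewrite ?lexx ?ler01.
  by rewrite setD11.
have H1 : hom F <= p * hom (F :\ e) +
   \sum_(psi : {ffun V -> W}) centered (psi @: e) *
       \prod_(f in F :\ e) (psi @: f \in edges G)%:R.
  rewrite /hom mulr_sumr -big_split; apply: ler_sum => psi _.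
  rewrite (big_setD1 e eF) /= -mulrDl ler_wpM2r ?prodr_ge0 // /centered.
  case: ifP => [_|]; first by lra.
  by move=> /negP eP; case: (boolP (_ \in edges G)) => [/(subsetP (edges_pairs G))|_]; rewrite ?addr0.
apply: le_trans H1 _.
have cF : #|F| = #|F :\ e|.+1 by rewrite (cardsD1 e F) eF.
have H2 : hom (F :\ e) <= (2 * p) ^+ #|F :\ e| * N.
  by apply: IH; [rewrite -ltnS -cF|apply: subset_trans FE; apply: subD1set].
have H3 : `|\sum_(psi : {ffun V -> W}) centered (psi @: e) *
       \prod_(f in F :\ e) (psi @: f \in edges G)%:R| <= eta / 2 * (2 * p) ^+ #|F| * N.
  apply: le_trans CB _.
  apply: (error_bound (deg_inC F v) (deg_inC F u)); rewrite ?hom_ge0 ?dv //.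
  - exact: deg_in_gt0 eF ve.
  - exact: deg_in_gt0 eF ue.
  - by rewrite addnC.
have H4 := le_trans (ler_norm _) H3.
have H5 := ler_wpM2l p0 H2.
rewrite cF exprS in H4 *.
apply: hom_step_arith H5 H4 => //.
by rewrite exprn_ge0 ?mulr_ge0.
Qed.


(* F is the set of pairs still required to be edges, M the set of pairs still required
   to be non-edges; every other pair is only required to be mapped injectively. *)
Definition pattern_weight (F M : {set {set V}}) (f : {set V}) (e : {set W}) : R :=
  [&& e \in pairs_of W, (f \in F) ==> (e \in edges G) &
      (f \in M) ==> (e \notin edges G)]%:R.

Definition pattern_count (F M : {set {set V}}) : R :=
  \sum_(psi : {ffun V -> W}) \prod_(f in pairs_of V) pattern_weight F M f (psi @: f).

Let pw01 F M f e : 0 <= pattern_weight F M f e <= 1.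
Proof. by rewrite /pattern_weight; case: [&& _, _ & _]; rewrite ?lexx ler01. Qed.

Lemma pattern_cut (F M : {set {set V}}) (u v : V) : u != v ->
  `|\sum_(psi : {ffun V -> W}) centered (psi @: [set u; v]) *
     \prod_(f in pairs_of V :\ [set u; v]) pattern_weight F M f (psi @: f)| <=
  lam * Num.sqrt (hom [set f in F :&: pairs_of V | (v \notin f) && (f != [set u; v])] *
                  hom [set f in F :&: pairs_of V | (u \notin f) && (f != [set u; v])]).
Proof.
move=> uv; apply: le_trans (cut_bound centered (h := pattern_weight F M) _ uv _ _ W0) _ => //.
- exact: subD1set.
- by rewrite setD11.
rewrite ler_wpM2l //; apply: ler_wsqrtr.
have X w : 0 <= \sum_(psi : {ffun V -> W})
   \prod_(f in pairs_of V :\ [set u; v] | w \notin f) pattern_weight F M f (psi @: f) <=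
   hom [set f in F :&: pairs_of V | (w \notin f) && (f != [set u; v])].
  rewrite sumr_ge0 /= => [|psi _]; last by apply: prodr_ge0 => f _; case/andP: (pw01 F M f (psi @: f)).
  apply: ler_sum => psi _; apply: ler_prod_sub => f; first exact: pw01.
  rewrite in_set in_setI in_setD1 => /andP[/andP[fF fP] /andP[wf fe]].
  rewrite fe fP wf /= /pattern_weight fF /=.
  by case: (_ \in edges G); rewrite ?andbF // ler_nat leq_b1.
by case/andP: (X u) => ? ?; case/andP: (X v) => ? ?; apply: ler_pM.
Qed.

Let prod_pw F M (psi : {ffun V -> W}) e : e \in pairs_of V ->
  \prod_(f in pairs_of V) pattern_weight F M f (psi @: f) =
  pattern_weight F M e (psi @: e) *
  \prod_(f in pairs_of V :\ e) pattern_weight F M f (psi @: f).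
Proof. by move=> eP; rewrite (big_setD1 e). Qed.

(** Peels the edges in the order given by [sparse], keeping all the non-edges of [M]; each of the
    [#|F|] steps contributes at most [eta * (2 * p) ^ #|F| * N] once it is multiplied by the
    densities of the edges peeled before it. *)
Lemma pattern_edges (F M : {set {set V}}) : F \subset edges H -> [disjoint F & M] ->
  `|pattern_count F M - p ^+ #|F| * pattern_count set0 M| <=
  #|F|%:R * eta * (2 * p) ^+ #|F| * N.
Proof.
have [m] := ubnP #|F|; elim: m => // m IH in F *; rewrite ltnS => Fm FE FM.
have [->|F0] := eqVneq F set0; first by rewrite cards0 expr0 !mul1r subrr normr0 !mul0r.
have [u [v [uv eF db]]] := sparse FE F0.
have eP : [set u; v] \in pairs_of V by rewrite in_pairs.
have CB := pattern_cut (F :\ [set u; v]) M uv.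
set e := [set u; v] in eF eP CB *.
have ue : u \in e by rewrite !inE eqxx.
have ve : v \in e by rewrite !inE eqxx orbT.
have F'E : F :\ e \subset edges H by apply: subset_trans FE; apply: subD1set.
have F'M : [disjoint F :\ e & M] by apply: disjointWl FM; apply: subD1set.
have eM : e \notin M by move/pred0P: FM => /(_ e) /=; rewrite eF => /negbT.
have cF : #|F| = #|F :\ e|.+1 by rewrite (cardsD1 e F) eF.
have sub w : [set f in F | w \notin f] \subset edges H.
  by apply: subset_trans FE; apply/subsetP => f; rewrite inE => /andP[].
have D w : w \in e -> [set f in (F :\ e) :&: pairs_of V | (w \notin f) && (f != e)] =
   [set f in F | w \notin f].
  move=> we; apply/setP => f; rewrite in_set in_setI in_setD1 [RHS]in_set.
  case: eqP => [->|_]; rewrite ?we ?andbF //= andbT.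
  case: (boolP (f \in F)) => //= fF.
  by rewrite (subsetP (edges_pairs H)) // (subsetP FE).
rewrite !D // in CB.
have {}CB : `|\sum_(psi : {ffun V -> W}) centered (psi @: e) *
    \prod_(f in pairs_of V :\ e) pattern_weight (F :\ e) M f (psi @: f)| <=
    eta * (2 * p) ^+ #|F| * N.
  apply: le_trans CB _; apply: le_trans (_ : eta / 2 * (2 * p) ^+ #|F| * N <= _).
    apply: (error_bound (deg_inC F v) (deg_inC F u)); rewrite ?hom_ge0 ?hom_le //.
    - exact: deg_in_gt0 eF ve.
    - exact: deg_in_gt0 eF ue.
    - by rewrite addnC.
  rewrite ler_wpM2r // ler_wpM2r ?exprn_ge0 ?mulr_ge0 //; move: e0; lra.
(* Edge indicator = [p] + centered part. If [psi @: e] is not a pair, both sides vanish, since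
   [pattern_weight] tests for pairs even at an [e] outside [F] and [M]. *)
have E1 : pattern_count F M = p * pattern_count (F :\ e) M +
   \sum_(psi : {ffun V -> W}) centered (psi @: e) *
    \prod_(f in pairs_of V :\ e) pattern_weight (F :\ e) M f (psi @: f).
  rewrite /pattern_count mulr_sumr -big_split; apply: eq_bigr => psi _ /=.
  rewrite !(prod_pw _ _ _ eP).
  have -> : \prod_(f in pairs_of V :\ e) pattern_weight F M f (psi @: f) =
      \prod_(f in pairs_of V :\ e) pattern_weight (F :\ e) M f (psi @: f).
    apply: eq_bigr => f; rewrite in_setD1 => /andP[fe _].
    by rewrite /pattern_weight in_setD1 fe.
  rewrite mulrA -mulrDl; congr (_ * _).
  rewrite /pattern_weight setD11 eF (negbTE eM) /= !andbT /centered.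
  case: ifP => /= _; last by rewrite mulr0 addr0.
  by rewrite mulr1 addrC subrK.
rewrite {}E1.
have {}IH := IH (F :\ e) _ F'E F'M; rewrite -cF in IH.
move: (IH Fm) => {IH}.
set A := pattern_count _ _; set S := \sum_psi _ in CB *; set Z := pattern_count _ _ => IH.
rewrite cF exprS.
have E1 q : p * A + S - p * q * Z = p * (A - q * Z) + S by ring.
rewrite E1.
apply: le_trans (ler_normD _ _) _.
rewrite normrM (ger0_norm p0).
have {}IH := ler_wpM2l p0 IH.
apply: le_trans (lerD IH CB) _.
rewrite cF -(natr1 #|F :\ e|) exprS.
apply: pattern_step_arith => //; first by rewrite exprn_ge0 ?mulr_ge0.
Qed.

(** The error carries no power of [p], so [lam_le] suffices. The edges are already peeled, and
    [counting_lemma] multiplies this error by their density [p ^ #|edges H|]. *)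
Lemma pattern_nonedges (M : {set {set V}}) : M \subset pairs_of V ->
  `|pattern_count set0 M - (1 - p) ^+ #|M| * pattern_count set0 set0| <=
  #|M|%:R * eta * N.
Proof.
have [m] := ubnP #|M|; elim: m => // m IH in M *; rewrite ltnS => Mm MP.
have [->|/set0Pn[e eM]] := eqVneq M set0.
  by rewrite cards0 expr0 !mul1r subrr normr0 !mul0r.
have cM : #|M| = #|M :\ e|.+1 by rewrite (cardsD1 e M) eM.
have eP := subsetP MP _ eM.
have {}IH := IH (M :\ e); rewrite -cM in IH.
have {}IH := IH Mm (subset_trans (subD1set _ _) MP).
have CB : `|\sum_(psi : {ffun V -> W}) centered (psi @: e) *
    \prod_(f in pairs_of V :\ e) pattern_weight set0 (M :\ e) f (psi @: f)| <= eta * N.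
  have /pairsP[[u v] /= uv eE] := eP.
  rewrite eE; apply: le_trans (pattern_cut _ _ uv) _.
  have HN w : hom [set f in set0 :&: pairs_of V | (w \notin f) && (f != [set u; v])] = N.
    rewrite /hom (eq_bigr (fun=> 1)) => [|psi _].
      by rewrite sumr_const card_ffun natrX.
    by rewrite big1 // => f; rewrite in_set in_setI in_set0.
  by rewrite !HN -expr2 sqrtr_sqr ger0_norm // ler_wpM2r // lam_le.
have p1 : 0 <= 1 - p by case/andP: p01; lra.
have p1' : 1 - p <= 1 by move: p0; lra.
have E1 : pattern_count set0 M = (1 - p) * pattern_count set0 (M :\ e) -
   \sum_(psi : {ffun V -> W}) centered (psi @: e) *
    \prod_(f in pairs_of V :\ e) pattern_weight set0 (M :\ e) f (psi @: f).
  rewrite /pattern_count mulr_sumr -sumrB; apply: eq_bigr => psi _ /=.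
  rewrite !(prod_pw _ _ _ eP).
  have -> : \prod_(f in pairs_of V :\ e) pattern_weight set0 M f (psi @: f) =
      \prod_(f in pairs_of V :\ e) pattern_weight set0 (M :\ e) f (psi @: f).
    apply: eq_bigr => f; rewrite in_setD1 => /andP[fe _].
    by rewrite /pattern_weight in_setD1 fe.
  rewrite mulrA -mulrBl; congr (_ * _).
  rewrite /pattern_weight setD11 eM in_set0 /= /centered.
  case: ifP => /= _; last by rewrite mulr0 subr0.
  by case: (_ \in edges G); rewrite /= !mulr1 ?subr0; ring.
rewrite {}E1; move: IH CB.
set A := pattern_count _ _; set S := \sum_psi _; set Z := pattern_count _ _ => IH CB.
rewrite cM exprS.
have E1 q : (1 - p) * A - S - (1 - p) * q * Z = (1 - p) * (A - q * Z) - S by ring.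
rewrite E1.
apply: le_trans (ler_normB _ _) _.
rewrite normrM (ger0_norm p1).
have {}IH : (1 - p) * `|A - (1 - p) ^+ #|M :\ e| * Z| <= #|M :\ e|%:R * eta * N.
  by apply: le_trans IH; rewrite ler_piMl.
apply: le_trans (lerD IH CB) _.
by rewrite -(natr1 #|M :\ e|) !mulrDl mul1r.
Qed.

Lemma counting_lemma :
  `|(count_copies H G)%:R - copy_prob H p * (pinj V W)%:R| <=
  (#|edges H|%:R * 2 ^+ #|edges H| + #|pairs_of V :\: edges H|%:R) *
  eta * p ^+ #|edges H| * N.
Proof.
set M := pairs_of V :\: edges H.
have ET : pattern_count (edges H) M = (count_copies H G)%:R.
  rewrite count_copiesE -sum1_card natr_sum [RHS]big_mkcond; apply: eq_bigr => psi _.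
  rewrite inE (_ : (if _ then _ else _) = (copy H G psi)%:R :> R); last by case: copy.
  rewrite copy_prod; apply: eq_bigr => f fP; rewrite /pattern_weight in_setD fP andbT.
  by case: (f \in edges H); case: (_ \in edges G); case: (_ \in pairs_of W).
have E0 : pattern_count set0 set0 = (pinj V W)%:R.
  rewrite /pinj -sum1_card natr_sum [RHS]big_mkcond; apply: eq_bigr => psi _.
  rewrite inE injectiveb_pairs.
  rewrite (_ : (if _ then _ else _) = [forall e in pairs_of V, psi @: e \in pairs_of W]%:R :> R);
     last by case: ifP.
  transitivity (\prod_(e in pairs_of V) (psi @: e \in pairs_of W)%:R : R); last exact: prod_indic.
  apply: eq_bigr => f fP.
  by rewrite /pattern_weight !in_set0 /= andbT.
have dis : [disjoint edges H & M].
  by apply/pred0P => f /=; rewrite !inE; case: (_ \in edges H).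
have H1 := pattern_edges (subxx _) dis.
have H2 := pattern_nonedges (subsetDl _ _ : M \subset pairs_of V).
rewrite ET in H1; rewrite E0 in H2.
rewrite /copy_prob -/M.
have D (c q q' z x : R) : c - q * q' * z = (c - q * x) + q * (x - q' * z) by ring.
rewrite (D _ _ _ _ (pattern_count set0 M)).
apply: le_trans (ler_normD _ _) _.
rewrite normrM (ger0_norm (exprn_ge0 _ p0)).
apply: le_trans (lerD H1 (ler_wpM2l (exprn_ge0 _ p0) H2)) _.
have E (a x q m : R) : a * eta * (x * q) * N + q * (m * eta * N) = (a * x + m) * eta * q * N.
  by ring.
by rewrite exprMn E.
Qed.

End Counting.

(** * The tester *)

Section MeanC4.
Variables (R : realType) (n : nat) (p : R).
Hypothesis p01 : 0 <= p <= 1.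
Local Notation pairs := (pairs_of 'I_n).

Lemma centered_norm_le1 (G : sgraph 'I_n) e : `|centered G p e| <= 1.
Proof.
case/andP: p01 => p0 p1; rewrite /centered; case: ifP => _; last by rewrite normr0.
by case: (_ \in _); rewrite /= ?mulr1n ?mulr0n ler_norml; apply/andP; split; lra.
Qed.

(** The pair [e0] is independent of those in [s], which may repeat, and its own factor has mean 0.
    If some set is not a pair, the product vanishes identically. *)
Lemma mean_centered_prod (e0 : {set 'I_n}) (s : seq {set 'I_n}) : e0 \notin s ->
  mean p (fun G => centered G p e0 * \prod_(e <- s) centered G p e) = 0.
Proof.
move=> e0s; have [e0P|e0P] := boolP (e0 \in pairs); last first.
  by rewrite -[RHS](mean_cst n p); apply: eq_mean => G; rewrite /centered (negbTE e0P) mul0r.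
have [/allP sP|/allPn[e es /= eP]] := boolP (all (mem pairs) s); last first.
  rewrite -[RHS](mean_cst n p); apply: eq_mean => G.
  rewrite (_ : \prod_(e <- s) _ = 0) ?mulr0 //.
  by apply/eqP; rewrite prodf_seq_eq0; apply/hasP; exists e => //; rewrite /= /centered ifN ?eqxx.
pose c (b : bool) : R := b%:R - p.
pose g (e : {set 'I_n}) b : R :=
  (if e == e0 then c b else 1) * \prod_(e' <- s) (if e == e' then c b else 1).
have one e' (G : sgraph 'I_n) : e' \in pairs ->
    centered G p e' = \prod_(e in pairs) (if e == e' then c (e \in edges G) else 1).
  move=> e'P; rewrite (bigD1 e') //= eqxx /centered e'P big1 ?mulr1 // => e /andP[_ /negbTE->].
  by [].
transitivity (mean p (fun G : sgraph 'I_n => \prod_(e in pairs) g e (e \in edges G))).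
  apply: eq_mean => G; rewrite /g big_split /= -one //; congr (_ * _).
  by rewrite exchange_big; apply: eq_big_seq => e es; rewrite -one //; exact: sP.
rewrite mean_prod (bigD1 e0) //=.
have g0 b : g e0 b = c b.
  rewrite /g eqxx big_seq big1 ?mulr1 // => e es; case: eqP => // E.
  by rewrite E es in e0s.
have E : p * c true + (1 - p) * c false = 0 by rewrite /c /=; ring.
by rewrite !g0 E mul0r.
Qed.

(** A quadruple can have nonzero mean only if [x = x'] or [y = y']. Otherwise either [x = y'] and a
    diagonal factor vanishes, or [[set x; y]] differs from the three other sides of the 4-cycle. *)
Lemma mean_c4_graph_le : mean p (fun G : sgraph 'I_n => c4_graph G p) <= 2 * n%:R ^+ 3.
Proof.
rewrite /c4_graph /c4 mean_sum.
apply: le_trans (_ : \sum_(x < n) \sum_(x' < n) \sum_(y < n) \sum_(y' < n)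
    ((x == x')%:R + (y == y')%:R) <= _ :> R).
  apply: ler_sum => x _; rewrite mean_sum; apply: ler_sum => x' _.
  rewrite mean_sum; apply: ler_sum => y _; rewrite mean_sum; apply: ler_sum => y' _.
  have [E|xx'] := eqVneq x x'; last have [E|yy'] := eqVneq y y'.
  - rewrite -[leRHS](mean_cst n p); apply: le_mean => // G.
    apply: le_trans (ler_norm _) _; rewrite !normrM.
    apply: le_trans (_ : 1 * 1 * 1 * 1 <= _); last by rewrite !mulr1 lerDl ler0n.
    by rewrite !ler_pM ?mulr_ge0 ?centered_norm_le1.
  - rewrite -[leRHS](mean_cst n p); apply: le_mean => // G.
    apply: le_trans (ler_norm _) _; rewrite !normrM.
    apply: le_trans (_ : 1 * 1 * 1 * 1 <= _); last by rewrite !mulr1 lerDr ler0n.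
    by rewrite !ler_pM ?mulr_ge0 ?centered_norm_le1.
  rewrite (_ : mean _ _ = 0) ?addr0 //.
  have [xy|xy] := eqVneq x y'.
    rewrite -[RHS](mean_cst n p); apply: eq_mean => G.
    by rewrite xy [centered G p [set y'; y']]/centered in_pairs eqxx mulr0 mul0r.
  rewrite -[RHS](@mean_centered_prod [set x; y] [:: [set x'; y]; [set x; y']; [set x'; y']]).
    by apply: eq_mean => G; rewrite !big_cons big_nil mulr1 !mulrA.
  have X z z' w : z != z' -> z != w -> [set z; w] != [set z'; w].
    move=> zz zw; apply/eqP => /setP/(_ z); rewrite !inE eqxx.
    by rewrite (negbTE zz) (negbTE zw).
  rewrite !inE !negb_or; apply/and3P; split.
  - have [xy2|xy2] := eqVneq x y; last exact: X.
    apply/eqP => /setP/(_ x'); rewrite !inE eqxx xy2 orbb orbC /=.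
    by rewrite xy2 in xx'; rewrite eq_sym (negbTE xx').
  - apply/eqP => /setP/(_ y'); rewrite !inE eqxx orbT.
    by rewrite eq_sym (negbTE xy) eq_sym (negbTE yy').
  - apply/eqP => /setP/(_ x); rewrite !inE eqxx /=.
    by rewrite (negbTE xx') (negbTE xy).
have sum1 (x : 'I_n) : \sum_(y < n) (x == y)%:R = 1 :> R.
  rewrite (bigD1 x) //= eqxx big1 ?addr0 // => y /negbTE.
  by rewrite eq_sym => ->.
rewrite le_eqVlt; apply/orP; left; apply/eqP.
transitivity (\sum_(x < n) (n%:R * n%:R + n%:R * n%:R) : R); last first.
  by rewrite sumr_const card_ord -mulr_natr; ring.
apply: eq_bigr => x _.
transitivity (\sum_(x' < n) ((x == x')%:R * (n%:R * n%:R) + n%:R) : R).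
  apply: eq_bigr => x' _.
  transitivity (\sum_(y < n) ((x == x')%:R * n%:R + 1) : R).
    apply: eq_bigr => y _; rewrite big_split /= sum1 sumr_const card_ord -mulr_natr; ring.
  rewrite sumr_const card_ord -mulr_natr; ring.
rewrite big_split /= -mulr_suml sum1 sumr_const card_ord -mulr_natr; ring.
Qed.

End MeanC4.

(** * Averages, random walks and Chebyshev's inequality *)

Section Average.
Variable R : realType.

Definition avg (T : finType) (f : T -> R) : R := (\sum_x f x) / #|T|%:R.

Lemma eq_avg (T : finType) (f g : T -> R) : f =1 g -> avg f = avg g.
Proof. by move=> E; rewrite /avg (eq_bigr _ (fun x _ => E x)). Qed.

Lemma le_avg (T : finType) (f g : T -> R) : (forall x, f x <= g x) -> avg f <= avg g.
Proof. by move=> H; rewrite ler_wpM2r ?invr_ge0 // ler_sum. Qed.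

Lemma avgD (T : finType) (f g : T -> R) : avg (fun x => f x + g x) = avg f + avg g.
Proof. by rewrite /avg big_split /= mulrDl. Qed.

Lemma avgZ (T : finType) c (f : T -> R) : avg (fun x => c * f x) = c * avg f.
Proof. by rewrite /avg -mulr_sumr mulrA. Qed.

Lemma avgZr (T : finType) c (f : T -> R) : avg (fun x => f x * c) = avg f * c.
Proof. by rewrite mulrC -avgZ; apply: eq_avg => x; rewrite mulrC. Qed.

Lemma avg_cst (T : finType) c : (0 < #|T|)%N -> avg (fun _ : T => c) = c.
Proof.
by move=> T0; rewrite /avg sumr_const -[c *+ _]mulr_natr mulfK // pnatr_eq0 -lt0n.
Qed.

Lemma avg_pair (S T : finType) (f : S * T -> R) :
  avg f = avg (fun x => avg (fun y => f (x, y))).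
Proof.
rewrite /avg card_prod natrM -mulr_suml (pair_bigA _ (fun x y => f (x, y))) /=.
by rewrite -mulrA -invfM (mulrC #|T|%:R); congr (_ / _); apply: eq_bigr => -[].
Qed.

Lemma avg_norm (T : finType) (f : T -> R) : `|avg f| <= avg (fun x => `|f x|).
Proof.
rewrite /avg normrM [X in _ * X <= _]ger0_norm ?invr_ge0 // ler_wpM2r ?invr_ge0 //.
exact: ler_norm_sum.
Qed.

End Average.

Section Walk.
Variables (R : realType) (T : finType) (S : Type) (step : T -> S -> S).
Hypothesis T0 : (0 < #|T|)%N.

(* The mean of f over the states reached by m independent random steps. *)
Fixpoint walk (m : nat) (f : S -> R) (s : S) : R :=
  if m is m'.+1 then avg (fun x => walk m' f (step x s)) else f s.

Lemma le_walk m f g s : (forall s, f s <= g s) -> walk m f s <= walk m g s.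
Proof. by move=> H; elim: m s => [|m IH] s //=; apply: le_avg. Qed.

Lemma walkZ m c f s : walk m (fun s => c * f s) s = c * walk m f s.
Proof. by elim: m s => [|m IH] s //=; rewrite -avgZ; apply: eq_avg. Qed.

Lemma walkD m f g s : walk m (fun s => f s + g s) s = walk m f s + walk m g s.
Proof. by elim: m s => [|m IH] s //=; rewrite -avgD; apply: eq_avg. Qed.

Lemma walk_cst m c s : walk m (fun=> c) s = c.
Proof.
elim: m s => [|m IH] s //=; rewrite -[RHS](avg_cst c T0).
by apply: eq_avg => x; rewrite IH.
Qed.

Variables (z : S -> R) (xi : T -> R).
Hypothesis zstep : forall x s, z (step x s) = z s + xi x.
Hypothesis xi1 : forall x, `|xi x| <= 1.

(** Each step moves the mean by [avg xi] and adds at most 1 to the variance, because [xi] is bounded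
    by 1. *)
Lemma walk_second_moment m c s :
  walk m (fun s => (z s - c) ^+ 2) s <= (z s + m%:R * avg xi - c) ^+ 2 + m%:R.
Proof.
elim: m s => [|m IH] s /=; first by rewrite mul0r !addr0.
apply: le_trans (le_avg (fun x => IH (step x s))) _.
set mu := avg xi.
apply: le_trans (_ : avg (fun x => (xi x ^+ 2 +
   ((2 * (z s + m%:R * mu - c)) * xi x + ((z s + m%:R * mu - c) ^+ 2 + m%:R)))) <= _).
  apply: le_avg => x; rewrite zstep le_eqVlt; apply/orP; left; apply/eqP; ring.
rewrite !avgD avgZ !avg_cst // -/mu.
have sq1 : avg (fun x => xi x ^+ 2) <= 1.
  rewrite -[leRHS](avg_cst 1 T0); apply: le_avg => x.
  by rewrite -real_normK ?num_real // exprn_ile1.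
rewrite -(natr1 m).
have -> : z s + (m%:R + 1) * mu - c = (z s + m%:R * mu - c) + mu by ring.
move: sq1 (sqr_ge0 mu); set A := avg _; set K := z s + _ - c; set M : R := m%:R => A1 mu2.
rewrite -subr_ge0 (_ : _ - _ = mu ^+ 2 + (1 - A)); first by rewrite addr_ge0 // subr_ge0.
by ring.
Qed.

Lemma walk_chebyshev m c d s (P : pred S) : 0 < d ->
  z s + m%:R * avg xi = c -> (forall s, P s -> d <= `|z s - c|) ->
  walk m (fun s => (P s)%:R) s <= m%:R / d ^+ 2.
Proof.
move=> d0 E HP; rewrite ler_pdivlMr ?exprn_gt0 // mulrC -walkZ.
apply: le_trans (_ : walk m (fun s => (z s - c) ^+ 2) s <= _).
  apply: le_walk => s'; case: (boolP (P s')) => [/HP H|_]; last by rewrite mulr0 sqr_ge0.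
  rewrite mulr1 -[leRHS]real_normK ?num_real //.
  by rewrite ler_pXn2r ?nnegrE ?normr_ge0 ?(ltW d0).
by apply: le_trans (walk_second_moment _ _ _) _; rewrite E subrr expr0n add0r.
Qed.

End Walk.

Section Estimator.
Variables (R : realType).

(* A signed integer [q.1 - q.2] kept as two natural numbers, since words of the
   random access machine are natural numbers. *)
Definition sval2 (q : nat * nat) : R := q.1%:R - q.2%:R.
Definition smul (q r : nat * nat) : nat * nat :=
  (q.1 * r.1 + q.2 * r.2, q.1 * r.2 + q.2 * r.1)%N.
Definition sdiff (a x : bool) : nat * nat := (a - x, x - a)%N.

Lemma sval2_mul q r : sval2 (smul q r) = sval2 q * sval2 r.
Proof. by rewrite /sval2 /= !natrD !natrM; ring. Qed.

Lemma sval2_diff a x : sval2 (sdiff a x) = a%:R - x%:R.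
Proof. by case: a; case: x; rewrite /sval2 /= ?(subnn, subn0, sub0n) ?subrr. Qed.

Variables (n P : nat) (G : sgraph 'I_n).

Local Notation quad := (('I_n * 'I_n) * ('I_n * 'I_n))%type.
(** Four vertices and four coins. A coin is a uniform element of ['I_n] compared with [P], so that
    one [IRand] instruction produces it exactly. *)
Definition sample : finType := (quad * quad)%type.

Definition increment (w : sample) : nat * nat :=
  let: (((u, u'), (v, v')), ((j1, j2), (j3, j4))) := w in
  smul (smul (sdiff (adj G u v) (j1 < P)%N) (sdiff (adj G u' v) (j2 < P)%N))
       (smul (sdiff (adj G u v') (j3 < P)%N) (sdiff (adj G u' v') (j4 < P)%N)).

Definition count_step (w : sample) (s : nat * nat) : nat * nat :=
  ((s.1 + (increment w).1)%N, (s.2 + (increment w).2)%N).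

Lemma sval2_step w s : sval2 (count_step w s) = sval2 s + sval2 (increment w).
Proof. by rewrite /sval2 /= !natrD; ring. Qed.

Lemma norm_bool_diff (a x : bool) : `|a%:R - x%:R : R| <= 1.
Proof. by case: a; case: x; rewrite ?subrr ?subr0 ?sub0r ?normrN ?normr0 ?normr1. Qed.

Lemma increment_norm_le1 w : `|sval2 (increment w)| <= 1.
Proof.
case: w => -[[u u'] [v v']] [[j1 j2] [j3 j4]] /=.
rewrite !sval2_mul !sval2_diff !normrM.
by rewrite !mulr_ile1 ?mulr_ge0 ?norm_bool_diff.
Qed.

Hypotheses (n0 : (0 < n)%N) (Pn : (P <= n)%N).
Let phat : R := P%:R / n%:R.
Let c (u v : 'I_n) : R := (adj G u v)%:R - phat.

(* Subtracting a fresh coin of bias P / n from the adjacency bit keeps the sample in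
   {-1, 0, 1} and has mean A - P / n. *)
Lemma avg_coin (a : bool) : avg (fun j : 'I_n => a%:R - (j < P)%N%:R : R) = a%:R - phat.
Proof.
rewrite avgD avg_cst ?card_ord //; congr (_ + _).
rewrite /avg sumrN mulNr; congr (- (_ / _)); last by rewrite card_ord.
rewrite -natr_sum; congr (_%:R).
transitivity #|[set j : 'I_n | (j < P)%N]|.
  by rewrite -sum1_card [RHS]big_mkcond; apply: eq_bigr => j _; rewrite inE; case: ltnP.
rewrite -[RHS](card_ord P).
have -> : [set j : 'I_n | (j < P)%N] = [set widen_ord Pn x | x : 'I_P].
  apply/setP => j; rewrite inE; apply/idP/imsetP => [jP|[x _ ->]]; last exact: (ltn_ord x).
  by exists (Ordinal jP) => //; apply: val_inj.
by rewrite card_imset // => x y /(congr1 val) /= /val_inj.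
Qed.

Lemma avg_increment : avg (fun w => sval2 (increment w)) =
  avg (fun q : quad =>
     c q.1.1 q.2.1 * c q.1.2 q.2.1 * c q.1.1 q.2.2 * c q.1.2 q.2.2).
Proof.
rewrite [LHS]avg_pair; apply: eq_avg => -[[u u'] [v v']] /=.
transitivity (avg (fun j : quad =>
   (((adj G u v)%:R - (j.1.1 < P)%N%:R) * ((adj G u' v)%:R - (j.1.2 < P)%N%:R)) *
   (((adj G u v')%:R - (j.2.1 < P)%N%:R) * ((adj G u' v')%:R - (j.2.2 < P)%N%:R)) : R)).
  apply: eq_avg => -[[j1 j2] [j3 j4]].
  by rewrite !sval2_mul !sval2_diff.
rewrite avg_pair /=; under eq_avg do rewrite avgZ.
rewrite avgZr avg_pair /=; under eq_avg do rewrite avgZ avg_coin.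
rewrite avgZr avg_coin avg_pair /=; under eq_avg do rewrite avgZ avg_coin.
by rewrite avgZr avg_coin /c !mulrA.
Qed.

End Estimator.

Section Drift.
Variables (R : realType).

Lemma avg_fst (S T : finType) (f : S -> R) : (0 < #|T|)%N ->
  avg (fun x : S * T => f x.1) = avg f.
Proof. by move=> T0; rewrite avg_pair; apply: eq_avg => x /=; rewrite avg_cst. Qed.

Lemma avg_snd (S T : finType) (f : T -> R) : (0 < #|S|)%N ->
  avg (fun x : S * T => f x.2) = avg f.
Proof. by move=> S0; rewrite avg_pair /= avg_cst. Qed.

Lemma dist_mul_le (a b c d : R) : `|a| <= 1 -> `|d| <= 1 ->
  `|a * b - c * d| <= `|a - c| + `|b - d|.
Proof.
move=> a1 d1; have -> : a * b - c * d = a * (b - d) + (a - c) * d by ring.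
apply: le_trans (ler_normD _ _) _; rewrite addrC !normrM.
by apply: lerD; [rewrite ler_piMr|rewrite ler_piMl].
Qed.

Variables (n P : nat) (G : sgraph 'I_n) (p : R).
Hypotheses (n0 : (0 < n)%N) (Pn : (P <= n)%N) (p01 : 0 <= p <= 1).
Hypothesis (Pp : `|p - P%:R / n%:R| <= n%:R^-1).

Let phat : R := P%:R / n%:R.
Let cp (u v : 'I_n) : R := (adj G u v)%:R - phat.
Let nR : 0 < n%:R :> R. Proof. by rewrite ltr0n. Qed.

Let phat01 : 0 <= phat <= 1.
Proof.
rewrite /phat divr_ge0 ?ler0n //= ler_pdivrMr // mul1r ler_nat //.
Qed.

Let cp1 u v : `|cp u v| <= 1.
Proof.
case/andP: phat01 => q0 q1; rewrite /cp ler_norml.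
by case: adj; rewrite /=; apply/andP; split; lra.
Qed.

Lemma c4_graph_avg : c4_graph G p / n%:R ^+ 4 =
  avg (fun q : ('I_n * 'I_n) * ('I_n * 'I_n) =>
    centered G p [set q.1.1; q.2.1] * centered G p [set q.1.2; q.2.1] *
    centered G p [set q.1.1; q.2.2] * centered G p [set q.1.2; q.2.2]).
Proof.
have E : #|{: ('I_n * 'I_n) * ('I_n * 'I_n)}|%:R = n%:R ^+ 4 :> R.
  by rewrite !card_prod !card_ord !natrM; ring.
rewrite /avg E.
congr (_ / _); rewrite /c4_graph /c4.
rewrite (pair_bigA _ (fun x x' => \sum_y \sum_y' _)) /=.
under eq_bigr do rewrite (pair_bigA _ (fun y y' => _)) /=.
by rewrite (pair_bigA _ (fun x y => _)).
Qed.

Let cp_dist u v : `|cp u v - centered G p [set u; v]| <= n%:R^-1 + (u == v)%:R.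
Proof.
rewrite /centered in_pairs; have [->|uv] /= := eqVneq u v.
  rewrite subr0; apply: le_trans (cp1 _ _) _.
  by rewrite lerDr invr_ge0 ler0n.
rewrite addr0 (_ : _ - _ = p - P%:R / n%:R) //.
by rewrite /cp /phat /adj; ring.
Qed.

(** Replacing [p] by [P / n] moves each of the four entries by at most [1 / n] off the diagonal and
    by at most 1 on it, and a random pair is diagonal with probability [1 / n]. Each entry thus
    costs [2 / n]. *)
Lemma avg_increment_c4 :
  `|avg (fun w => sval2 R (increment P G w)) - c4_graph G p / n%:R ^+ 4| <= 8 / n%:R.
Proof.
rewrite avg_increment // c4_graph_avg.
set f := (X in avg X - _); set g := (X in _ - avg X).
have -> : avg f - avg g = avg (fun q => f q - g q).
  rewrite avgD; congr (_ + _); rewrite -mulN1r -avgZ; apply: eq_avg => q.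
  by rewrite mulN1r.
apply: le_trans (avg_norm _) _.
pose d (u v : 'I_n) : R := n%:R^-1 + (u == v)%:R.
apply: le_trans (_ : avg (fun q : ('I_n * 'I_n) * ('I_n * 'I_n) =>
   d q.1.1 q.2.1 + (d q.1.2 q.2.1 + (d q.1.1 q.2.2 + d q.1.2 q.2.2))) <= _).
  apply: le_avg => q; rewrite /f /g /= -!mulrA.
  have c1 e : `|centered G p e| <= 1 := centered_norm_le1 p01 G e.
  have m1 (a b : R) : `|a| <= 1 -> `|b| <= 1 -> `|a * b| <= 1.
    by move=> ? ?; rewrite normrM mulr_ile1.
  apply: le_trans (dist_mul_le _ _ _ _) _; [exact: cp1|by rewrite ?m1|].
  apply: lerD; first exact: cp_dist.
  apply: le_trans (dist_mul_le _ _ _ _) _; [exact: cp1|by rewrite ?m1|].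
  apply: lerD; first exact: cp_dist.
  apply: le_trans (dist_mul_le _ _ _ _) _; [exact: cp1|exact: c1|].
  by apply: lerD; exact: cp_dist.
have I0 : (0 < #|'I_n|)%N by rewrite card_ord.
have II0 : (0 < #|{: 'I_n * 'I_n}|)%N by rewrite card_prod muln_gt0 I0.
have dE x : avg (d x) = 2 / n%:R.
  rewrite /d avgD avg_cst // /avg (bigD1 x) //= eqxx big1 => [|y /negbTE]; last first.
    by rewrite eq_sym => ->.
  by rewrite /= card_ord addr0; field; rewrite lt0r_neq0.
have dp (f1 f2 : 'I_n * 'I_n -> 'I_n) :
   (forall h : 'I_n -> R, avg (fun x => h (f2 x)) = avg h) ->
   avg (fun q : ('I_n * 'I_n) * ('I_n * 'I_n) => d (f1 q.1) (f2 q.2)) = 2 / n%:R.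
  move=> F2; rewrite avg_pair -[RHS](avg_cst _ II0); apply: eq_avg => x.
  by rewrite /= (F2 (fun y => d (f1 x) y)) dE.
have F1 (h : 'I_n -> R) : avg (fun x : 'I_n * 'I_n => h x.1) = avg h by apply: avg_fst.
have F2 (h : 'I_n -> R) : avg (fun x : 'I_n * 'I_n => h x.2) = avg h by apply: avg_snd.
rewrite avgD (dp fst fst F1) avgD (dp snd fst F1) avgD (dp fst snd F2) (dp snd snd F2).
by rewrite le_eqVlt; apply/orP; left; apply/eqP; field; rewrite lt0r_neq0.
Qed.

End Drift.

Section Tester.
Variables (R : realType) (n P a : nat).

(** The threshold corresponds to a mean of [1 / a] per sample. Means below [1 / (2 * a)] or above
    [3 / (2 * a)] put the expected sum at distance [50 * a] from it, while the variance is at most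
    [100 * a ^ 2]: the error is at most 1/25. *)
Definition tester (G : sgraph 'I_n) (b : bool) : R :=
  walk (@count_step n P G) (100 * a ^ 2)
    (fun s => ((s.1 <= s.2 + 100 * a)%N == b)%:R) (0%N, 0%N).

Hypotheses (a0 : (0 < a)%N) (an : (40 * a <= n)%N) (Pn : (P <= n)%N).

Let n0 : (0 < n)%N. Proof. by move: a0 an; clear; lia. Qed.
Let aR : 0 < a%:R :> R. Proof. by rewrite ltr0n. Qed.
Let nR : 0 < n%:R :> R. Proof. by rewrite ltr0n. Qed.

Let S0 : (0 < #|sample n|)%N.
Proof. by rewrite !card_prod !card_ord !muln_gt0 n0. Qed.

Lemma tester_sum1 G : tester G true + tester G false = 1.
Proof.
rewrite /tester -walkD -[RHS](walk_cst (@count_step n P G) S0 (100 * a ^ 2) 1 (0%N, 0%N)).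
apply: (@le_anti _ _ _ _); apply/andP; split; apply: le_walk => s;
  by case: (_ <= _)%N; rewrite ?addr0 ?add0r.
Qed.

Let chebyshev G (b : bool) : let mu := avg (fun w => sval2 R (increment P G w)) in
  (if b then mu <= 1 / (2 * a%:R) else 3 / (2 * a%:R) <= mu) ->
  tester G (~~ b) <= 1 / 25.
Proof.
move=> mu Hmu; rewrite /tester.
have D0 : 0 < 50 * a%:R :> R by rewrite mulr_gt0.
have := walk_chebyshev S0 (sval2_step R P G) (increment_norm_le1 R P G) (s := (0%N, 0%N))
   (m := 100 * a ^ 2) (P := fun s => (s.1 <= s.2 + 100 * a)%N == ~~ b) D0 erefl.
rewrite -/mu {2}/sval2 subrr add0r => H.
have Em : (100 * a ^ 2)%:R = 100 * a%:R ^+ 2 :> R by rewrite natrM natrX.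
have -> : 1 / 25 = (100 * a ^ 2)%:R / (50 * a%:R) ^+ 2 :> R.
  by rewrite Em; field; rewrite lt0r_neq0.
apply: H => -[s1 s2] /= Hs; rewrite Em.
have amu : a%:R * mu * (2 * a%:R) = 2 * a%:R ^+ 2 * mu by ring.
have Ea : 100 * a%:R ^+ 2 * mu = 50 * a%:R * (2 * a%:R * mu) by ring.
rewrite Ea /sval2 /=; case: b Hs Hmu => /=.
  rewrite ler_pdivlMr ?mulr_gt0 // => Hs Hmu.
  have {}Hs : s2%:R + 100 * a%:R < s1%:R :> R.
    by move: Hs; case: (leqP s1) => // Hs _; rewrite -natrM -natrD ltr_nat.
  rewrite ler_normr; apply/orP; left.
  have : 50 * a%:R * (2 * a%:R * mu) <= 50 * a%:R * 1 :> R by rewrite ler_pM2l // mulrC.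
  by move: Hs; lra.
rewrite ler_pdivrMr ?mulr_gt0 // => Hs Hmu.
have {}Hs : s1%:R <= s2%:R + 100 * a%:R :> R.
  by move: Hs; case: (leqP s1) => // Hs _; rewrite -natrM -natrD ler_nat.
rewrite ler_normr; apply/orP; right.
have : 50 * a%:R * 3 <= 50 * a%:R * (2 * a%:R * mu) :> R by rewrite ler_pM2l // (mulrC _ mu).
by move: Hs; lra.
Qed.

Variables (p : R) (V : finType) (H : sgraph V) (eps : R).
Hypotheses (p01 : 0 <= p <= 1) (Pp : `|p - P%:R / n%:R| <= n%:R^-1).
Hypothesis sound : forall G : sgraph 'I_n,
  c4_graph G p <= 2 / a%:R * n%:R ^+ 4 -> `|rho H p G - 1| <= eps.

(** The origin of the 40 in [an]: the bias [8 / n] fits into the gaps, as 1/4 + 1/5 <= 1/2 on the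
    accepting side and 2 - 1/5 >= 3/2 on the rejecting side, in units of [1 / a]. *)
Let err : 8 / n%:R <= 1 / (5 * a%:R) :> R.
Proof.
rewrite ler_pdivrMr // mulrC mulrA ler_pdivlMr ?mulr_gt0 // mulr1.
by have := an; rewrite -(ler_nat R) natrM; lra.
Qed.

Lemma tester_solves : qc_solves (@Gnp R n p) (rho H p) eps tester.
Proof.
split; last first.
  move=> G HG; have Hc : 2 / a%:R * n%:R ^+ 4 < c4_graph G p.
    by rewrite ltNge; apply/negP => /sound; rewrite leNgt HG.
  have E := tester_sum1 G.
  suff : tester G true <= 1 / 25 by move: E; lra.
  apply: (chebyshev (b := false)).
  have D := avg_increment_c4 G n0 Pn p01 Pp.
  have : 2 / a%:R < c4_graph G p / n%:R ^+ 4 by rewrite ltr_pdivlMr ?exprn_gt0.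
  move: D; rewrite ler_norml => /andP[D _]; move: D err.
  have -> : 1 / (5 * a%:R) = (1 / 5) * a%:R^-1 :> R by field; rewrite lt0r_neq0.
  have -> : 3 / (2 * a%:R) = (3 / 2) * a%:R^-1 :> R by field; rewrite lt0r_neq0.
  have : 0 < a%:R^-1 :> R by rewrite invr_gt0.
  lra.
have M2 := mean_c4_graph_le n p01.
(* Markov's inequality at this level: the mean [2 * n ^ 3] is exceeded by a factor
   [n / (8 * a) >= 5], so acceptance has probability at least 24/25 - 1/5 > 2/3. *)
pose t : R := 1 / (4 * a%:R) * n%:R ^+ 4.
pose B : R := mean p (fun G : sgraph 'I_n => (t < c4_graph G p)%R%:R).
have M : t * B <= mean p (fun G : sgraph 'I_n => c4_graph G p).
  by apply: markov_mean => // G; apply: c4_ge0.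
have t0 : 0 < t by rewrite mulr_gt0 ?exprn_gt0 ?divr_gt0 ?mulr_gt0.
have HB : B <= 1 / 5.
  have : t * B <= 2 * n%:R ^+ 3 by apply: le_trans M M2.
  have -> : 2 * n%:R ^+ 3 = t * (8 / n%:R * a%:R) by rewrite /t; field; rewrite !lt0r_neq0.
  rewrite ler_pM2l // => /le_trans; apply.
  apply: le_trans (ler_wpM2r (ltW aR) err) _.
  by rewrite le_eqVlt; apply/orP; left; apply/eqP; field; rewrite lt0r_neq0.
have : mean p (fun G : sgraph 'I_n => 24 / 25 + (- 1) * (t < c4_graph G p)%R%:R) <=
       mean p (fun G => tester G true).
  apply: le_mean => // G; case: ltP => [_|Ht] /=.
    apply: le_trans (_ : 0 <= _); first lra.
    rewrite /tester -(walk_cst (@count_step n P G) S0 (100 * a ^ 2) 0 (0%N, 0%N)).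
    by apply: le_walk => s; rewrite ler0n.
  have E := tester_sum1 G.
  suff : tester G false <= 1 / 25 by move: E; lra.
  apply: (chebyshev (b := true)).
  have D := avg_increment_c4 G n0 Pn p01 Pp.
  have : c4_graph G p / n%:R ^+ 4 <= 1 / (4 * a%:R) by rewrite ler_pdivrMr ?exprn_gt0.
  move: D; rewrite ler_norml => /andP[_ D]; move: D err.
  have -> : 1 / (5 * a%:R) = (1 / 5) * a%:R^-1 :> R by field; rewrite lt0r_neq0.
  have -> : 1 / (2 * a%:R) = (1 / 2) * a%:R^-1 :> R by field; rewrite lt0r_neq0.
  have -> : 1 / (4 * a%:R) = (1 / 4) * a%:R^-1 :> R by field; rewrite lt0r_neq0.
  have : 0 < a%:R^-1 :> R by rewrite invr_gt0.
  lra.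
rewrite meanD mean_cst meanZ => X; apply: le_trans X.
apply: le_trans (_ : 24 / 25 + -1 * B <= _); last exact: lexx.
by move: HB; lra.
Qed.

End Tester.

(** * Query algorithms *)

Section QueryAlgorithmFacts.
Variables (R : realType) (V : finType).
Implicit Types (t : qalg R V) (G : sgraph V).

Lemma qalg_out_ge0 t G b : 0 <= qalg_out t G b.
Proof.
elim: t => [a|r k IH|u v k IH] /=; rewrite ?IH ?ler0n //.
by rewrite addr_ge0 // mulr_ge0 // subr_ge0.
Qed.

Lemma qalg_out_sum1 t G : qalg_out t G true + qalg_out t G false = 1.
Proof.
elim: t => [a|r k IH|u v k IH] /=; rewrite ?IH //.
  by case: a; rewrite ?addr0 ?add0r.
transitivity (r%:num * (qalg_out (k true) G true + qalg_out (k true) G false) +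
  (1 - r%:num) * (qalg_out (k false) G true + qalg_out (k false) G false)); first by ring.
by rewrite !IH; ring.
Qed.

Lemma qalg_out_le1 t G b : qalg_out t G b <= 1.
Proof.
have := qalg_out_sum1 t G; have := qalg_out_ge0 t G true; have := qalg_out_ge0 t G false.
by case: b; lra.
Qed.

Lemma inv_succ_ge0 (m : nat) : 0 <= m.+1%:R^-1 :> R.
Proof. by rewrite invr_ge0. Qed.

Lemma inv_succ_le1 (m : nat) : m.+1%:R^-1 <= 1 :> R.
Proof. by rewrite invf_le1 ?ltr0n // ler1n. Qed.

Definition coin (m : nat) : {i01 R} := Itv01 (inv_succ_ge0 m) (inv_succ_le1 m).

(** A uniform choice by biased coins: the head is kept with probability 1 over the number of
    elements left. *)
Fixpoint unif_seq (T : Type) (f : T -> qalg R V) (x : T) (s : seq T) : qalg R V :=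
  if s is y :: s' then Flip (coin (size s)) (fun b => if b then f x else unif_seq f y s')
  else f x.

Lemma unif_seq_out (T : Type) (f : T -> qalg R V) x s G b :
  qalg_out (unif_seq f x s) G b =
  (\sum_(y <- x :: s) qalg_out (f y) G b) / (size s).+1%:R.
Proof.
elim: s x => [|y s IH] x /=; first by rewrite big_seq1 divr1.
rewrite IH [in RHS]big_cons.
move: (\sum_(_ <- _) _) (qalg_out (f x) G b) => A B.
have : (size s).+1%:R != 0 :> R by rewrite pnatr_eq0.
have : (size s).+2%:R != 0 :> R by rewrite pnatr_eq0.
rewrite -(natr1 (size s).+1); move: ((size s).+1%:R) => q q0 q1.
by field; rewrite q0 q1.
Qed.

Lemma unif_seq_queries (T : Type) (f : T -> qalg R V) x s m :
  (forall y, qalg_queries (f y) <= m)%N -> (qalg_queries (unif_seq f x s) <= m)%N.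
Proof.
move=> H; elim: s x => [|y s IH] x //=.
by rewrite geq_max H IH.
Qed.

Definition unif (T : finType) (f : T -> qalg R V) : qalg R V :=
  if enum T is x :: s then unif_seq f x s else Answer R V true.

Lemma unif_out (T : finType) (f : T -> qalg R V) G b : (0 < #|T|)%N ->
  qalg_out (unif f) G b = avg (fun x => qalg_out (f x) G b).
Proof.
rewrite /avg /unif cardT -[in RHS]big_enum /=; case: (enum T) => [|x s] // _.
by rewrite unif_seq_out.
Qed.

Lemma unif_queries (T : finType) (f : T -> qalg R V) m :
  (forall y, qalg_queries (f y) <= m)%N -> (qalg_queries (unif f) <= m)%N.
Proof. by rewrite /unif; case: (enum T) => // x s H; apply: unif_seq_queries. Qed.

Fixpoint learn (dec : {set {set V}} -> bool) (l : seq (V * V)) (E : {set {set V}}) : qalg R V :=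
  if l is (u, v) :: l' then
    Ask u v (fun b => learn dec l' (if b then [set u; v] |: E else E))
  else Answer R V (dec E).

Lemma learn_queries dec l E : (qalg_queries (learn dec l E) <= size l)%N.
Proof. by elim: l E => [|[u v] l IH] E //=; rewrite ltnS geq_max !IH. Qed.

Lemma learn_out dec l E G b : qalg_out (learn dec l E) G b =
  (dec (E :|: [set e in edges G | has (fun q => e == [set q.1; q.2]) l]) == b)%:R.
Proof.
elim: l E => [|[u v] l IH] E /=.
  by rewrite (_ : [set _ in _ | _] = set0) ?setU0 //; apply/setP => e; rewrite !inE andbF.
rewrite IH; congr ((dec _ == b)%:R); apply/setP => e.
rewrite /adj !inE; case: (boolP ([set u; v] \in edges G)) => uvG; rewrite ?inE.
  by case: (eqVneq e [set u; v]) => [->|_] //=; rewrite uvG orbT.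
by case: (eqVneq e [set u; v]) => [->|_] //=; rewrite (negbTE uvG).
Qed.

Lemma read_graph (f : sgraph V -> bool) : exists2 t : qalg R V,
  (qalg_queries t <= #|V| * #|V|)%N & forall G b, qalg_out t G b = (f G == b)%:R.
Proof.
exists (learn (fun E => if insub E is Some G then f G else true) (enum {: V * V}) set0).
  by apply: leq_trans (learn_queries _ _ _) _; rewrite -cardT card_prod.
move=> G b; rewrite learn_out set0U (_ : [set _ in _ | _] = edges G).
  by rewrite /edges valK.
apply/setP => e; rewrite inE; case: (boolP (e \in edges G)) => //= eG.
have /pairsP[[u v] /= _ ->] := subsetP (edges_pairs G) _ eG.
by apply/hasP; exists (u, v); rewrite ?mem_enum //=.
Qed.

End QueryAlgorithmFacts.

Section TesterTree.
Variables (R : realType) (n P a : nat).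

Fixpoint tester_tree (m : nat) (s : nat * nat) : qalg R 'I_n :=
  if m is m'.+1 then
    unif (fun w : sample n =>
      let: (((u, u'), (v, v')), ((j1, j2), (j3, j4))) := w in
      Ask u v (fun b1 => Ask u' v (fun b2 => Ask u v' (fun b3 => Ask u' v' (fun b4 =>
        let q := smul (smul (sdiff b1 (j1 < P)%N) (sdiff b2 (j2 < P)%N))
                      (smul (sdiff b3 (j3 < P)%N) (sdiff b4 (j4 < P)%N)) in
        tester_tree m' ((s.1 + q.1)%N, (s.2 + q.2)%N))))))
  else Answer R 'I_n (s.1 <= s.2 + 100 * a)%N.

Lemma tester_tree_out m s G b : (0 < n)%N -> qalg_out (tester_tree m s) G b =
  walk (@count_step n P G) m (fun s => ((s.1 <= s.2 + 100 * a)%N == b)%:R) s.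
Proof.
move=> n0; elim: m s => [|m IH] s //=.
rewrite unif_out; last by rewrite !card_prod !card_ord !muln_gt0 n0.
by apply: eq_avg => -[[[u u'] [v v']] [[j1 j2] [j3 j4]]] /=; rewrite IH.
Qed.

Lemma tester_tree_queries m s : (qalg_queries (tester_tree m s) <= 4 * m)%N.
Proof.
elim: m s => [|m IH] s //=; apply: unif_queries => -[[[u u'] [v v']] [[j1 j2] [j3 j4]]] /=.
rewrite mulnS !ltnS.
by rewrite !(geq_max, ltnS, IH).
Qed.

End TesterTree.

(** * The random access machine *)

Section Execution.
Variables (R : realType) (prog : seq instr) (W n : nat) (G : sgraph 'I_n).
Implicit Type M : nat -> nat.
Local Notation ram := (@ram_out R prog W n G).

Definition code_at (pc : nat) (c : seq instr) : Prop :=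
  forall i, (i < size c)%N -> onth prog (pc + i) = onth c i.

Lemma code_at_cons pc i c : code_at pc (i :: c) -> onth prog pc = Some i /\ code_at pc.+1 c.
Proof.
move=> H; split; first by have := H 0%N isT; rewrite addn0.
by move=> j jc; have := H j.+1 jc; rewrite addnS.
Qed.

Lemma code_at_cat pc c1 c2 : code_at pc (c1 ++ c2) -> code_at pc c1 /\ code_at (pc + size c1) c2.
Proof.
move=> H; split=> j jc.
  by rewrite H ?size_cat ?ltn_addr // onth_cat jc.
by rewrite -addnA H ?size_cat ?ltn_add2l // onth_cat ltnNge leq_addr /= addKn.
Qed.

(** Quantifying over the remaining time [t] lets consecutive segments compose by rewriting. *)
Definition steps (k pc : nat) M (pc' : nat) M' : Prop :=
  forall t b, ram (k + t) pc M b = ram t pc' M' b.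

(** Covers the deterministic instructions whose whole effect is one write to a fixed register.
    Values are not reduced modulo [W] here; [no_overflow] justifies this. *)
Definition assign (i : instr) M : option (nat * nat) :=
  match i with
  | IConst d c => Some (d, c)
  | IAdd d x y => Some (d, M x + M y)%N
  | ISub d x y => Some (d, M x - M y)%N
  | IMul d x y => Some (d, M x * M y)%N
  | IDiv d x y => Some (d, M x %/ M y)%N
  | IQuery d x y => Some (d, nat_of_bool (query_bit G (M x) (M y)))
  | _ => None
  end.

Fixpoint exec (c : seq instr) M : nat -> nat :=
  if c is i :: c' then
    if assign i M is Some dv then exec c' (upd M dv.1 dv.2) else M
  else M.

Fixpoint no_overflow (c : seq instr) M : Prop :=
  if c is i :: c' then
    if assign i M is Some dv then (dv.2 < W)%N /\ no_overflow c' (upd M dv.1 dv.2) else False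
  else True.

Lemma exec_steps c pc M : code_at pc c -> no_overflow c M ->
  steps (size c) pc M (pc + size c) (exec c M).
Proof.
elim: c pc M => [|i c IH] pc M; first by move=> _ _ t b; rewrite addn0.
move=> /code_at_cons[Hi /IH{}IH] /=.
case E: (assign i M) => [[d v]|] //= [vW /IH{}IH] t b.
rewrite addSn -addSnnS -IH /= Hi.
by case: i Hi E vW => //= [d' c'|d' x y|d' x y|d' x y|d' x y|d' x y] _ [<- <-] vW;
  rewrite modn_small.
Qed.

Lemma jump_step pc x y l M : onth prog pc = Some (IJlt x y l) ->
  steps 1 pc M (if (M x < M y)%N then l else pc.+1) M.
Proof. by move=> E t b; rewrite add1n /= E. Qed.

Lemma halt_step pc a M b t : onth prog pc = Some (IHalt a) ->
  ram t.+1 pc M b = (a == b)%:R.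
Proof. by move=> /= ->. Qed.

Lemma rand_step pc d M t b : onth prog pc = Some (IRand d 0%N) -> M 0%N = n ->
  (0 < n)%N -> (n <= W)%N ->
  ram t.+1 pc M b = avg (fun j : 'I_n => ram t pc.+1 (upd M d j) b).
Proof.
move=> E M0 n0 nW; rewrite /= E M0 (maxn_idPl n0) /avg card_ord; congr (_ / _).
by apply: eq_bigr => j _; rewrite modn_small // (leq_trans (ltn_ord j)).
Qed.

Definition rand_code : seq instr := [seq IRand d 0 | d <- iota 10 8].

Definition sampled M (w : sample n) : nat -> nat :=
  let: (((u, u'), (v, v')), ((j1, j2), (j3, j4))) := w in
  upd (upd (upd (upd (upd (upd (upd (upd M 10 u) 11 u') 12 v) 13 v') 14 j1) 15 j2) 16 j3) 17 j4.

Lemma rand_steps pc M t b : code_at pc rand_code -> M 0%N = n -> (0 < n)%N -> (n <= W)%N ->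
  ram (8 + t) pc M b = avg (fun w => ram t (pc + 8) (sampled M w) b).
Proof.
move=> C M0 n0 nW; rewrite avg_pair avg_pair.
have {C}[C0 C] := code_at_cons C.
rewrite (rand_step _ _ C0) // [RHS]avg_pair; apply: eq_avg => u.
have {C0 C}[C0 C] := code_at_cons C.
rewrite (rand_step _ _ C0) //; apply: eq_avg => u'.
have {C0 C}[C0 C] := code_at_cons C.
rewrite [RHS]avg_pair (rand_step _ _ C0) //; apply: eq_avg => v.
have {C0 C}[C0 C] := code_at_cons C.
rewrite (rand_step _ _ C0) //; apply: eq_avg => v'.
have {C0 C}[C0 C] := code_at_cons C.
rewrite [RHS]avg_pair [RHS]avg_pair (rand_step _ _ C0) //; apply: eq_avg => j1.
have {C0 C}[C0 C] := code_at_cons C.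
rewrite (rand_step _ _ C0) //; apply: eq_avg => j2.
have {C0 C}[C0 C] := code_at_cons C.
rewrite [RHS]avg_pair (rand_step _ _ C0) //; apply: eq_avg => j3.
have {C0 C}[C0 C] := code_at_cons C.
rewrite (rand_step _ _ C0) //; apply: eq_avg => j4.
by rewrite /sampled addnC.
Qed.

(* Registers 24 and 25 hold the two parts of a signed accumulator, register 1
   holds [P], register 3 holds 1 and register 23 holds 0. *)
Definition factor_code (x y j : nat) : seq instr :=
  [:: IQuery 18 x y; IAdd 19 j 3; ISub 19 19 1; ISub 19 3 19;
      ISub 20 18 19; ISub 21 19 18;
      IMul 22 24 20; IMul 26 25 21; IAdd 22 22 26;
      IMul 26 24 21; IMul 27 25 20; IAdd 25 26 27; IAdd 24 22 23].

Lemma sdiff_sum_le1 a x : ((sdiff a x).1 + (sdiff a x).2 <= 1)%N.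
Proof. by case: a; case: x. Qed.

(** Keeps the signed accumulator in {-1, 0, 1}, with one part equal to 0, so that multiplying by a
    further factor cannot overflow. *)
Lemma smul_sum_le1 q r : (q.1 + q.2 <= 1)%N -> (r.1 + r.2 <= 1)%N ->
  ((smul q r).1 + (smul q r).2 <= 1)%N.
Proof.
move=> Hq Hr; apply: leq_trans (leq_mul Hq Hr).
by rewrite /smul /= !mulnDl !mulnDr; lia.
Qed.

Definition wp (c : seq instr) M (Q : (nat -> nat) -> Prop) : Prop :=
  no_overflow c M /\ Q (exec c M).

Lemma wp_cons i c M d v Q : assign i M = Some (d, v) -> (v < W)%N ->
  wp c (upd M d v) Q -> wp (i :: c) M Q.
Proof. by move=> E vW [H1 H2]; rewrite /wp /= E. Qed.

Lemma factor_steps x y j P M : M 1%N = P -> M 3%N = 1%N -> M 23%N = 0%N ->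
  (x < 18)%N -> (y < 18)%N -> (j < 18)%N -> (M j < n)%N -> (n.+1 < W)%N ->
  (M 24 + M 25 <= 1)%N ->
  wp (factor_code x y j) M (fun M' =>
    [/\ (M' 24%N, M' 25%N) =
         smul (M 24%N, M 25%N) (sdiff (query_bit G (M x) (M y)) (M j < P)%N),
         forall i, (i < 18)%N -> M' i = M i & M' 23%N = 0%N]).
Proof.
move=> M1 M3 M23 x18 y18 j18 jn nW acc.
have j_18 : (j == 18)%N = false by apply/negbTE; rewrite neq_ltn j18.
(* The bit [M j < P] is computed without a jump, by truncated subtraction. *)
have X : (1 - (M j + 1 - P) = (M j < P))%N by case: ltnP; lia.
set a := query_bit G (M x) (M y); set c := (M j < P)%N.
have hd := sdiff_sum_le1 a c.
have hs := @smul_sum_le1 (M 24%N, M 25%N) _ acc hd.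
rewrite /= in hd hs.
have jW : (M j + 1 < W)%N by lia.
have aW : (a < W)%N by case: (a); lia.
have cW : (c < W)%N by case: (c); lia.
move EA: (M 24%N) hs acc => A hs acc; move EB: (M 25%N) hs acc => B hs acc.
apply: (@wp_cons _ _ _ 18 a); [by []|exact: aW|].
apply: (@wp_cons _ _ _ 19 (M j + 1)%N); [by rewrite /= /upd /= j_18 M3|exact: jW|].
apply: (@wp_cons _ _ _ 19 (M j + 1 - P)%N); [by rewrite /= /upd /= M1| |].
  exact: leq_ltn_trans (leq_subr _ _) jW.
apply: (@wp_cons _ _ _ 19 c); [by rewrite /= /upd /= M3 X|exact: cW|].
apply: (@wp_cons _ _ _ 20 (a - c)%N); [by []|exact: leq_ltn_trans (leq_subr _ _) aW|].
apply: (@wp_cons _ _ _ 21 (c - a)%N); [by []|exact: leq_ltn_trans (leq_subr _ _) cW|].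
apply: (@wp_cons _ _ _ 22 (A * (a - c))%N); [by rewrite /= /upd /= EA|lia|].
apply: (@wp_cons _ _ _ 26 (B * (c - a))%N); [by rewrite /= /upd /= EB|lia|].
apply: (@wp_cons _ _ _ 22 (A * (a - c) + B * (c - a))%N); [by []|lia|].
apply: (@wp_cons _ _ _ 26 (A * (c - a))%N); [by rewrite /= /upd /= EA|lia|].
apply: (@wp_cons _ _ _ 27 (B * (a - c))%N); [by rewrite /= /upd /= EB|lia|].
apply: (@wp_cons _ _ _ 25 (A * (c - a) + B * (a - c))%N); [by []|lia|].
apply: (@wp_cons _ _ _ 24 (A * (a - c) + B * (c - a))%N); [|lia|].
  by rewrite /= /upd /= M23 addn0.
split; first by [].
split.
- by rewrite /= /upd /=.
- move=> i i18; rewrite /= /upd.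
  by do !rewrite ifN ?neq_ltn ?(leq_trans i18) //.
- by rewrite /= /upd /= M23.
Qed.

Lemma wp_steps c pc M Q : code_at pc c -> wp c M Q ->
  exists M', steps (size c) pc M (pc + size c) M' /\ Q M'.
Proof. by move=> C [ok HQ]; exists (exec c M); split=> //; apply: exec_steps. Qed.

Lemma power_steps r k A M : M 4%N = A -> M 2%N = r -> (0 < r)%N -> (A * r ^ k < W)%N ->
  wp (nseq k (IMul 4 4 2)) M (fun M' =>
    M' 4%N = (A * r ^ k)%N /\ forall i, (i != 4)%N -> M' i = M i).
Proof.
move=> + + r0; elim: k A M => [|k IH] A M M4 M2 AW.
  by split=> //=; rewrite muln1.
rewrite expnS mulnA in AW *.
apply: (@wp_cons _ _ _ 4 (A * r)%N); first by rewrite /= M4 M2.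
  by apply: leq_ltn_trans AW; rewrite leq_pmulr // expn_gt0 r0.
have [] := IH (A * r)%N (upd M 4 (A * r)) => //.
move=> H1 [H2 H3]; split=> //; split=> // i i4.
by rewrite H3 // /upd (negbTE i4).
Qed.

Definition loop_inv (P th m i : nat) (s : nat * nat) M : Prop :=
  [/\ M 0%N = n, M 1%N = P, M 3%N = 1%N & [/\ M 5%N = th, M 6%N = m &
     [/\ M 7%N = s.1, M 8%N = s.2, M 9%N = i & M 23%N = 0%N]]].

(** Register 4 receives [a = K * (n %/ P + 1) ^ k], an integer substitute for [K / p ^ k] that needs
    only [n] and [P]; registers 5 and 6 receive the threshold [100 * a] and the sample size
    [100 * a ^ 2]. *)
Definition setup_code (K k : nat) : seq instr :=
  [:: IDiv 2 0 1; IConst 3 1; IAdd 2 2 3; IConst 4 K] ++ nseq k (IMul 4 4 2) ++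
  [:: IConst 5 100; IMul 5 5 4; IMul 6 5 4].

Lemma setup_steps K k P M a : M 0%N = n -> M 1%N = P ->
  (forall i, (1 < i)%N -> M i = 0%N) -> a = (K * (n %/ P + 1) ^ k)%N ->
  (n.+1 < W)%N -> (100 * a ^ 2 + 100 * a < W)%N -> (0 < a)%N ->
  wp (setup_code K k) M (loop_inv P (100 * a) (100 * a ^ 2) 0 (0%N, 0%N)).
Proof.
move=> M0 M1 Mi aE nW aW a0.
have r1 : (n %/ P <= n)%N by apply: leq_div.
have a2 : (0 < a ^ 2)%N by rewrite expn_gt0 a0.
have W1 : (100 < W)%N by lia.
have Wa : (a < W)%N by lia.
have W2 : (100 * a < W)%N by lia.
have W3 : (100 * a * a < W)%N by rewrite -mulnA mulnn; lia.
have rk : (0 < (n %/ P + 1) ^ k)%N by rewrite expn_gt0 addn1.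
have KW : (K < W)%N by apply: leq_ltn_trans Wa; rewrite aE leq_pmulr.
apply: (@wp_cons _ _ _ 2 (n %/ P)%N); [by rewrite /= M0 M1|lia|].
apply: (@wp_cons _ _ _ 3 1%N); [by []|lia|].
apply: (@wp_cons _ _ _ 2 (n %/ P + 1)%N); [by []|lia|].
apply: (@wp_cons _ _ _ 4 K); [by []|exact: KW|].
set M4 := upd _ 4 K.
have r0 : (0 < n %/ P + 1)%N by rewrite addn1.
have [no4 [E4 E4']] := @power_steps (n %/ P + 1)%N k K M4 erefl erefl r0 (eq_ind _ (fun x => x < W)%N Wa _ aE).
pose M5 := exec (nseq k (IMul 4 4 2)) M4.
have cat c1 c2 N Q : no_overflow c1 N -> wp c2 (exec c1 N) Q -> wp (c1 ++ c2) N Q.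
  elim: c1 N => [|x c1 IH] N //=; case E: (assign x N) => [[d v]|] //= [vW no] H.
  by apply: (wp_cons E vW); apply: IH.
apply: cat no4 _; rewrite -/M5 in E4 E4' *.
rewrite -aE in E4.
apply: (@wp_cons _ _ _ 5 100%N); [by []|lia|].
apply: (@wp_cons _ _ _ 5 (100 * a)%N); [by rewrite /= /upd /= E4|lia|].
apply: (@wp_cons _ _ _ 6 (100 * a * a)%N); [by rewrite /= /upd /= E4|lia|].
split; first by [].
have E i : (i \notin [:: 2; 3; 4]%N) -> M5 i = M i.
  by rewrite !inE !negb_or => /and3P[i2 i3 i4]; rewrite E4' // /M4 /upd (negbTE i2) (negbTE i3) (negbTE i4).
rewrite /loop_inv /= /upd /=; split.
- by rewrite E.
- by rewrite E.
- by rewrite E4'.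
by split; [|rewrite -mulnA mulnn|split; rewrite E ?Mi].
Qed.

(** The body starts at [L + 4], and [L + 70] is the rejecting halt. The jump [IJlt 23 3 L] compares
    0 with 1, so it is always taken. One iteration takes 1 + 2 + 8 + 4 * 13 + 3 + 1 = 67 steps, and
    leaving the loop takes 4 in either case. *)
Definition loop_code (L : nat) : seq instr :=
  [:: IJlt 9 6 (L + 4); IAdd 8 8 5; IJlt 8 7 (L + 70); IHalt true; IConst 24 1; IConst 25 0] ++
  rand_code ++ factor_code 10 12 14 ++ factor_code 11 12 15 ++ factor_code 10 13 16 ++
  factor_code 11 13 17 ++ [:: IAdd 7 7 24; IAdd 8 8 25; IAdd 9 9 3; IJlt 23 3 L; IHalt false].

Lemma query_bit_ord (u v : 'I_n) : query_bit G u v = adj G u v.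
Proof. by rewrite /query_bit !valK. Qed.

Lemma smul_left q d1 d2 d3 d4 : q = (1, 0)%N ->
  smul (smul (smul (smul q d1) d2) d3) d4 = smul (smul d1 d2) (smul d3 d4).
Proof.
move=> ->; rewrite /smul /=; congr pair; rewrite !mul1n !mul0n !addn0; ring.
Qed.

(** A sample adds at most 1 to [s.1 + s.2], so the counters stay below the iteration number [i];
    this invariant excludes overflow. *)
Lemma loop_steps L P th m j i s M b : code_at L (loop_code L) ->
  (i + j = m)%N -> (s.1 + s.2 <= i)%N -> (n.+1 < W)%N -> (m + th < W)%N -> (0 < n)%N ->
  loop_inv P th m i s M ->
  ram (j * 67 + 4) L M b =
  walk (@count_step n P G) j (fun s => ((s.1 <= s.2 + th)%N == b)%:R) s.
Proof.
move=> C ijm si nW mW n0; elim: j i s M ijm si => [|j IH] i s M ijm si [M0 M1 M3 [M5 M6 [M7 M8 M9 M23]]].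
  have [C0 C1] := code_at_cons C; have [C2 C3] := code_at_cons C1.
  have [C4 C5] := code_at_cons C3; have [C6 _] := code_at_cons C5.
  have CF : onth prog (L + 70) = Some (IHalt false) by rewrite C.
  rewrite mul0n (_ : (0 + 4 = 1 + 3)%N) // (jump_step _ C0) M9 M6 (_ : (i < m)%N = false); last by lia.
  have [M' [S1 [Q]]] : exists M', steps 1 L.+1 M (L.+1 + 1) M' /\
     (M' 8%N = s.2 + th /\ M' 7%N = s.1)%N.
    apply: (@wp_steps [:: IAdd 8 8 5]); first by move=> [|//] _; rewrite addn0 C2.
    by apply: (@wp_cons _ _ _ 8 (s.2 + th)%N); [rewrite /= M8 M5|lia|].
  move=> Q2; rewrite (_ : 3 = 1 + 2)%N // S1 addn1.
  rewrite (_ : 2 = 1 + 1)%N // (jump_step _ C4) Q Q2 [RHS]/=; case: ltnP => _.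
    by rewrite (halt_step _ _ _ CF).
  by rewrite (halt_step _ _ _ C6).
have [T ET] : exists T, T = (j * 67 + 4)%N by exists (j * 67 + 4)%N.
rewrite mulSn -addnA -ET in IH *.
rewrite (_ : (67 + T)%N = (1 + (2 + (8 + (13 + (13 + (13 + (13 + (3 + (1 + T)))))))))%N) //.
have [C0 _] := code_at_cons C.
rewrite (jump_step _ C0) M9 M6 (_ : (i < m)%N = true); last by lia.
have {C}[C1 C] := @code_at_cat L [:: IJlt 9 6 (L + 4); IAdd 8 8 5; IJlt 8 7 (L + 70); IHalt true] _ C.
have {C}[C2 C] := @code_at_cat (L + 4) [:: IConst 24 1; IConst 25 0] _ C.
have {C}[C3 C] := @code_at_cat (L + 4 + 2) rand_code _ C.
have {C}[F1 C] := @code_at_cat (L + 4 + 2 + 8) (factor_code 10 12 14) _ C.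
have {C}[F2 C] := @code_at_cat (L + 4 + 2 + 8 + 13) (factor_code 11 12 15) _ C.
have {C}[F3 C] := @code_at_cat (L + 4 + 2 + 8 + 13 + 13) (factor_code 10 13 16) _ C.
have {C}[F4 C] := @code_at_cat (L + 4 + 2 + 8 + 13 + 13 + 13) (factor_code 11 13 17) _ C.
have {C}[C5 C] := @code_at_cat (L + 4 + 2 + 8 + 13 + 13 + 13 + 13) [:: IAdd 7 7 24; IAdd 8 8 25; IAdd 9 9 3] _ C.
have {C}[C6 _] := code_at_cons C.
pose M' := upd (upd M 24 1) 25 0.
have nW' : (n <= W)%N by lia.
have W1 : (1 < W)%N by lia.
have SI : steps 2 (L + 4) M (L + 4 + 2) M'.
  exact: (exec_steps C2 (conj W1 (conj (ltnW W1) I))).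
rewrite (SI _ b) (@rand_steps (L + 4 + 2) M' _ b C3 M0 n0 nW').
apply: eq_avg => -[[[u u'] [v v']] [[j1 j2] [j3 j4]]].
set N0 := sampled _ _.
have [X1 [S1 [A1 B1 Z1]]] := wp_steps F1 (@factor_steps 10 12 14 P N0 M1 M3 M23 isT isT isT (ltn_ord j1) nW isT).
rewrite (S1 _ b).
have acc1 : (X1 24 + X1 25 <= 1)%N.
  by have := @smul_sum_le1 (1, 0)%N _ isT (sdiff_sum_le1 (query_bit G (N0 10) (N0 12)) (N0 14 < P)%N); rewrite -A1.
have [X2 [S2 [A2 B2 Z2]]] := wp_steps F2 (@factor_steps 11 12 15 P X1 (etrans (B1 1%N isT) M1)
  (etrans (B1 3%N isT) M3) Z1 isT isT isT (eq_ind_r (fun x => x < n)%N (ltn_ord j2) (B1 15%N isT)) nW acc1).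
rewrite (S2 _ b).
have acc2 : (X2 24 + X2 25 <= 1)%N.
  by have := @smul_sum_le1 (X1 24, X1 25)%N _ acc1 (sdiff_sum_le1 (query_bit G (X1 11) (X1 12)) (X1 15 < P)%N); rewrite -A2.
have [X3 [S3 [A3 B3 Z3]]] := wp_steps F3 (@factor_steps 10 13 16 P X2 (etrans (B2 1%N isT) (etrans (B1 1%N isT) M1))
  (etrans (B2 3%N isT) (etrans (B1 3%N isT) M3)) Z2 isT isT isT
  (eq_ind_r (fun x => x < n)%N (ltn_ord j3) (etrans (B2 16%N isT) (B1 16%N isT))) nW acc2).
rewrite (S3 _ b).
have acc3 : (X3 24 + X3 25 <= 1)%N.
  by have := @smul_sum_le1 (X2 24, X2 25)%N _ acc2 (sdiff_sum_le1 (query_bit G (X2 10) (X2 13)) (X2 16 < P)%N); rewrite -A3.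
have B3' i' : (i' < 18)%N -> X3 i' = N0 i' by move=> i18; rewrite B3 // B2 // B1.
have [X4 [S4 [A4 B4 Z4]]] := wp_steps F4 (@factor_steps 11 13 17 P X3 (etrans (B3' 1%N isT) M1)
  (etrans (B3' 3%N isT) M3) Z3 isT isT isT
  (eq_ind_r (fun x => x < n)%N (ltn_ord j4) (B3' 17%N isT)) nW acc3).
rewrite (S4 _ b).
have acc4 : (X4 24 + X4 25 <= 1)%N.
  by have := @smul_sum_le1 (X3 24, X3 25)%N _ acc3 (sdiff_sum_le1 (query_bit G (X3 11) (X3 13)) (X3 17 < P)%N); rewrite -A4.
have inc : (X4 24, X4 25)%N = increment P G ((u, u'), (v, v'), ((j1, j2), (j3, j4))).
  rewrite A4 A3 A2 A1 (B3' 11%N) // (B3' 13%N) // (B3' 17%N) // (B2 10%N) // (B2 13%N) // (B2 16%N) //.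
  rewrite (B1 10%N) // (B1 13%N) // (B1 16%N) // (B1 11%N) // (B1 12%N) // (B1 15%N) //.
  by rewrite smul_left // /increment -!query_bit_ord.
have B4' i' : (i' < 18)%N -> X4 i' = N0 i' by move=> i18; rewrite B4 // B3'.
have X47 : X4 7%N = s.1 by rewrite B4'.
have X48 : X4 8%N = s.2 by rewrite B4'.
have X49 : X4 9%N = i by rewrite B4'.
have X43 : X4 3%N = 1%N by rewrite B4'.
have [X5 [S5 HX5]] : exists X5, steps 3 (L + 4 + 2 + 8 + 13 + 13 + 13 + 13) X4 (L + 4 + 2 + 8 + 13 + 13 + 13 + 13 + 3) X5 /\
   loop_inv P th m i.+1 (s.1 + X4 24, s.2 + X4 25)%N X5.
  apply: (wp_steps C5).
  apply: (@wp_cons _ _ _ 7 (s.1 + X4 24)%N); [by rewrite /= X47|lia|].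
  apply: (@wp_cons _ _ _ 8 (s.2 + X4 25)%N); [by rewrite /= /upd /= X48|lia|].
  apply: (@wp_cons _ _ _ 9 (i + 1)%N); [by rewrite /= /upd /= X43 X49|lia|].
  split; first by [].
  rewrite /loop_inv /= /upd /= Z4 addn1; split; try by rewrite B4'.
  by split; try by rewrite B4'.
have HA : (i.+1 + j = m)%N by rewrite -ijm addnS.
have HB : ((s.1 + X4 24, s.2 + X4 25)%N.1 + (s.1 + X4 24, s.2 + X4 25)%N.2 <= i.+1)%N.
  by move: acc4 si; clear; rewrite /=; lia.
rewrite (S5 _ b) (jump_step _ C6).
case: (HX5) => H0 H1 H3 [H5 H6 [H7 H8 H9 H23]].
rewrite H23 H3 (IH _ _ _ HA HB HX5).
by rewrite /count_step -inc.
Qed.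

End Execution.

Section TesterProgram.
Variables (R : realType) (K k n : nat) (p : R).

(** Precision 1 gives the program [P], the integer part of [p * n]. Words of three times the length
    of [n] exceed [n ^ 3], which is room for [100 * a ^ 2 + 100 * a] as [40 * a <= n]. *)
Definition tester_alg : ram_alg := RamAlg (setup_code K k ++ loop_code (7 + k)) 3 1.

Let P := Num.truncn (p * n%:R).
Let a := (K * (n %/ P + 1) ^ k)%N.

Lemma tester_alg_run (G : sgraph 'I_n) b : (P <= n)%N -> (0 < a)%N -> (40 * a <= n)%N ->
  ram_run tester_alg p (7 + k + (100 * a ^ 2 * 67 + 4)) G b = tester R P a G b.
Proof.
move=> Pn a0 an; rewrite /ram_run; set W := word_bound _ n.
have nW : (n ^ 3 < W)%N.
  rewrite /W /word_bound mulnC expnM ltn_exp2r // trunc_log_ltn //.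
have n40 : (40 <= n)%N by lia.
have H1 : (n.+1 < W)%N.
  by apply: leq_ltn_trans nW; rewrite !expnS expn0; nia.
have H2 : (100 * a ^ 2 + 100 * a < W)%N.
  by apply: leq_ltn_trans nW; rewrite !expnS !expn0; nia.
have sz : size (setup_code K k) = (7 + k)%N.
  by rewrite /setup_code !size_cat size_nseq; clear; rewrite /=; lia.
have C1 : code_at (setup_code K k ++ loop_code (7 + k)) 0 (setup_code K k).
  by move=> i iz; rewrite add0n onth_cat iz.
have C2 : code_at (setup_code K k ++ loop_code (7 + k)) (7 + k) (loop_code (7 + k)).
  by move=> i iz; rewrite onth_cat sz ltnNge leq_addr /= addKn.
have I0 : ram_init tester_alg n p 0 = n by rewrite /= modn_small //; exact: ltnW.
have I1 : ram_init tester_alg n p 1 = P.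
  by rewrite /= expr1 modn_small //; exact: leq_ltn_trans Pn (ltnW H1).
have I2 i : (1 < i)%N -> ram_init tester_alg n p i = 0%N by case: i => [|[|i]].
have Q := @setup_steps W n G K k P (ram_init tester_alg n p) a I0 I1 I2 erefl H1 H2 a0.
have [M' [S Inv]] := @wp_steps R _ W n G _ _ _ _ C1 Q.
rewrite sz add0n in S.
rewrite (S _ b); apply: (@loop_steps R _ W n G (7 + k) P (100 * a) (100 * a ^ 2)
  (100 * a ^ 2) 0 (0, 0)%N M' b C2 (add0n _) isT H1 H2 _ Inv).
exact: leq_trans n40.
Qed.

End TesterProgram.

(** * Planting copies *)

Lemma card_set_type (T : finType) : #|{set T}| = (2 ^ #|T|)%N.
Proof. by rewrite -[LHS]cardsT -powersetT card_powerset cardsT. Qed.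

Section Extensions.
Variables (R : realType) (V W : finType) (H : sgraph V) (v0 : V).

Lemma adjC (T : finType) (G : sgraph T) u v : adj G u v = adj G v u.
Proof. by rewrite /adj setUC. Qed.

(* The maps whose restriction to V - v0 extends to a copy of H; the value at v0 is
   arbitrary. *)
Definition extendable (G : sgraph W) : {set {ffun V -> W}} :=
  [set psi | [exists x, copy H G (setf psi v0 x)]].

Definition extension_pairs (G : sgraph W) : R :=
  \sum_(psi : {ffun V -> W}) \sum_y (copy H G psi && copy H G (setf psi v0 y))%:R.

(** Cauchy-Schwarz for the number [c psi] of values at [v0] that turn [psi] into a copy: [c] is
    supported on the extendable maps, and its second moment counts the extension pairs. One factor
    [#|W|] reflects the free value at [v0]. *)
Lemma extendable_bound (G : sgraph W) : (0 < #|W|)%N ->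
  #|W|%:R * (count_copies H G)%:R ^+ 2 <= #|extendable G|%:R * extension_pairs G.
Proof.
move=> W0; have n0 : 0 < #|W|%:R :> R by rewrite ltr0n.
pose c psi : R := \sum_x (copy H G (setf psi v0 x))%:R.
have C1 : #|W|%:R * (count_copies H G)%:R = \sum_psi c psi.
  rewrite /c (sum_resample (fun psi => (copy H G psi)%:R)) count_copiesE; congr (_ * _).
  rewrite -sum1_card natr_sum [LHS]big_mkcond; apply: eq_bigr => psi _.
  by rewrite inE; case: copy.
have C2 : \sum_psi c psi ^+ 2 = #|W|%:R * extension_pairs G.
  rewrite -(sum_resample (fun psi => \sum_y (copy H G psi && copy H G (setf psi v0 y))%:R) v0).
  apply: eq_bigr => psi _; rewrite expr2 /c mulr_suml; apply: eq_bigr => x _.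
  rewrite mulr_sumr; apply: eq_bigr => y _; rewrite setf_setf.
  by rewrite -natrM mulnb.
have C3 : \sum_psi c psi = \sum_psi (psi \in extendable G)%:R * c psi.
  apply: eq_bigr => psi _; rewrite inE; case: (boolP [exists x, _]) => [_|/existsPn N].
    by rewrite mul1r.
  by rewrite mul0r /c big1 // => x _; rewrite (negbTE (N x)).
have := sum_cauchy_schwarz (fun psi => (psi \in extendable G)%:R : R) c.
rewrite -C3 -C1 C2.
have -> : \sum_psi ((psi \in extendable G)%:R : R) ^+ 2 = #|extendable G|%:R.
  rewrite -sum1_card natr_sum [RHS]big_mkcond; apply: eq_bigr => psi _.
  by case: (_ \in _); rewrite ?expr1n ?expr0n.
rewrite exprMn expr2 -mulrA (mulrCA #|extendable G|%:R).
by rewrite ler_pM2l.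
Qed.

End Extensions.

Section MeanPairs.
Variables (R : realType) (V : finType) (H : sgraph V) (v0 : V) (n : nat) (p : R).
Hypothesis p01 : 0 <= p <= 1.

Let D := degree (adj H) v0.

Lemma copy_edges (W : finType) (G : sgraph W) psi e : copy H G psi -> e \in edges H ->
  psi @: e \in edges G.
Proof.
rewrite copyE => /andP[_ /forallP/(_ e)] + eH.
by rewrite (subsetP (edges_pairs H)) // eH => /eqP.
Qed.

(** If [y = psi v0] there is a single copy, with [#|edges H|] forced edges. Otherwise the second
    copy forces [D] further edges, all at [y], hence disjoint from those of the first. The non-edges
    are ignored. *)
Lemma mean_extension_pairs :
  mean p (fun G : sgraph 'I_n => extension_pairs R H v0 G) <=
  n%:R ^+ #|V| * p ^+ #|edges H| + n%:R ^+ #|V|.+1 * p ^+ (#|edges H| + D).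
Proof.
have p0 : 0 <= p by case/andP: p01.
rewrite /extension_pairs mean_sum.
apply: le_trans (_ : \sum_(psi : {ffun V -> 'I_n})
   (p ^+ #|edges H| + n%:R * p ^+ (#|edges H| + D)) <= _); last first.
  rewrite sumr_const card_ffun card_ord -[X in X <= _]mulr_natl natrX exprS.
  by rewrite mulrDr mulrA (mulrC n%:R).
apply: ler_sum => psi _; rewrite mean_sum.
apply: le_trans (_ : \sum_(y < n) ((y == psi v0)%:R * p ^+ #|edges H| + p ^+ (#|edges H| + D)) <= _); last first.
  rewrite big_split /= sumr_const card_ord -[X in _ + X <= _]mulr_natl lerD2r.
  rewrite (bigD1 (psi v0)) //= eqxx mul1r big1 ?addr0 // => y /negbTE->.
  by rewrite mul0r.
apply: ler_sum => y _.
have [inj|ninj] := boolP (injectiveb psi && injectiveb (setf psi v0 y)); last first.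
  apply: le_trans (_ : 0 <= _); last first.
    by rewrite addr_ge0 ?mulr_ge0 ?exprn_ge0.
  rewrite -[leRHS](mean_cst n p); apply: le_mean => // G.
  rewrite (_ : _ && _ = false) //; apply/negbTE; apply: contra ninj.
  by move=> /andP[/andP[-> _] /andP[-> _]].
case/andP: inj => /injectiveP inj /injectiveP injy.
pose S0 : {set {set 'I_n}} := [set psi @: (e : {set V}) | e in edges H].
have S0P : S0 \subset pairs_of 'I_n.
  apply/subsetP => _ /imsetP[e eH ->]; have := subsetP (edges_pairs H) _ eH.
  by rewrite !inE card_imset.
have cS0 : #|S0| = #|edges H| by rewrite card_imset //; apply: imset_inj.
have [E|yv] := eqVneq y (psi v0).
  apply: le_trans (_ : p ^+ #|edges H| <= _); last by rewrite mul1r lerDl exprn_ge0.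
  rewrite -cS0 -mean_subset //; apply: le_mean => // G; rewrite ler_nat.
  case: (boolP (copy H G psi)) => //= cp; rewrite (_ : S0 \subset _) ?leq_b1 //.
  by apply/subsetP => _ /imsetP[e eH ->]; apply: copy_edges.
rewrite mul0r add0r.
pose S1 : {set {set 'I_n}} := [set [set y; psi w] | w in [set w | adj H v0 w]].
(* The new vertex lies off the image of [psi]: at [v0] by the case at hand, elsewhere by injectivity
   of the second map. *)
have yps w : y != psi w.
  have [->|wv] := eqVneq w v0; first by [].
  apply: contraNneq wv => E; apply/eqP; apply: injy.
  by rewrite setf_same ffunE; case: eqP.
have S1P : S1 \subset pairs_of 'I_n.
  by apply/subsetP => _ /imsetP[w _ ->]; rewrite in_pairs.
have cS1 : #|S1| = D.
  rewrite card_imset // => w w' /setP/(_ (psi w)); rewrite !inE eqxx orbT.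
  by rewrite eq_sym (negbTE (yps w)) /= => /esym/eqP/inj.
have dis : [disjoint S0 & S1].
  apply/pred0P => e /=; apply/negbTE/negP => /andP[/imsetP[f _ ->] /imsetP[w _ /setP/(_ y)]].
  rewrite !inE eqxx /= => /imsetP[w' _ E].
  by have := yps w'; rewrite E eqxx.
have cU : #|S0 :|: S1| = (#|edges H| + D)%N.
  by rewrite cardsU (disjoint_setI0 dis) cards0 subn0 cS0 cS1.
rewrite -cU -mean_subset ?subUset ?S0P //; apply: le_mean => // G; rewrite ler_nat.
case: (boolP (copy H G psi)) => //= cp; case: (boolP (copy H G (setf psi v0 y))) => //= cpy.
rewrite (_ : _ \subset _) ?leq_b1 // subUset; apply/andP; split.
  by apply/subsetP => _ /imsetP[e eH ->]; apply: copy_edges.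
apply/subsetP => e' /imsetP[w]; rewrite inE => vw ->.
have := copy_edges cpy vw; rewrite imset2set setf_same setf_other //.
by apply: contraTneq vw => ->; rewrite adj_irr.
Qed.

End MeanPairs.

Section Planting.
Variables (V : finType) (H : sgraph V) (v0 : V) (n : nat).

(** Every vertex of [S] gets the neighbourhood [N :\: S]. Making [S] independent is harmless, as the
    copies to be created meet [S] only in the image of [v0]. *)
Definition plant_edges (G : sgraph 'I_n) (S N : {set 'I_n}) : {set {set 'I_n}} :=
  [set e in pairs_of 'I_n | if [disjoint e & S] then e \in edges G
     else [exists x in S, exists y in N :\: S, e == [set x; y]]].

Lemma plant_subset G S N : plant_edges G S N \subset pairs_of 'I_n.
Proof. by apply/subsetP => e; rewrite inE => /andP[]. Qed.

Definition plant G S N : sgraph 'I_n := exist (fun E : {set {set 'I_n}} => E \subset pairs_of 'I_n) _ (plant_subset G S N).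

Lemma adj_plant_out G (S N : {set 'I_n}) x y : x \notin S -> y \notin S -> adj (plant G S N) x y = adj G x y.
Proof.
move=> xS yS; rewrite /adj [LHS]inE.
have -> : [disjoint [set x; y] & S].
  by apply/pred0P => z /=; rewrite !inE; apply/negbTE/negP => /andP[/orP[]/eqP->]; apply/negP.
case: (boolP ([set x; y] \in edges G)) => [/(subsetP (edges_pairs G)) ->|] //.
by rewrite andbF.
Qed.

Lemma adj_plant_in G (S N : {set 'I_n}) x y : x \in S -> y \notin S -> adj (plant G S N) x y = (y \in N).
Proof.
move=> xS yS; have xy : x != y by apply: contraNneq yS => <-.
rewrite /adj [LHS]inE in_pairs xy /=.
have -> : [disjoint [set x; y] & S] = false.
  by apply/negbTE/negP => /pred0P/(_ x); rewrite /= !inE eqxx xS.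
apply/existsP/idP => [[x' /andP[x'S /existsP[y' /andP[]]]]|yN].
  rewrite inE => /andP[y'S y'N] /eqP/setP/(_ y); rewrite !inE eqxx orbT.
  by move=> /esym/orP[]/eqP E; rewrite E // -E (negbTE yS) in x'S *.
exists x; rewrite xS; apply/existsP; exists y.
by rewrite inE yS yN eqxx.
Qed.

Definition avoiding (G : sgraph 'I_n) (S : {set 'I_n}) : {set {ffun V -> 'I_n}} :=
  [set psi in extendable H v0 G | [forall (w | w != v0), psi w \notin S]].

Definition compatible (N : {set 'I_n}) (psi : {ffun V -> 'I_n}) : bool :=
  [forall (w | w != v0), (psi w \in N) == adj H v0 w].

Lemma copy_plant G (S N : {set 'I_n}) psi : psi \in avoiding G S -> compatible N psi -> psi v0 \in S ->
  copy H (plant G S N) psi.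
Proof.
rewrite !inE => /andP[/existsP[x /andP[/injectiveP inj /forallP cp]] /forallP av] /forallP co vS.
have avS w : w != v0 -> psi w \notin S by move=> wv; have := av w; rewrite wv.
have coN w : w != v0 -> (psi w \in N) = adj H v0 w.
  by move=> wv; have := co w; rewrite wv => /eqP.
apply/andP; split.
  apply/injectiveP => u w; have [->|uv] := eqVneq u v0; have [->|wv] := eqVneq w v0 => // E.
  - by have := avS w wv; rewrite -E vS.
  - by have := avS u uv; rewrite E vS.
  by apply: inj; rewrite !setf_other.
apply/forallP => u; apply/forallP => w.
have [->|uv] := eqVneq u v0; have [->|wv] := eqVneq w v0.
- by rewrite !adj_irr.
- by rewrite adj_plant_in ?avS // coN.
- by rewrite adjC (adjC H) adj_plant_in ?avS // coN.
rewrite adj_plant_out ?avS //.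
by have /forallP/(_ w) := cp u; rewrite !setf_other.
Qed.

(** Being avoiding and compatible does not depend on the value at [v0], so this value lies in [S]
    for a fraction [#|S| / n] of these maps, and all of those become copies. *)
Lemma copies_plant G (S N : {set 'I_n}) :
  (#|S| * #|[set psi in avoiding G S | compatible N psi]| <= n * count_copies H (plant G S N))%N.
Proof.
rewrite count_copiesE.
have indep psi x : (setf psi v0 x \in [set psi in avoiding G S | compatible N psi]) =
    (psi \in [set psi in avoiding G S | compatible N psi]).
  rewrite 2!inE [RHS]inE [in RHS]inE !inE.
  congr (_ && _ && _).
  - by apply: eq_existsb => y; rewrite setf_setf.
  - by apply: eq_forallb => w; case: (boolP (w != v0)) => // wv; rewrite setf_other.
  - by apply: eq_forallb => w; case: (boolP (w != v0)) => // wv; rewrite setf_other.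
set A := [set psi in avoiding G S | compatible N psi] in indep *.
have E := sum_resample (fun psi => ((psi v0 \in S) && (psi \in A))%:R : rat) v0.
rewrite card_ord in E.
have -> : (#|S| * #|A|)%N = (n * #|[set psi in A | psi v0 \in S]|)%N.
  apply/eqP; rewrite -(eqr_nat rat) !natrM; apply/eqP.
  transitivity (\sum_(psi : {ffun V -> 'I_n}) \sum_(x < n) ((x \in S) && (psi \in A))%:R : rat).
    rewrite mulrC -[X in X%:R * _]sum1_card natr_sum [in LHS]big_mkcond mulr_suml.
    apply: eq_bigr => psi _; case: (psi \in A); last first.
      by rewrite mul0r big1 // => x _; rewrite andbF.
    rewrite mul1r -sum1_card natr_sum big_mkcond; apply: eq_bigr => x _.
    by rewrite andbT; case: (x \in S).
  transitivity (n%:R * \sum_(psi : {ffun V -> 'I_n}) ((psi v0 \in S) && (psi \in A))%:R : rat).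
    rewrite -E; apply: eq_bigr => psi _; apply: eq_bigr => x _.
    by rewrite setf_same indep.
  congr (_ * _); rewrite -sum1_card natr_sum [RHS]big_mkcond; apply: eq_bigr => psi _.
  by rewrite inE andbC; case: (_ && _).
rewrite leq_mul2l; apply/orP; right; apply: subset_leq_card; apply/subsetP => psi.
rewrite inE => /andP[]; rewrite inE => /andP[av co] vS.
by rewrite inE copy_plant.
Qed.

(* N is recovered from its modification on the image of psi and its pattern there. *)
Lemma compatible_many (G : sgraph 'I_n) psi : psi \in extendable H v0 G ->
  (2 ^ n <= #|[set N | compatible N psi]| * 2 ^ #|V|)%N.
Proof.
rewrite inE => /existsP[x /andP[/injectiveP inj _]].
have inj' w w' : w != v0 -> w' != v0 -> psi w = psi w' -> w = w'.
  by move=> wv wv' E; apply: inj; rewrite !setf_other.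
rewrite -[X in (2 ^ X <= _)%N]card_ord -!card_set_type -cardX.
pose fix_ (N : {set 'I_n}) : {set 'I_n} :=
  [set z | if [pick w | (w != v0) && (psi w == z)] is Some w then adj H v0 w else z \in N].
pose f N := (fix_ N, [set w | psi w \in N]).
have fix_co N : compatible (fix_ N) psi.
  apply/forallP => w; apply/implyP => wv; rewrite inE.
  case: pickP => [w' /andP[wv' /eqP E]|/(_ w)]; last by rewrite wv eqxx.
  by rewrite (inj' _ _ wv' wv E).
have finj : injective f.
  move=> N N' [E1 E2]; apply/setP => z.
  have [/existsP[w /andP[wv /eqP <-]]|Nz] := boolP [exists w, (w != v0) && (psi w == z)].
    by move/setP/(_ w): E2; rewrite !inE.
  move/setP/(_ z): E1; rewrite !inE; case: pickP => // w /= Hw.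
  by case/existsP: Nz; exists w.
rewrite -(card_imset _ finj); apply: subset_leq_card; apply/subsetP => _ /imsetP[N _ ->].
by rewrite !inE fix_co.
Qed.

(** Averaging over all [N]: by [compatible_many] each avoiding map is compatible with a fraction at
    least [2 ^ - #|V|] of them. If every [N] failed, summing over [N] would contradict this. *)
Lemma good_pattern G S : exists N,
  (#|avoiding G S| <= 2 ^ #|V| * #|[set psi in avoiding G S | compatible N psi]|)%N.
Proof.
have [/existsP[N HN]|/existsPn Hno] := boolP [exists N : {set 'I_n},
   (#|avoiding G S| <= 2 ^ #|V| * #|[set psi in avoiding G S | compatible N psi]|)%N].
  by exists N.
exfalso.
have H1 : (\sum_(N : {set 'I_n}) 2 ^ #|V| * #|[set psi in avoiding G S | compatible N psi]| <
   \sum_(N : {set 'I_n}) #|avoiding G S|)%N.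
  apply: (@leq_trans (\sum_(N : {set 'I_n}) (2 ^ #|V| * #|[set psi in avoiding G S | compatible N psi]|).+1)).
    have E1 (X : {set 'I_n} -> nat) : (\sum_N (X N).+1 = \sum_N X N + \sum_(N : {set 'I_n}) 1)%N.
      by rewrite -big_split; apply: eq_bigr => N _; rewrite /= addn1.
    rewrite E1 -addn1 leq_add2l sum_nat_const muln1 card_set_type expn_gt0.
    by [].
  by apply: leq_sum => N _; have := Hno N; rewrite -ltnNge.
rewrite sum_nat_const card_set_type card_ord -big_distrr /= in H1.
have E : (\sum_(N : {set 'I_n}) #|[set psi in avoiding G S | compatible N psi]| =
   \sum_(psi in avoiding G S) #|[set N | compatible N psi]|)%N.
  transitivity (\sum_(N : {set 'I_n}) \sum_(psi in avoiding G S) compatible N psi)%N.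
    apply: eq_bigr => N _; rewrite -sum1_card big_mkcond [RHS]big_mkcond.
    by apply: eq_bigr => psi _; rewrite inE; case: (_ \in _); case: compatible.
  rewrite exchange_big; apply: eq_bigr => psi _; rewrite -sum1_card [RHS]big_mkcond.
  by apply: eq_bigr => N _; rewrite inE; case: compatible.
have : (2 ^ n * #|avoiding G S| <= 2 ^ #|V| * \sum_(psi in avoiding G S) #|[set N | compatible N psi]|)%N.
  rewrite mulnC -sum_nat_const big_distrr /=; apply: leq_sum => psi psiA.
  rewrite mulnC; apply: (@compatible_many G).
  by move: psiA; rewrite inE => /andP[].
by rewrite -E leqNgt H1.
Qed.

End Planting.

(** * Indistinguishability of the planted graphs *)

Section Hidden.
Variables (R : realType) (V : finType) (J : nat).
Variables (G : sgraph V) (G' : 'I_J -> sgraph V) (S : 'I_J -> {set V}).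
Hypothesis disj : forall u, (#|[set j | u \in S j]| <= 1)%N.
Hypothesis same : forall j u v, u \notin S j -> v \notin S j -> adj (G' j) u v = adj G u v.

(* Every query meets at most two of the sets S j. *)
Lemma hidden_change (t : qalg R V) b (D : {set 'I_J}) :
  #|D|%:R * qalg_out t G b - 2 * (qalg_queries t)%:R <=
  \sum_(j in D) qalg_out t (G' j) b.
Proof.
elim: t D => [a|r k IH|u v k IH] D /=.
- by rewrite mulr0 subr0 sumr_const -[leRHS]mulr_natl.
- rewrite big_split /= -!mulr_sumr.
  have r0 : 0 <= r%:num by [].
  have r1 : 0 <= 1 - r%:num by rewrite subr_ge0.
  set m := maxn _ _.
  have B c : #|D|%:R * qalg_out (k c) G b - 2 * m%:R <= \sum_(j in D) qalg_out (k c) (G' j) b.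
    apply: le_trans (IH c D); rewrite lerD2l lerN2 ler_pM2l // ler_nat.
    by case: c; rewrite ?leq_maxl ?leq_maxr.
  apply: le_trans (lerD (ler_wpM2l r0 (B true)) (ler_wpM2l r1 (B false))).
  by rewrite le_eqVlt; apply/orP; left; apply/eqP; ring.
set m := maxn _ _; set c := adj G u v.
pose D' := [set j in D | (u \notin S j) && (v \notin S j)].
have D'D : D' \subset D by apply/subsetP => j; rewrite inE => /andP[].
have cD : (#|D| <= #|D'| + 2)%N.
  rewrite -(cardsID D' D) (setIidPr D'D) leq_add2l.
  apply: (@leq_trans #|[set j | u \in S j] :|: [set j | v \in S j]|).
    apply: subset_leq_card; apply/subsetP => j; rewrite !inE.
    by case: (j \in D) => //=; rewrite andbT negb_and !negbK.
  apply: leq_trans (leq_add (disj u) (disj v)).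
  by rewrite cardsU leq_subr.
apply: le_trans (_ : \sum_(j in D') qalg_out (k c) (G' j) b <= _).
  apply: le_trans (IH c D').
  have o0 := qalg_out_ge0 (k c) G b; have o1 := qalg_out_le1 (k c) G b.
  have mm : (qalg_queries (k c))%:R <= m%:R :> R.
    by rewrite ler_nat /m; case: (c); rewrite ?leq_maxl ?leq_maxr.
  have : (#|D|%:R - #|D'|%:R) * qalg_out (k c) G b <= 2.
    apply: le_trans (_ : 2 * qalg_out (k c) G b <= _); last by rewrite ler_piMr.
    by rewrite ler_wpM2r // lerBlDl -natrD ler_nat.
  rewrite -(natr1 m) mulrBl; move: mm; lra.
rewrite [leRHS](big_setID D') /= (setIidPr D'D) -[leLHS]addr0; apply: lerD.
  rewrite le_eqVlt; apply/orP; left; apply/eqP; apply: eq_bigr => j.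
  by rewrite inE => /andP[_ /andP[uS vS]]; rewrite same.
by apply: sumr_ge0 => j _; apply: qalg_out_ge0.
Qed.

End Hidden.

Section Blocks.
Variables (n s : nat).
Hypothesis s0 : (0 < s)%N.

Definition block (j : nat) : {set 'I_n} := [set x : 'I_n | (x %/ s == j)%N].

Lemma card_block j : (j < n %/ s)%N -> (s <= #|block j|)%N.
Proof.
move=> jJ.
have lt (i : 'I_s) : (j * s + i < n)%N.
  apply: leq_trans (leq_trunc_div n s); apply: leq_trans (leq_mul jJ (leqnn s)).
  by rewrite mulSn addnC ltn_add2r.
rewrite -[leqLHS]card_ord -(card_imset (f := fun i => Ordinal (lt i)) _); last first.
  by move=> i i' /(congr1 val) /= /addnI /val_inj.
apply: subset_leq_card; apply/subsetP => _ /imsetP[i _ ->].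
by rewrite inE /= divnMDl // divn_small // addn0.
Qed.

Lemma block_disjoint (J : nat) u : (#|[set j : 'I_J | u \in block j]| <= 1)%N.
Proof.
apply/card_le1_eqP => j j'; rewrite !inE => /eqP E /eqP E'.
by apply: val_inj; rewrite /= -E -E'.
Qed.

End Blocks.

Lemma double_sub a e : (2 * a < e)%N -> (e <= 2 * (e - a))%N.
Proof. lia. Qed.

Section LowerBound.
Variables (R : realType) (V : finType) (H : sgraph V) (v0 : V) (n s : nat) (p eps : R).
Variable t : qalg R 'I_n.

Let J := (n %/ s)%N.
Let k := #|V|.
Let mu : R := mean p (fun G : sgraph 'I_n => (count_copies H G)%:R).
Let B : R := n%:R ^+ k * p ^+ #|edges H| +
  n%:R ^+ k.+1 * p ^+ (#|edges H| + degree (adj H) v0).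

Hypotheses (p01 : 0 <= p <= 1) (eps01 : 0 < eps < 1) (n0 : (0 < n)%N) (s0 : (0 < s)%N).
Hypotheses (kJ : (20 * k <= J)%N) (qJ : (40 * qalg_queries t < J)%N).
Hypotheses (mu0 : 0 < mu) (B0 : 0 < B).
Hypothesis gap : (1 + eps) * mu * 2 ^+ k.+1 * (10 * B) < s%:R * ((1 - eps) * mu) ^+ 2.
Hypothesis qc : qc_problem (@Gnp R n p) (rho H p) eps.

Let pat (G : sgraph 'I_n) (S : {set 'I_n}) : {set 'I_n} := xchoose (good_pattern H v0 G S).
Let pl (G : sgraph 'I_n) (j : 'I_J) : sgraph 'I_n := plant G (block n s j) (pat G (block n s j)).

Let rhoE (G : sgraph 'I_n) : rho H p G = (count_copies H G)%:R / mu.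
Proof. by []. Qed.

(** Double counting: a bad block is hit by at least half of the extendable maps, while a map has at
    most [k] values and so hits at most [k] of the disjoint blocks. *)
Lemma few_bad_blocks (G : sgraph 'I_n) :
  (#|[set j : 'I_J | (2 * #|avoiding H v0 G (block n s j)| < #|extendable H v0 G|)%N]| <= 2 * k)%N.
Proof.
set D0 := [set j | _]; set E := extendable H v0 G.
have [E0|E0] := posnP #|E|.
  rewrite (_ : D0 = set0) ?cards0 //; apply/setP => j; rewrite !inE E0.
  by rewrite ltn0.
rewrite -(leq_pmul2r E0).
have H1 (j : 'I_J) : j \in D0 -> (#|E| <= 2 * #|E :\: avoiding H v0 G (block n s j)|)%N.
  rewrite inE => Hj; rewrite cardsD.
  have -> : E :&: avoiding H v0 G (block n s j) = avoiding H v0 G (block n s j).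
    by apply/setIidPr/subsetP => psi; rewrite inE => /andP[].
  exact: double_sub.
apply: (@leq_trans (\sum_(j in D0) 2 * #|E :\: avoiding H v0 G (block n s j)|)).
  by rewrite -sum_nat_const; apply: leq_sum.
apply: (@leq_trans (\sum_(j < J) 2 * #|E :\: avoiding H v0 G (block n s j)|)).
  by rewrite [leqRHS](bigID (mem D0)) /= leq_addr.
rewrite -big_distrr /= -mulnA leq_pmul2l //.
apply: (@leq_trans (\sum_(j < J) \sum_(psi in E) \sum_(w : V) (psi w \in block n s j))).
  apply: leq_sum => j _; rewrite -sum1_card big_mkcond [leqRHS]big_mkcond /=.
  apply: leq_sum => psi _; rewrite in_setD; case: (boolP (psi \in E)) => psiE; rewrite ?andbF //.
  rewrite andbT; case: ifP => // av.
  have /forallPn[w] : ~~ [forall (w | w != v0), psi w \notin block n s j].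
    by apply: contraNN av => av; rewrite in_set psiE.
  by rewrite negb_imply negbK => /andP[_ wS]; rewrite (bigD1 w) //= wS.
rewrite exchange_big /=; under eq_bigr do rewrite exchange_big /=.
apply: (@leq_trans (\sum_(psi in E) \sum_(w : V) 1)); last first.
  by rewrite sum_nat_const sum1_card mulnC.
apply: leq_sum => psi _; apply: leq_sum => w _.
apply: leq_trans (block_disjoint s J (psi w)).
rewrite -sum1_card [leqRHS]big_mkcond; apply: leq_sum => j _.
by rewrite !inE; case: (_ == _).
Qed.

(** Chains three losses: a factor 2 for the maps avoiding the block, [2 ^ k] for the compatible
    ones, and [extendable_bound], which gives at least [n * ((1 - eps) * mu) ^ 2 / (10 * B)]
    extendable maps. The hypothesis [gap] then says that the planted graph has more than
    [(1 + eps) * mu] copies. *)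
Lemma planted_is_far (G : sgraph 'I_n) (j : 'I_J) :
  `|rho H p G - 1| <= eps -> extension_pairs R H v0 G <= 10 * B ->
  (#|extendable H v0 G| <= 2 * #|avoiding H v0 G (block n s j)|)%N ->
  eps < `|rho H p (pl G j) - 1|.
Proof.
move=> HG HP Hj.
have n0R : 0 < n%:R :> R by rewrite ltr0n.
have e1 : 0 < 1 - eps by case/andP: eps01; lra.
have C1 : (1 - eps) * mu <= (count_copies H G)%:R.
  move: HG; rewrite rhoE ler_norml => /andP[HG _].
  by rewrite -ler_pdivlMr //; move: HG; lra.
set c' : R := (count_copies H (pl G j))%:R.
have A1 := xchooseP (good_pattern H v0 G (block n s j)).
have A2 := copies_plant H v0 G (block n s j) (pat G (block n s j)).
rewrite -/(pat _ _) in A1.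
have A3 : (s * #|extendable H v0 G| <= 2 ^ k.+1 * (n * count_copies H (pl G j)))%N.
  apply: leq_trans (leq_mul (leqnn s) Hj) _; rewrite mulnCA expnS -mulnA leq_pmul2l //.
  apply: leq_trans (leq_mul (leqnn s) A1) _; rewrite mulnCA leq_pmul2l ?expn_gt0 //.
  apply: leq_trans (leq_mul (card_block s0 (ltn_ord j)) (leqnn _)) _.
  exact: A2.
have A4 : s%:R * #|extendable H v0 G|%:R <= 2 ^+ k.+1 * (n%:R * c').
  by rewrite /c' -!natrM -natrX -natrM ler_nat.
have W0 : (0 < #|'I_n|)%N by rewrite card_ord.
have A5 := extendable_bound R H v0 G W0.
rewrite card_ord in A5.
have A6 : s%:R * (n%:R * ((1 - eps) * mu) ^+ 2) <= 2 ^+ k.+1 * (n%:R * c') * (10 * B).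
  apply: le_trans (_ : s%:R * #|extendable H v0 G|%:R * (10 * B) <= _); last first.
    by rewrite ler_wpM2r // mulr_ge0 // ltW.
  rewrite -mulrA ler_wpM2l //; apply: le_trans (_ : n%:R * (count_copies H G)%:R ^+ 2 <= _).
    by rewrite ler_pM2l // ler_pXn2r // nnegrE // mulr_ge0 // ltW.
  by apply: le_trans A5 _; rewrite ler_wpM2l.
have A7 : s%:R * ((1 - eps) * mu) ^+ 2 <= c' * (2 ^+ k.+1 * (10 * B)).
  rewrite -(ler_pM2l n0R).
  apply: le_trans (le_trans _ A6) _; first by rewrite mulrCA.
  by rewrite le_eqVlt; apply/orP; left; apply/eqP; move: (2 ^+ _) => z; ring.
have K0 : 0 < 2 ^+ k.+1 * (10 * B) by rewrite mulr_gt0 ?exprn_gt0 // mulr_gt0.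
have A8 : (1 + eps) * mu < c'.
  by rewrite -(ltr_pM2r K0); apply: lt_le_trans A7; have := gap; rewrite -!mulrA.
rewrite rhoE -/c'; apply: lt_le_trans (ler_norm _).
by move: A8; rewrite -ltr_pdivlMr //; lra.
Qed.

(** Let [F] be the acceptance probability averaged over the planted blocks. By [hidden_change] and
    [40 * q < J], with [q] the number of queries, its mean is at least 2/3 - 1/20. If [rho] is close
    to 1 and extension pairs are few, all but [J / 10] blocks force rejection, so [F] is at most 1/3
    + 2/3 * 1/10 = 2/5. Each of these two conditions fails with probability at most 1/10, so the
    mean is at most 2/5 + 3/5 * 1/5 = 13/25, a contradiction. *)
Lemma query_lower_bound : ~ qc_solves (@Gnp R n p) (rho H p) eps (qalg_out t).
Proof.
move=> [acc rej].
have J0 : (0 < J)%N by apply: leq_ltn_trans qJ.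
have JR : 0 < J%:R :> R by rewrite ltr0n.
pose F G : R := (\sum_(j < J) qalg_out t (pl G j) true) / J%:R.
have F1 G : F G <= 1.
  rewrite ler_pdivrMr // mul1r; apply: le_trans (_ : \sum_(j < J) 1 <= _).
    by apply: ler_sum => j _; apply: qalg_out_le1.
  by rewrite sumr_const card_ord.
have lowF : mean p (qalg_out t ^~ true) - 1 / 20 <= mean p F.
  apply: le_trans (_ : mean p (fun G => qalg_out t G true + - (1 / 20)) <= _).
    by rewrite meanD mean_cst.
  apply: le_mean => // G; rewrite /F ler_pdivlMr //.
  have same (j : 'I_J) u v : u \notin block n s j -> v \notin block n s j ->
      adj (pl G j) u v = adj G u v by apply: adj_plant_out.
  have HC := hidden_change (block_disjoint s J) same t true setT.
  apply: le_trans (_ : \sum_(j in [set: 'I_J]) qalg_out t (pl G j) true <= _); last first.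
    by rewrite le_eqVlt; apply/orP; left; apply/eqP; apply: eq_bigl => j; rewrite inE.
  apply: le_trans HC.
  rewrite cardsT card_ord.
  have : 40 * (qalg_queries t)%:R <= J%:R :> R by rewrite -natrM ler_nat ltnW.
  lra.
pose g1 (G : sgraph 'I_n) := `|rho H p G - 1| <= eps.
pose g2 (G : sgraph 'I_n) := 10 * B < extension_pairs R H v0 G.
have highF : mean p F <= mean p (fun G => (1 - 3 / 5 * (g1 G)%:R) + 3 / 5 * (g2 G)%:R).
  apply: le_mean => // G; case: (boolP (g1 G)) => G1; last first.
    rewrite mulr0 subr0; apply: le_trans (F1 G) _.
    by rewrite lerDl mulr_ge0.
  case: (boolP (g2 G)) => G2; first by apply: le_trans (F1 G) _; rewrite /=; lra.
  rewrite mulr0 addr0 mulr1 ler_pdivrMr //.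
  pose D0 := [set j : 'I_J | (2 * #|avoiding H v0 G (block n s j)| < #|extendable H v0 G|)%N].
  have cD0 := few_bad_blocks G; rewrite -/D0 in cD0.
  apply: le_trans (_ : \sum_(j < J) (1 / 3 + 2 / 3 * (j \in D0)%:R) <= _).
    apply: ler_sum => j _; case: (boolP (j \in D0)) => jD.
      by apply: le_trans (qalg_out_le1 _ _ _) _; rewrite mulr1; lra.
    rewrite inE -leqNgt in jD.
    have P2 : extension_pairs R H v0 G <= 10 * B by rewrite leNgt.
    have R1 := rej _ (planted_is_far G1 P2 jD).
    have S1 := qalg_out_sum1 t (pl G j).
    by rewrite mulr0 addr0; move: R1 S1; rewrite /pl; lra.
  rewrite big_split /= sumr_const card_ord -mulr_sumr -[X in X + _]mulr_natl.
  have -> : \sum_(j < J) (j \in D0)%:R = #|D0|%:R :> R.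
    rewrite -sum1_card natr_sum [RHS]big_mkcond; apply: eq_bigr => j _.
    by case: (j \in D0).
  have : 10 * #|D0|%:R <= J%:R :> R.
    rewrite -natrM ler_nat; apply: leq_trans kJ.
    by apply: leq_trans (leq_mul (leqnn 10) cD0) _; rewrite mulnA.
  lra.
have Pg2 : mean p (fun G => (g2 G)%:R) <= 1 / 10.
  have M : 10 * B * mean p (fun G => (g2 G)%:R) <=
      mean p (fun G : sgraph 'I_n => extension_pairs R H v0 G).
    apply: (@markov_mean R n p p01 (fun G => extension_pairs R H v0 G) (10 * B)) => G; apply: sumr_ge0 => psi _; apply: sumr_ge0 => y _.
    exact: ler0n.
  have := le_trans M (mean_extension_pairs H v0 n p01).
  rewrite -/k -/B -mulrA (mulrCA 10) -[X in _ <= X]mulr1 ler_pM2l //; lra.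
have Pg1 : 9 / 10 <= mean p (fun G => (g1 G)%:R) by rewrite mean_indic.
have : mean p (fun G => (1 - 3 / 5 * (g1 G)%:R) + 3 / 5 * (g2 G)%:R) =
   1 - 3 / 5 * mean p (fun G => (g1 G)%:R) + 3 / 5 * mean p (fun G => (g2 G)%:R).
  rewrite meanD meanZ; congr (_ + _).
  transitivity (mean p (fun G => 1 + (- (3 / 5)) * (g1 G)%:R)).
    by apply: eq_mean => G; rewrite mulNr.
  by rewrite meanD mean_cst meanZ mulNr.
move: acc; rewrite -/(mean p (qalg_out t ^~ true)) => acc E.
rewrite E in highF; move: Pg1 Pg2 acc lowF highF; lra.
Qed.

End LowerBound.

(** * Constants *)

Section LineGraph.
Variables (V : finType) (H : sgraph V).

Lemma maxdegP (T : finType) (r : rel T) v : (degree r v <= maxdeg r)%N.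
Proof. exact: (leq_bigmax v). Qed.

Lemma degeneracyP (T : finType) (r : rel T) : degenerate r (degeneracy r).
Proof. by rewrite /degeneracy; case: ex_minnP. Qed.

Lemma degeneracy_le_maxdeg (T : finType) (r : rel T) : (degeneracy r <= maxdeg r)%N.
Proof.
rewrite /degeneracy; case: ex_minnP => d _; apply.
apply/forallP => S; apply/implyP => /set0Pn[v vS]; apply/existsP; exists v.
rewrite vS /=; apply: leq_trans (maxdegP r v); apply: subset_leq_card.
by apply/subsetP => w; rewrite !inE => /andP[].
Qed.

Lemma deg_in_le (F : {set {set V}}) u : F \subset edges H -> (deg_in F u <= maxdeg (adj H))%N.
Proof.
move=> FH; apply: leq_trans (maxdegP (adj H) u).
rewrite /degree -(card_in_imset (f := fun w => [set u; w])); last first.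
  move=> w w'; rewrite !inE => uw uw' /setP/(_ w); rewrite !inE eqxx orbT.
  move=> /esym/orP[/eqP E|/eqP //]; by rewrite -E adj_irr in uw.
apply: subset_leq_card; apply/subsetP => f; rewrite inE => /andP[fF uf].
have fH := subsetP FH _ fF.
have /pairsP[[x y] /= xy fE] := subsetP (edges_pairs H) _ fH.
move: uf; rewrite fE !inE => /orP[]/eqP ->; apply/imsetP; [exists y|exists x] => //.
- by rewrite inE /adj -fE.
- by rewrite inE /adj setUC -fE.
- by rewrite setUC.
Qed.

(* The b of the proof idea above. *)
Definition density_exponent : nat :=
  minn (degeneracy (@line_rel V H)).+2 (2 * maxdeg (adj H)).

(** For the bound [2 * maxdeg] any edge serves. For the other one take an edge [e] with few
    neighbours in the line graph of [F]: the remaining edges at [u] and those at [v] are disjoint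
    families, since no other edge contains both, and [e] itself adds 1 at each end. *)
Lemma sparse_density_exponent : sparse_edges H density_exponent.
Proof.
move=> F FH F0; rewrite /density_exponent.
have [_|_] := leqP _ (2 * maxdeg (adj H))%N; last first.
  have /set0Pn[e eF] := F0.
  have /pairsP[[u v] /= uv eE] := subsetP (edges_pairs H) _ (subsetP FH _ eF).
  exists u, v; split=> //; first by rewrite -eE.
  by rewrite mul2n -addnn leq_add ?deg_in_le.
have /forallP/(_ [set e | val e \in F]) := degeneracyP (@line_rel V H).
have -> /= : [set e : {e | e \in edges H} | val e \in F] != set0.
  have /set0Pn[e eF] := F0; apply/set0Pn.
  by exists (exist _ e (subsetP FH _ eF)); rewrite inE.
move=> /existsP[[e eH] /andP[]]; rewrite inE /= => eF.
set X := [set w in _ | _] => cX.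
have /pairsP[[u v] /= uv eE] := subsetP (edges_pairs H) _ eH.
exists u, v; split=> //; first by rewrite -eE.
have one w : w \in e -> deg_in F w = (#|[set f in F :\ e | w \in f]|.+1)%N.
  move=> we; rewrite /deg_in (cardsD1 e) inE eF we /= add1n; congr _.+1.
  by apply: eq_card => f; rewrite !inE andbA.
rewrite (one u) ?eE ?inE ?eqxx // (one v) ?eE ?inE ?eqxx ?orbT // -eE addSn addnS !ltnS.
have dis : [disjoint [set f in F :\ e | u \in f] & [set f in F :\ e | v \in f]].
  apply/pred0P => f /=; apply/negbTE/negP; rewrite !inE => /andP[/andP[/andP[fe fF] uf] /andP[_ vf]].
  case/negP: fe; rewrite eq_sym eqEcard eE; apply/andP; split.
    by apply/subsetP => w; rewrite !inE => /orP[]/eqP->.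
  rewrite cards2 uv; have := subsetP (edges_pairs H) _ (subsetP FH _ fF).
  by rewrite inE => /eqP->.
rewrite -cardsUI (disjoint_setI0 dis) cards0 addn0.
apply: leq_trans cX; rewrite -[leqRHS](card_imset _ val_inj); apply: subset_leq_card.
apply/subsetP => f; rewrite inE => fX.
have [fe fF ef] : [/\ f != e, f \in F & e :&: f != set0].
  move: fX; rewrite !inE => /orP[/andP[/andP[fe fF] wf]|/andP[/andP[fe fF] wf]]; split=> //;
  by apply/set0Pn; [exists u + exists v]; rewrite !inE wf eE !inE eqxx ?orbT.
apply/imsetP; exists (exist _ f (subsetP FH _ fF)) => //.
rewrite /X !inE /= fF /line_rel /= ef andbT.
by apply: contra fe => /eqP/(congr1 val) /= ->.
Qed.

End LineGraph.

Lemma le_double_sub k n : (2 * k <= n)%N -> (n <= 2 * (n - k))%N.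
Proof. lia. Qed.

Section Counts.
Variables (R : realType) (V : finType) (H : sgraph V) (n : nat) (p kap eps : R).
Let k := #|V|.
Let b := density_exponent H.
Let ne := #|pairs_of V :\: edges H|.
Let Ck : R := #|edges H|%:R * 2 ^+ #|edges H| + ne%:R.

(** Makes the error [Ck * tolerance * p ^ #|edges H| * n ^ k] of [counting_lemma] at most
    [eps * mu], given the lower bound [mean_copies_ge] on [mu]. The [+ 1] avoids a zero denominator
    and keeps the value at most 1. *)
Definition tolerance : R := eps * kap / (2 ^+ k * (Ck + 1)).

Hypotheses (p0 : 0 < p) (p1 : p <= 1) (kap0 : 0 < kap) (kap1 : kap <= 1).
Hypotheses (eps01 : 0 < eps < 1) (nk : (2 * k <= n)%N) (n0 : (0 < n)%N).
Hypothesis kapp : kap <= (1 - p) ^+ ne.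

Let p01 : 0 <= p <= 1. Proof. by rewrite ltW. Qed.
Let Ck0 : 0 <= Ck. Proof. by rewrite addr_ge0 // mulr_ge0 // exprn_ge0. Qed.

Lemma ffact_ge (m j : nat) : ((m - j) ^ j <= m ^_ j)%N.
Proof.
elim: j m => [|j IH] m; first by rewrite ffactn0.
case: m => [|m]; first by rewrite sub0n exp0n.
rewrite ffactnS /= subSS expnS leq_mul //.
exact: leq_trans (leq_subr _ _) (leqnSn _).
Qed.

(** As [2 * k <= n], every factor of the falling factorial is at least [n / 2]. *)
Lemma pinj_ge : n%:R ^+ k <= 2 ^+ k * (pinj V 'I_n)%:R :> R.
Proof.
have -> : pinj V 'I_n = (n ^_ k)%N by rewrite /pinj card_inj_ffuns card_ord.
rewrite -!natrX -natrM ler_nat; apply: leq_trans (leq_mul (leqnn _) (ffact_ge n k)).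
rewrite -expnMn; case: (posnP k) => [->|k0]; first by rewrite !expn0.
by rewrite leq_exp2r // le_double_sub.
Qed.

Let mu : R := mean p (fun G : sgraph 'I_n => (count_copies H G)%:R).

Lemma mean_copies_ge : kap * (p ^+ #|edges H| * n%:R ^+ k) <= 2 ^+ k * mu.
Proof.
rewrite /mu mean_copies /copy_prob -/ne.
have pe0 : 0 <= p ^+ #|edges H| by rewrite exprn_ge0 // ltW.
have q0 : 0 <= (1 - p) ^+ ne by rewrite exprn_ge0 // subr_ge0.
apply: le_trans (_ : (1 - p) ^+ ne * (p ^+ #|edges H| * (2 ^+ k * (pinj V 'I_n)%:R)) <= _).
  apply: ler_pM => //; [exact: ltW|by rewrite mulr_ge0 // exprn_ge0|].
  by rewrite ler_wpM2l // pinj_ge.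
rewrite le_eqVlt; apply/orP; left; apply/eqP.
by move: (_ ^+ ne) (_ ^+ #|edges H|) (_ ^+ k) => x y z; ring.
Qed.

Lemma mean_copies_gt0 : 0 < mu.
Proof.
have : 0 < 2 ^+ k * mu.
  apply: lt_le_trans mean_copies_ge; rewrite !mulr_gt0 ?exprn_gt0 ?ltr0n //.
by rewrite pmulr_rgt0 // exprn_gt0.
Qed.

Lemma tolerance_gt0 : 0 < tolerance.
Proof.
case/andP: eps01 => e0 _; rewrite divr_gt0 ?mulr_gt0 ?exprn_gt0 //.
by rewrite ltr_wpDl.
Qed.

Lemma tolerance_le1 : tolerance <= 1.
Proof.
case/andP: eps01 => e0 e1.
rewrite ler_pdivrMr ?mulr_gt0 ?exprn_gt0 ?ltr_wpDl // mul1r.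
apply: le_trans (_ : 1 * 1 <= _); first by rewrite ler_pM // ltW.
apply: ler_pM => //; last by rewrite lerDr.
by rewrite exprn_ege1 // ler1n.
Qed.

Lemma rho_close (G : sgraph 'I_n) :
  c4_graph G p <= tolerance ^+ 4 * p ^+ (2 * b) * n%:R ^+ 4 -> `|rho H p G - 1| <= eps.
Proof.
move=> Hc; have W0 : (0 < #|'I_n|)%N by rewrite card_ord.
have t01 : 0 <= tolerance <= 1 by rewrite tolerance_le1 (ltW tolerance_gt0).
have CL := @counting_lemma R V 'I_n H G p tolerance b p01 t01 W0 (@sparse_density_exponent V H).
rewrite card_ord -mean_copies -/mu -/Ck in CL; have {}CL := CL Hc.
have m0 := mean_copies_gt0.
rewrite /rho -/(mean p _) -/mu -[X in _ - X](divff (lt0r_neq0 m0)) -mulrBl normrM normfV (gtr0_norm m0).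
rewrite ler_pdivrMr //; apply: le_trans CL _.
case/andP: eps01 => e0 e1.
have M := ler_wpM2l (ltW e0) mean_copies_ge.
have K0 : 0 < 2 ^+ k :> R by rewrite exprn_gt0.
rewrite -(ler_pM2l K0) (mulrCA _ eps); apply: le_trans M.
have C1 : 0 < Ck + 1 by rewrite ltr_wpDl.
rewrite /tolerance -/Ck.
have Q0 : 0 <= eps * kap * (p ^+ #|edges H| * n%:R ^+ k).
  by rewrite !mulr_ge0 ?exprn_ge0 // ltW.
have -> : 2 ^+ k * (Ck * (eps * kap / (2 ^+ k * (Ck + 1))) * p ^+ #|edges H| * n%:R ^+ #|V|) =
   (Ck / (Ck + 1)) * (eps * kap * (p ^+ #|edges H| * n%:R ^+ k)).
  rewrite -/k; move: K0 C1; move: (2 ^+ k) (p ^+ _) (n%:R ^+ k) (Ck) => z x y c z0 c0.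
  by field; rewrite !lt0r_neq0.
rewrite (mulrA eps kap) -[leRHS]mul1r; apply: ler_wpM2r => //.
by rewrite ler_pdivrMr // mul1r lerDl.
Qed.

End Counts.

Section SampleSize.
Variables (R : realType) (n K b : nat) (p tol : R).
Hypotheses (p0 : 0 < p) (p1 : p <= 1) (n0 : (0 < n)%N) (tol01 : 0 < tol <= 1).
Hypothesis HK : 2 <= K%:R * tol ^+ 4.
Hypothesis Hn : 40 * K%:R * 3 ^+ (2 * b) <= n%:R * p ^+ (2 * b).

Definition sample_param (K e P : nat) : nat := (K * (n %/ P + 1) ^ e)%N.

Let P := Num.truncn (p * n%:R).
Let a := sample_param K (2 * b) P.

Let nR : 0 < n%:R :> R. Proof. by rewrite ltr0n. Qed.
Let p01 : 0 <= p <= 1. Proof. by rewrite ltW. Qed.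

Lemma K_ge2 : (2 <= K)%N.
Proof.
rewrite -(ler_nat R); apply: le_trans HK _; case/andP: tol01 => t0 t1.
by rewrite ler_piMr // exprn_ile1 // ltW.
Qed.

Lemma trunc_le_n : (P <= n)%N.
Proof.
rewrite -(ler_nat R); apply: le_trans (_ : p * n%:R <= _).
  by rewrite truncn_le mulr_ge0 // ltW.
by rewrite ler_piMl.
Qed.

Lemma trunc_approx : `|p - P%:R / n%:R| <= n%:R^-1.
Proof.
have /andP[A B] : P%:R <= p * n%:R < P.+1%:R by apply: trunc_itv; rewrite mulr_ge0 // ltW.
have -> : p - P%:R / n%:R = (p * n%:R - P%:R) / n%:R by field; rewrite lt0r_neq0.
rewrite normrM normfV (gtr0_norm nR) -[leRHS]mul1r ler_wpM2r ?invr_ge0 //.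
by rewrite ger0_norm ?subr_ge0 //; move: B; rewrite -natr1; lra.
Qed.

(** With [r = n %/ P + 1] one has [1 <= r * p <= 3]: the lower bound from [n <= r * P <= r * p * n],
    the upper one from [(r - 1) * P <= n] and [p * n <= 2 * P]. *)
Lemma sample_param_bounds : K%:R <= a%:R * p ^+ (2 * b) <= K%:R * 3 ^+ (2 * b).
Proof.
rewrite /a /sample_param natrM natrX -mulrA -exprMn.
(* For [b = 0] the hypothesis [Hn] says nothing about [p], but the power of [r * p] is trivial.
   Otherwise [Hn] yields [p * n >= 2], so rounding [p * n] down to [P] loses at most a factor 2. *)
have [->|b0] := posnP b; first by rewrite muln0 !expr0 mulr1 lexx.
have pn2 : 2 <= p * n%:R.
  apply: le_trans (_ : n%:R * p ^+ (2 * b) <= _); last first.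
    rewrite mulrC ler_wpM2r // -[leRHS]expr1 ler_wiXn2l ?(ltW p0) //.
    by rewrite muln_gt0.
  apply: le_trans Hn; have := K_ge2; rewrite -(ler_nat R) => K2.
  have T1 : 1 <= 3 ^+ (2 * b) :> R by rewrite exprn_ege1 // ler1n.
  by apply: le_trans (_ : 40 * K%:R * 1 <= _); [lra|rewrite ler_wpM2l // mulr_ge0].
have /andP[A B] : P%:R <= p * n%:R < P.+1%:R by apply: trunc_itv; rewrite mulr_ge0 // ltW.
have P0 : (0 < P)%N.
  by rewrite -(ltr_nat R); move: B; rewrite -natr1; move: pn2; lra.
have PR : 0 < P%:R :> R by rewrite ltr0n.
have Phalf : p * n%:R <= 2 * P%:R by move: B pn2; rewrite -natr1; lra.
set r : R := (n %/ P + 1)%:R.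
have r_lb : 1 <= r * p.
  have L : n%:R <= r * P%:R :> R by rewrite /r -natrM ler_nat addn1 ltnW // ltn_ceil.
  rewrite -(ler_pM2r nR) mul1r -mulrA; apply: le_trans L _.
  by rewrite ler_wpM2l // /r ler0n.
have r_ub : r * p <= 3.
  have L : (r - 1) * P%:R <= n%:R.
    by rewrite /r natrD addrK -natrM ler_nat leq_trunc_div.
  rewrite -(ler_pM2r nR) -mulrA.
  have r1 : 0 <= r - 1 by rewrite subr_ge0 /r natrD lerDr.
  have := ler_wpM2l r1 Phalf.
  have : p * n%:R <= n%:R by rewrite ler_piMl.
  move: L; rewrite (mulrCA (r - 1)) mulrBl mul1r; lra.
have r0 : 0 <= r * p by apply: le_trans r_lb.
apply/andP; split.
  by rewrite ler_peMr // exprn_ege1.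
by rewrite ler_wpM2l // ler_pXn2r // ?nnegrE ?muln_gt0.
Qed.

Let a0 : (0 < a)%N.
Proof. by rewrite /a /sample_param muln_gt0 expn_gt0 addn1 (ltnW K_ge2). Qed.

Let pb0 : 0 < p ^+ (2 * b). Proof. exact: exprn_gt0. Qed.

Lemma sample_param_small : (40 * a <= n)%N.
Proof.
rewrite -(ler_nat R) natrM -(ler_pM2r pb0) -mulrA; apply: le_trans Hn.
by rewrite -mulrA ler_wpM2l //; case/andP: sample_param_bounds.
Qed.

Lemma sample_param_le : a%:R ^+ 2 <= (K%:R * 3 ^+ (2 * b)) ^+ 2 / p ^+ (4 * b).
Proof.
rewrite ler_pdivlMr ?exprn_gt0 // (_ : (4 * b = 2 * b * 2)%N); last by rewrite mulnAC.
rewrite exprM -exprMn; case/andP: sample_param_bounds => _ L.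
by rewrite ler_pXn2r // nnegrE mulr_ge0 ?exprn_ge0 // ltW.
Qed.

End SampleSize.

Section Testers.
Variables (R : realType) (V : finType) (H : sgraph V) (n K : nat) (p kap eps : R).
Let b := density_exponent H.
Let tol := tolerance H kap eps.
Hypotheses (p0 : 0 < p) (p1 : p <= 1) (kap0 : 0 < kap) (kap1 : kap <= 1).
Hypotheses (eps01 : 0 < eps < 1) (nk : (2 * #|V| <= n)%N) (n0 : (0 < n)%N).
Hypothesis kapp : kap <= (1 - p) ^+ #|pairs_of V :\: edges H|.
Hypothesis HK : 2 <= K%:R * tol ^+ 4.
Hypothesis Hn : 40 * K%:R * 3 ^+ (2 * b) <= n%:R * p ^+ (2 * b).
Let P := Num.truncn (p * n%:R).
Let a := sample_param n K (2 * b) P.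

Let p01 : 0 <= p <= 1. Proof. by rewrite ltW. Qed.
Let tol01 : 0 < tol <= 1.
Proof. by rewrite tolerance_gt0 // tolerance_le1. Qed.
Let K2 : (2 <= K)%N. Proof. exact: K_ge2 tol01 HK. Qed.
Let a0 : (0 < a)%N.
Proof. by rewrite /a /sample_param muln_gt0 expn_gt0 addn1 (ltnW K2). Qed.
Let an : (40 * a <= n)%N.
Proof. exact: (sample_param_small p0 p1 n0 tol01 HK Hn). Qed.
Let Pn : (P <= n)%N. Proof. exact: trunc_le_n. Qed.

(** The level [2 / a] required by [tester_solves] lies below the level [tol ^ 4 * p ^ (2 * b)] of
    [rho_close], because [a * p ^ (2 * b) >= K] and [K * tol ^ 4 >= 2]. *)
Lemma tester_qc_solves : qc_solves (@Gnp R n p) (rho H p) eps (@tester R n P a).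
Proof.
apply: tester_solves p01 (trunc_approx p0 n0) _ => //.
move=> G Hc; apply: (rho_close (kap := kap)) => //; apply: le_trans Hc _.
rewrite ler_wpM2r ?exprn_ge0 // ler_pdivrMr ?ltr0n //.
case/andP: (sample_param_bounds p0 p1 n0 tol01 HK Hn) => L _.
have t0 : 0 <= tol ^+ 4 by rewrite exprn_ge0 // ltW // tolerance_gt0.
by apply: le_trans HK _; rewrite -mulrA (mulrC _ a%:R) [leLHS]mulrC ler_wpM2l.
Qed.

Lemma query_solvable_tester : query_solvable H eps n p (400 * a ^ 2).
Proof.
exists (tester_tree R n P a (100 * a ^ 2) (0, 0)%N).
  by apply: leq_trans (@tester_tree_queries R n P a (100 * a ^ 2) (0, 0)%N) _; rewrite mulnA.
have [acc rej] := tester_qc_solves.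
split=> [|G HG].
  by apply: le_trans acc _; rewrite le_eqVlt; apply/orP; left; apply/eqP;
    apply: eq_bigr => G _; rewrite tester_tree_out.
by rewrite tester_tree_out //; apply: rej.
Qed.

Lemma ram_solves_tester :
  ram_solves H eps n p (tester_alg K (2 * b)) (7 + 2 * b + (100 * a ^ 2 * 67 + 4)).
Proof.
have run G c := @tester_alg_run R K (2 * b) n p G c Pn a0 an.
have [acc rej] := tester_qc_solves.
split=> [G|]; first by rewrite !run tester_sum1.
split=> [|G HG].
  by apply: le_trans acc _; rewrite le_eqVlt; apply/orP; left; apply/eqP;
    apply: eq_bigr => G _; rewrite run.
by rewrite run //; apply: rej.
Qed.

End Testers.

Section Trivial.
Variables (R : realType) (V : finType) (H : sgraph V) (n : nat) (p eps : R).

Lemma query_solvable_full : qc_problem (@Gnp R n p) (rho H p) eps ->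
  query_solvable H eps n p (n * n).
Proof.
move=> qc; have [t tq tout] := @read_graph R 'I_n (fun G => `|rho H p G - 1| <= eps).
exists t; first by rewrite card_ord in tq.
split=> [|G HG]; last first.
  have E : (`|rho H p G - 1| <= eps) = false by rewrite leNgt HG.
  by rewrite tout E /= ler_pdivrMr // mul1r ler_nat.
apply: le_trans (_ : 9 / 10 <= _); first by lra.
apply: le_trans qc _; rewrite le_eqVlt; apply/orP; left; apply/eqP.
rewrite [LHS]big_mkcond; apply: eq_bigr => G _; rewrite tout.
by case: (_ <= _); rewrite ?mulr1 ?mulr0.
Qed.

Lemma no_query_out (t : qalg R 'I_n) (G G' : sgraph 'I_n) b : qalg_queries t = 0%N ->
  qalg_out t G b = qalg_out t G' b.
Proof.
elim: t => [a|r k IH|u v k IH] //= /eqP.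
by rewrite -leqn0 geq_max !leqn0 => /andP[/eqP A /eqP B]; rewrite (IH _ A) (IH _ B).
Qed.

Lemma copy_free_graph : (1 < #|V|)%N -> exists G : sgraph 'I_n, count_copies H G = 0%N.
Proof.
move=> V1; have [H0|/set0Pn[e eH]] := eqVneq (edges H) set0.
  exists (exist (fun E : {set {set 'I_n}} => E \subset pairs_of 'I_n) _ (subxx _)).
  rewrite count_copiesE; apply/eqP; rewrite cards_eq0; apply/eqP/setP => psi.
  rewrite !inE; apply/negbTE/negP => /andP[/injectiveP inj /forallP cp].
  have /card_gt1P[u [v [_ _ uv]]] := V1.
  have /forallP/(_ v) := cp u.
  by rewrite /adj H0 in_set0 /edges /= in_pairs inj_eq // uv.
exists (exist (fun E : {set {set 'I_n}} => E \subset pairs_of 'I_n) _ (sub0set _)).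
rewrite count_copiesE; apply/eqP; rewrite cards_eq0; apply/eqP/setP => psi.
rewrite !inE; apply/negbTE/negP => cp.
by have := copy_edges cp eH; rewrite in_set0.
Qed.

(** Without queries the output distribution is the same on all graphs, yet a graph without copies
    has [rho] equal to 0 and must be rejected. *)
Lemma no_query_unsolvable : (1 < #|V|)%N -> eps < 1 ->
  ~ query_solvable H eps n p 0.
Proof.
move=> V1 e1 [t]; rewrite leqn0 => /eqP t0 [acc rej].
have [G G0] := copy_free_graph V1.
have far : eps < `|rho H p G - 1| by rewrite /rho G0 mul0r sub0r normrN1.
have := rej G far; have := qalg_out_sum1 t G.
have : \sum_G' Gnp p G' * qalg_out t G' true = qalg_out t G true.
  rewrite -[RHS](mean_cst n p); apply: eq_mean => G'; exact: no_query_out.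
by move=> E; rewrite E in acc; move: acc; lra.
Qed.

End Trivial.

Lemma gap_arith (R : realType) (T0 T1 kap e mu Q x s : R) :
  0 < T0 -> 0 < T1 -> 0 < kap -> 0 < e < 1 -> 0 < mu -> 0 < Q -> 0 < x ->
  kap * Q <= T0 * mu -> 20 * T1 * T0 * x < s * kap * (1 - e) ^+ 2 ->
  (1 + e) * mu * T1 * (10 * (Q * x)) < s * ((1 - e) * mu) ^+ 2.
Proof.
move=> T00 T10 k0 /andP[e0 e1] m0 Q0 x0 HQ Hs.
rewrite -(ltr_pM2l k0).
have A : 0 < (1 + e) * mu * T1 * 10 * x by rewrite !mulr_gt0 // addr_gt0.
have H1 := ler_wpM2l (ltW A) HQ.
have B : 0 < mu ^+ 2 by rewrite exprn_gt0.
have H2 : 20 * T1 * T0 * x * mu ^+ 2 < s * kap * (1 - e) ^+ 2 * mu ^+ 2 by rewrite ltr_pM2r.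
have H3 : (1 + e) * (10 * (T1 * T0 * x * mu ^+ 2)) <= 2 * (10 * (T1 * T0 * x * mu ^+ 2)).
  by rewrite ler_wpM2r ?mulr_ge0 // ?ltW //; lra.
have -> : kap * ((1 + e) * mu * T1 * (10 * (Q * x))) = (1 + e) * mu * T1 * 10 * x * (kap * Q) by ring.
have -> : kap * (s * ((1 - e) * mu) ^+ 2) = s * kap * (1 - e) ^+ 2 * mu ^+ 2 by ring.
apply: le_lt_trans H1 _; apply: le_lt_trans H2.
have -> : (1 + e) * mu * T1 * 10 * x * (T0 * mu) = (1 + e) * (10 * (T1 * T0 * x * mu ^+ 2)) by ring.
apply: le_trans H3 _; rewrite le_eqVlt; apply/orP; left; apply/eqP; ring.
Qed.

Section Planted.
Variables (R : realType) (V : finType) (H : sgraph V) (v0 : V) (n q : nat) (p kap eps : R).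
Let k := #|V|.
Let D := degree (adj H) v0.
Hypotheses (p0 : 0 < p) (p1 : p <= 1) (kap0 : 0 < kap) (kap1 : kap <= 1).
Hypotheses (eps01 : 0 < eps < 1) (nk : (2 * k <= n)%N) (n0 : (0 < n)%N).
Hypothesis kapp : kap <= (1 - p) ^+ #|pairs_of V :\: edges H|.
Hypothesis qc : qc_problem (@Gnp R n p) (rho H p) eps.

(** Blocks larger than this times [1 + n * p ^ D] satisfy the hypothesis [gap]: 20 is 2 for
    [1 + eps] times the 10 of Markov's inequality, [2 ^ k.+1] is the loss in planting, and
    [2 ^ k / kap] comes from [mean_copies_ge]. *)
Definition block_factor : R := 20 * 2 ^+ k.+1 * 2 ^+ k / (kap * (1 - eps) ^+ 2).

Lemma block_factor_gt0 : 0 < block_factor.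
Proof.
have e1 : 0 < (1 - eps) ^+ 2 by case/andP: eps01 => _ e1; rewrite exprn_gt0 // subr_gt0.
rewrite /block_factor; apply: divr_gt0; last exact: mulr_gt0.
by apply: mulr_gt0; [apply: mulr_gt0|]; rewrite ?exprn_gt0.
Qed.

Hypothesis Hn : (20 * k + 2 + 40 * q)%:R * (block_factor + 1) * (n%:R^-1 + p ^+ D) <= 1.

Lemma planted_unsolvable : ~ query_solvable H eps n p q.
Proof.
case=> t tq.
have nR : 0 < n%:R :> R by rewrite ltr0n.
have p01 : 0 <= p <= 1 by rewrite ltW.
have e1 : 0 < (1 - eps) ^+ 2 by case/andP: eps01 => _ e1; rewrite exprn_gt0 // subr_gt0.
have K0 := block_factor_gt0.
set x := 1 + n%:R * p ^+ D.
have pD0 : 0 < p ^+ D by rewrite exprn_gt0.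
have x1 : 1 <= x by rewrite lerDl mulr_ge0 // ltW.
set s := (Num.truncn (block_factor * x)).+1.
have Kx0 : 0 <= block_factor * x by rewrite mulr_ge0 // ltW // (lt_le_trans _ x1).
have /andP[sl su] := trunc_itv Kx0.
have s_lb : block_factor * x < s%:R by exact: su.
have s_ub : s%:R <= (block_factor + 1) * x.
  by rewrite /s -natr1 mulrDl mul1r lerD.
(* As [x / n] is [n^-1 + p ^ D], the hypothesis [Hn] bounds the total size of the blocks needed by
   [n]. *)
have sJ : ((20 * k + 2 + 40 * q) * s <= n)%N.
  rewrite -(ler_nat R) natrM; apply: le_trans (ler_wpM2l (ler0n _ _) s_ub) _.
  rewrite -[leRHS]mul1r mulrA -(divfK (lt0r_neq0 nR) x) mulrA ler_pM2r //.
  apply: le_trans Hn; rewrite le_eqVlt; apply/orP; left; apply/eqP; congr (_ * _).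
  by rewrite /x; move: (p ^+ D) => z; field; rewrite lt0r_neq0.
have HJ : (20 * k + 2 + 40 * q <= n %/ s)%N by rewrite leq_divRL.
have mu0 := mean_copies_gt0 p0 p1 kap0 nk n0 kapp.
have mul := mean_copies_ge p0 p1 kap0 nk kapp.
set mu := mean p _ in mu0 mul.
have B0 : 0 < n%:R ^+ #|V| * p ^+ #|edges H| + n%:R ^+ #|V|.+1 * p ^+ (#|edges H| + D) :> R.
  by rewrite addr_gt0 // mulr_gt0 // exprn_gt0.
apply: (@query_lower_bound R V H v0 n s p eps t p01 eps01 n0 _ _ _ mu0 B0 _ qc).
- by [].
- by apply: leq_trans HJ; rewrite -addnA leq_addr.
- apply: leq_trans HJ; apply: (@leq_trans (40 * q).+1); first by rewrite ltnS leq_mul2l tq orbT.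
  by rewrite -addn1 addnC leq_add2r addn2.
rewrite -/mu -/D.
have -> : n%:R ^+ #|V| * p ^+ #|edges H| + n%:R ^+ #|V|.+1 * p ^+ (#|edges H| + D) =
    (p ^+ #|edges H| * n%:R ^+ k) * x :> R.
  by rewrite /x exprS exprD; move: (p ^+ #|_|) (n%:R ^+ _) (p ^+ D) => z1 z2 z3; ring.
rewrite -/k in mul *.
set Q := p ^+ #|edges H| * n%:R ^+ k in mul *.
have Q0 : 0 < Q by rewrite mulr_gt0 ?exprn_gt0.
have T0 : 0 < 2 ^+ k :> R by rewrite exprn_gt0.
have T1 : 0 < 2 ^+ k.+1 :> R by rewrite exprn_gt0.
apply: (gap_arith (T0 := 2 ^+ k) (kap := kap)) => //; first exact: lt_le_trans x1.
move: s_lb; rewrite /block_factor mulrAC ltr_pdivrMr; last exact: mulr_gt0.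
by rewrite (mulrA s%:R).
Qed.

End Planted.

Section Exponents.
Variable R : realType.

Lemma maxdeg_lt (k : nat) (H : sgraph 'I_k) : (maxdeg (adj H) <= k.-1)%N.
Proof.
apply/bigmax_leqP => v _; rewrite /degree -[k in leqRHS]card_ord -(cardsC1 v).
apply: subset_leq_card; apply/subsetP => w; rewrite !inE => vw.
by apply: contraTneq vw => ->; rewrite adj_irr.
Qed.

(** Witnessed by the complete graph on all vertices, of density ['C(k, 2) / k]. *)
Lemma m_star_ge (k : nat) (H : sgraph 'I_k) : (1 < k)%N -> (k.-1)%:R / 2 <= m_star R H.
Proof.
move=> k1; rewrite /m_star.
pose K : sgraph 'I_k := exist (fun E : {set {set 'I_k}} => E \subset pairs_of 'I_k) _ (subxx _).
apply: (@bigmax_sup _ _ _ _ K); first exact: edges_pairs.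
rewrite /m_dens; apply: (@bigmax_sup _ _ _ _ setT).
  by rewrite -card_gt0 cardsT card_ord ltnW.
apply: (@bigmax_sup _ _ _ _ (pairs_of 'I_k)).
  by rewrite subxx; apply/subsetP => e _; rewrite powersetE subsetT.
rewrite /pairs_of card_draws cardsT card_ord bin2.
have kR : 0 < k%:R :> R by rewrite ltr0n ltnW.
rewrite ler_pdivlMr // mulrAC ler_pdivrMr // -natrM -[2]/(2%:R) -natrM ler_nat.
rewrite muln2 -[leqLHS](odd_double_half) mulnC.
have -> : odd (k * k.-1) = false.
  by rewrite oddM; case: (k) k1 => // k' _ /=; case: (odd k').
by rewrite add0n.
Qed.

(** With [d] the degeneracy of the line graph, both terms of [sigma] are at least [(d + 4) / 2], so
    the right-hand side is at least [2 * d + 7], against [2 * d + 4] on the left. *)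
Lemma density_exponent_le_sigma (k : nat) (H : sgraph 'I_k) :
  (2 * density_exponent H)%:R <= 4 * sigma R H - 1.
Proof.
have dD : (degeneracy (@line_rel _ H))%:R <= (maxdeg (@line_rel _ H))%:R :> R.
  by rewrite ler_nat degeneracy_le_maxdeg.
have b1 : (density_exponent H)%:R <= (degeneracy (@line_rel _ H)).+2%:R :> R.
  by rewrite ler_nat geq_minl.
rewrite natrM; move: b1; rewrite -addn2 natrD => b1.
have : ((degeneracy (@line_rel _ H))%:R + 4) / 2 <= sigma R H.
  by rewrite /sigma le_min; apply/andP; split; lra.
lra.
Qed.

(** Expanding the product gives four terms, each at most 1/4. Here [y] stands for [p ^ (Delta / 2)]:
    [q * y <= h] is the smallness of [q], and [c <= y * n] is the square root of [prob_power_ge]. *)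
Lemma sum_le1_arith (A B q n P y h c : R) : 0 < n -> 0 <= q -> 0 < y -> y <= 1 ->
  P = y ^+ 2 -> q * y <= h -> c <= y * n -> 0 <= B -> A <= n / 4 ->
  A * P <= 1 / 4 -> B * h <= c / 4 -> B * h <= 1 / 4 ->
  (A + B * q) * (n^-1 + P) <= 1.
Proof.
move=> n0 q0 y0 y1 PE qy cy B0 An AP Bc B4.
have E1 : A / n <= 1 / 4 by rewrite ler_pdivrMr //; lra.
have Bqy := ler_wpM2l B0 qy.
have E2 : B * q / n <= 1 / 4.
  rewrite ler_pdivrMr // -(ler_pM2r y0); move: Bqy Bc cy; rewrite mulrA.
  move: (B * q * y) (B * h) => u w; lra.
have E3 : B * q * P <= 1 / 4.
  rewrite PE; have -> : B * q * y ^+ 2 = (B * (q * y)) * y by ring.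
  have := ler_wpM2r (ltW y0) (le_trans Bqy B4); lra.
have -> : (A + B * q) * (n^-1 + P) = A / n + A * P + B * q / n + B * q * P by ring.
lra.
Qed.

Lemma complete_nonedges (V : finType) (H : sgraph V) : complete H ->
  #|pairs_of V :\: edges H| = 0%N.
Proof. by move=> ->; rewrite setDv cards0. Qed.

End Exponents.

(* Imported only from here on: the set notations and lemma names of the classical
   library shadow those of finset. *)
From mathcomp Require Import all_classical all_reals all_analysis.
Import Order.TTheory GRing.Theory Num.Theory.
Import numFieldNormedType.Exports.
Local Open Scope classical_set_scope.
Local Open Scope ring_scope.

Lemma time_arith (x y : nat) : (7 + x + (100 * y * 67 + 4) = 11 + x + 6700 * y)%N.
Proof. have -> : 6700%N = (100 * 67)%N by []. lia. Qed.

Lemma time_le (R : realType) : 6700 <= 8000 :> R.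
Proof. lra. Qed.

(** * Asymptotic form of the bounds *)

Section Asymptotics.
Variable R : realType.

Lemma bigO_nat (q : nat -> nat) (e p : nat -> R) (C : R) (j : nat) : 0 < C ->
  (\forall n \near \oo, 0 < p n) ->
  (forall n, e n = p n `^ (- j%:R)) ->
  (\forall n \near \oo, (q n)%:R <= C / p n ^+ j) ->
  (fun n => (q n)%:R : R) =O_\oo e.
Proof.
move=> C0 p0 eE H; apply/eqO_exP; exists C => //.
near=> n; have pn : 0 < p n by near: n.
rewrite eE powRN powR_mulrn ?(ltW pn) // !ger0_norm ?invr_ge0 ?exprn_ge0 ?(ltW pn) //.
by near: n.
Unshelve. all: by end_near.
Qed.

End Asymptotics.

Section MainTheorem.
Variables (R : realType) (k : nat) (H : sgraph 'I_k) (eps : R) (p : nat -> R).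
Let Delta := maxdeg (adj H).
Let b := density_exponent H.
Let ne := #|pairs_of 'I_k :\: edges H|.
Hypotheses (k1 : (1 < k)%N) (eps01 : 0 < eps < 1) (p01 : forall n, 0 <= p n <= 1).

Lemma nonedge_prob :
  (complete H \/ exists2 delta : R, 0 < delta & \forall n \near \oo, p n <= 1 - delta) ->
  exists2 kap : R, 0 < kap <= 1 & \forall n \near \oo, kap <= (1 - p n) ^+ ne.
Proof.
case=> [cH|[d d0 Hd]].
  exists 1; first by rewrite ltr01 lexx.
  by near=> n; rewrite /ne complete_nonedges // expr0.
(* Nothing prevents [delta] from exceeding 1, whereas [kap] has to be at most 1. *)
have m0 : 0 < Num.min d 1 by rewrite lt_min d0 ltr01.
have m1 : Num.min d 1 <= 1 by rewrite ge_min lexx orbT.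
exists (Num.min d 1 ^+ ne).
  by rewrite exprn_gt0 //= exprn_ile1 // ltW.
near=> n; have pn : p n <= 1 - d by near: n.
have m : Num.min d 1 <= 1 - p n by apply: le_trans (_ : d <= _); [rewrite ge_min lexx|lra].
apply: lerXn2r => //; rewrite nnegrE ?(ltW m0) // subr_ge0; by case/andP: (p01 n).
Unshelve. all: by end_near.
Qed.

Hypothesis Omega1 : p \is 'Omega_\oo (fun n => n%:R `^ (- (m_star R H)^-1)).

(** By [m_star_ge], [p] is at least of order [n ^ (-2 / (k - 1))], and [Delta <= k - 1]. Besides
    positivity of [p], this is the estimate that lets the lower bound reach the exponent 1/2. *)
Lemma prob_power_ge : exists2 c : R, 0 < c &
  \forall n \near \oo, 0 < p n /\ c <= p n ^+ Delta * n%:R ^+ 2.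
Proof.
have := Omega1; rewrite qualifE => /asboolP[c c0 Hc].
exists (c ^+ k.-1); first by rewrite exprn_gt0.
near=> n; have n0 : (0 < n)%N by near: n; exact: nbhs_infty_gt.
have nR : 0 < n%:R :> R by rewrite ltr0n.
have n1 : 1 <= n%:R :> R by rewrite ler1n.
have k0 : 0 < (k.-1)%:R :> R by rewrite ltr0n -ltnS prednK // ltnW.
have : c * `|n%:R `^ (- (m_star R H)^-1)| <= `|p n| by near: n.
case/andP: (p01 n) => pn0 pn1.
rewrite !ger0_norm ?powR_ge0 // => Hp.
have ms := m_star_ge R H k1.
have H2 : c * n%:R `^ (- (2 / (k.-1)%:R)) <= p n.
  apply: le_trans Hp; rewrite ler_pM2l // ler_powR // lerN2.
  rewrite -[leRHS]invf_div lef_pV2 ?posrE ?divr_gt0 //.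
  by apply: lt_le_trans ms; rewrite divr_gt0.
have pp : 0 < p n by apply: lt_le_trans H2; rewrite mulr_gt0 // powR_gt0.
split=> //.
apply: le_trans (_ : p n ^+ k.-1 * n%:R ^+ 2 <= _); last first.
  by rewrite ler_wpM2r ?exprn_ge0 // ler_wiXn2l // maxdeg_lt.
have : (c * n%:R `^ (- (2 / (k.-1)%:R))) ^+ k.-1 <= p n ^+ k.-1.
  by apply: lerXn2r; rewrite ?nnegrE ?mulr_ge0 ?powR_ge0 // ltW.
rewrite exprMn -[(_ `^ _) ^+ _]powR_mulrn ?powR_ge0 // -powRrM mulNr divfK ?lt0r_neq0 // powRN.
rewrite -[2]/(2%:R) powR_mulrn ?(ltW nR) // => H3.
by rewrite -ler_pdivrMr ?exprn_gt0.
Unshelve. all: by end_near.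
Qed.

Hypothesis Hqc : \forall n \near \oo, qc_problem (@Gnp R n (p n)) (rho H (p n)) eps.
Hypothesis Hdelta :
  complete H \/ exists2 delta : R, 0 < delta & \forall n \near \oo, p n <= 1 - delta.

Let Db : (4 * b <= 8 * Delta)%N.
Proof.
by rewrite (_ : 8 = 4 * 2)%N // -mulnA leq_mul2l geq_minr.
Qed.

Lemma sampling_constant (kap : R) : 0 < kap <= 1 ->
  exists K : nat, 2 <= K%:R * tolerance H kap eps ^+ 4.
Proof.
case/andP=> kap0 _; have t0 : 0 < tolerance H kap eps ^+ 4.
  by rewrite exprn_gt0 // tolerance_gt0.
exists (Num.truncn (2 / tolerance H kap eps ^+ 4)).+1.
have /andP[_ L] : (Num.truncn (2 / tolerance H kap eps ^+ 4))%:R <= 2 / tolerance H kap eps ^+ 4 <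
   (Num.truncn (2 / tolerance H kap eps ^+ 4)).+1%:R.
  by apply: trunc_itv; rewrite divr_ge0 // ltW.
by rewrite -ler_pdivrMr // ltW.
Qed.

Definition query_budget (K n : nat) : nat :=
  if 40 * K%:R * 3 ^+ (2 * b) <= n%:R * p n ^+ (2 * b)
  then (400 * sample_param n K (2 * b) (Num.truncn (p n * n%:R)) ^ 2)%N else (n * n)%N.

Lemma query_upper_bound : exists2 q : nat -> nat,
  (fun n => (q n)%:R : R) =O_\oo (fun n => p n `^ (- (8 * Delta%:R))) &
  \forall n \near \oo, query_solvable H eps n (p n) (q n).
Proof.
have [kap kap01 Hkap] := nonedge_prob Hdelta.
have [K HK] := sampling_constant kap01.
have [c c0 Hc] := prob_power_ge.
case/andP: (kap01) => kap0 kap1.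
have tol01 : 0 < tolerance H kap eps <= 1 by rewrite tolerance_gt0 // tolerance_le1.
have K2 := K_ge2 tol01 HK.
exists (query_budget K).
  (* One constant for both branches: sampling needs only 400 of the 1600 in this square, and reading
     the graph costs [n ^ 2], where [n < 40 * K * 3 ^ (2 * b) / p ^ (2 * b)]. *)
  apply: (@bigO_nat R _ _ p ((40 * K%:R * 3 ^+ (2 * b)) ^+ 2) (8 * Delta)).
  - by rewrite exprn_gt0 // !mulr_gt0 ?exprn_gt0 // ltr0n ltnW.
  - by near=> n; have [] : 0 < p n /\ c <= p n ^+ Delta * n%:R ^+ 2 by near: n.
  - by move=> n; rewrite natrM.
  near=> n; have [pn0 _] : 0 < p n /\ c <= p n ^+ Delta * n%:R ^+ 2 by near: n.
  have n0 : (0 < n)%N by near: n; exact: nbhs_infty_gt.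
  case/andP: (p01 n) => _ pn1.
  apply: le_trans (_ : (40 * K%:R * 3 ^+ (2 * b)) ^+ 2 / p n ^+ (4 * b) <= _); last first.
    by rewrite ler_wpM2l ?sqr_ge0 // lef_pV2 ?posrE ?exprn_gt0 // ler_wiXn2l // ltW.
  rewrite /query_budget; case: ifP => [Hn|/negbT].
    rewrite natrM natrX.
    apply: le_trans (ler_wpM2l (ler0n _ _) (sample_param_le pn0 pn1 n0 tol01 HK Hn)) _.
    rewrite -[X in _ <= X / _](_ : 1600 * (K%:R * 3 ^+ (2 * b)) ^+ 2 = _); last first.
      by move: (3 ^+ _) => z; ring.
    rewrite mulrA ler_wpM2r ?invr_ge0 ?exprn_ge0 ?(ltW pn0) //.
    by rewrite ler_wpM2r ?sqr_ge0 // ler_nat.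
  rewrite -ltNge => /ltW Hn.
  rewrite ler_pdivlMr ?exprn_gt0 // natrM -expr2 (_ : (4 * b = 2 * b * 2)%N); last by rewrite mulnAC.
  rewrite exprM -exprMn; apply: lerXn2r => //; rewrite nnegrE.
    by rewrite mulr_ge0 // exprn_ge0 // ltW.
  by rewrite !mulr_ge0 ?exprn_ge0.
near=> n; have [pn0 _] : 0 < p n /\ c <= p n ^+ Delta * n%:R ^+ 2 by near: n.
have n0 : (0 < n)%N by near: n; exact: nbhs_infty_gt.
have kn : (2 * k <= n)%N by near: n; exact: nbhs_infty_ge.
have kapn : kap <= (1 - p n) ^+ ne by near: n.
have qc : qc_problem (@Gnp R n (p n)) (rho H (p n)) eps by near: n.
case/andP: (p01 n) => _ pn1.
rewrite /query_budget; case: ifP => Hn; last exact: query_solvable_full.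
by apply: (query_solvable_tester (kap := kap)); rewrite ?card_ord.
Unshelve. all: by end_near.
Qed.

Lemma ram_upper_bound :
  p \is 'Omega_\oo (fun n => (ln n%:R / n%:R) `^ (4 * sigma R H - 1)^-1) ->
  exists (A : ram_alg) (T : nat -> nat),
    (fun n => (T n)%:R : R) =O_\oo (fun n => p n `^ (- (8 * Delta%:R))) /\
    \forall n \near \oo, ram_solves H eps n (p n) A (T n).
Proof.
rewrite qualifE => /asboolP[d d0 Hd].
have [kap kap01 Hkap] := nonedge_prob Hdelta.
have [K HK] := sampling_constant kap01.
have [c c0 Hc] := prob_power_ge.
case/andP: (kap01) => kap0 kap1.
have tol01 : 0 < tolerance H kap eps <= 1 by rewrite tolerance_gt0 // tolerance_le1.
have K2 := K_ge2 tol01 HK.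
pose Th : R := 40 * K%:R * 3 ^+ (2 * b).
have Th0 : 0 < Th by rewrite !mulr_gt0 ?exprn_gt0 // ltr0n ltnW.
(* With [x = 4 * sigma - 1 >= 2 * b], [n * p ^ (2 * b) >= n * p ^ x >= d ^ x * ln n]: the logarithm
   in the hypothesis beats the constant [Th], so no fallback to reading the whole graph is
   necessary. *)
have large : \forall n \near \oo, Th <= n%:R * p n ^+ (2 * b).
  set x := 4 * sigma R H - 1 in Hd.
  have bx : (2 * b)%:R <= x := density_exponent_le_sigma R H.
  have x0 : 0 < x.
    have : 2 <= sigma R H.
      have [A B] : 0 <= (degeneracy (@line_rel _ H))%:R :> R /\
        0 <= (maxdeg (@line_rel _ H))%:R :> R by split; exact: ler0n.
      by rewrite /sigma le_min; apply/andP; split; lra.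
    by rewrite /x; lra.
  near=> n.
  have n0 : (0 < n)%N by near: n; exact: nbhs_infty_gt.
  have nR : 0 < n%:R :> R by rewrite ltr0n.
  have [pn0 _] : 0 < p n /\ c <= p n ^+ Delta * n%:R ^+ 2 by near: n.
  case/andP: (p01 n) => pn0' pn1.
  have nln : expR (Th / d `^ x) <= n%:R by near: n; exact: nbhs_infty_ger.
  have lnn : Th / d `^ x <= ln n%:R.
    by rewrite -[leLHS]expRK ler_ln ?posrE ?expR_gt0.
  have ln0 : 0 <= ln n%:R :> R.
    by apply: le_trans lnn; rewrite divr_ge0 ?powR_ge0 // ltW.
  have : d * `|(ln n%:R / n%:R) `^ x^-1| <= `|p n| by near: n.
  rewrite !ger0_norm ?powR_ge0 // => Hp.
  have Hp2 : d `^ x * (ln n%:R / n%:R) <= p n `^ x.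
    apply: le_trans (_ : (d * (ln n%:R / n%:R) `^ x^-1) `^ x <= _); last first.
      by apply: ge0_ler_powR; rewrite ?nnegrE ?mulr_ge0 ?powR_ge0 // ltW.
    rewrite [(d * _) `^ x]powRM ?powR_ge0 ?(ltW d0) // -powRrM mulVf ?lt0r_neq0 // powRr1 //.
    by rewrite divr_ge0.
  have Hp3 : p n `^ x <= p n ^+ (2 * b).
    by rewrite -powR_mulrn // ger_powR // pn0.
  apply: le_trans (_ : n%:R * (d `^ x * (ln n%:R / n%:R)) <= _); last first.
    by rewrite ler_pM2l // (le_trans Hp2).
  have -> : n%:R * (d `^ x * (ln n%:R / n%:R)) = d `^ x * ln n%:R.
    by field; rewrite lt0r_neq0.
  by rewrite -ler_pdivrMl ?powR_gt0 // mulrC.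
exists (tester_alg K (2 * b)), (fun n =>
  (7 + 2 * b + (100 * sample_param n K (2 * b) (Num.truncn (p n * n%:R)) ^ 2 * 67 + 4))%N).
split; last first.
  near=> n; have [pn0 _] : 0 < p n /\ c <= p n ^+ Delta * n%:R ^+ 2 by near: n.
  have n0 : (0 < n)%N by near: n; exact: nbhs_infty_gt.
  have kn : (2 * k <= n)%N by near: n; exact: nbhs_infty_ge.
  have kapn : kap <= (1 - p n) ^+ ne by near: n.
  have Hn : Th <= n%:R * p n ^+ (2 * b) by near: n.
  case/andP: (p01 n) => _ pn1.
  by apply: (ram_solves_tester (kap := kap)); rewrite ?card_ord.
(* The samples cost [6700 * a ^ 2] steps, and [5 * Th ^ 2] is 8000 times the square of
   [K * 3 ^ (2 * b)]; the rest of the program takes [11 + 2 * b] steps. *)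
apply: (@bigO_nat R _ _ p ((11 + 2 * b)%:R + 5 * Th ^+ 2) (8 * Delta)).
- by rewrite ltr_wpDl // mulr_gt0 // exprn_gt0.
- by near=> n; have [] : 0 < p n /\ c <= p n ^+ Delta * n%:R ^+ 2 by near: n.
- by move=> n; rewrite natrM.
near=> n; have [pn0 _] : 0 < p n /\ c <= p n ^+ Delta * n%:R ^+ 2 by near: n.
have n0 : (0 < n)%N by near: n; exact: nbhs_infty_gt.
have Hn : Th <= n%:R * p n ^+ (2 * b) by near: n.
case/andP: (p01 n) => _ pn1.
apply: le_trans (_ : ((11 + 2 * b)%:R + 5 * Th ^+ 2) / p n ^+ (4 * b) <= _); last first.
  have C0 : 0 <= (11 + 2 * b)%:R + 5 * Th ^+ 2 :> R.
    by apply: addr_ge0; [exact: ler0n|rewrite mulr_ge0 // sqr_ge0].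
  rewrite ler_wpM2l // lef_pV2 ?posrE ?exprn_gt0 //.
  by rewrite ler_wiXn2l // ltW.
have L := sample_param_le pn0 pn1 n0 tol01 HK Hn.
set a := sample_param _ _ _ _ in L *.
have -> : (7 + 2 * b + (100 * a ^ 2 * 67 + 4))%:R = (11 + 2 * b)%:R + 6700 * a%:R ^+ 2 :> R.
  rewrite -natrX -[6700]/(6700%:R) -natrM -natrD; congr (_%:R).
  exact: time_arith.
rewrite [leRHS]mulrDl; apply: lerD.
  by rewrite ler_peMr // invf_ge1 ?exprn_gt0 // exprn_ile1 // ltW.
apply: le_trans (ler_wpM2l (ler0n _ 6700) L) _.
rewrite mulrA ler_wpM2r ?invr_ge0 ?exprn_ge0 ?(ltW pn0) // /Th.
have -> : 5 * (40 * K%:R * 3 ^+ (2 * b)) ^+ 2 = 8000 * (K%:R * 3 ^+ (2 * b)) ^+ 2 :> R.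
  by move: (3 ^+ _) => z; ring.
by apply: ler_wpM2r; [exact: sqr_ge0|exact: time_le].
Unshelve. all: by end_near.
Qed.

Lemma query_lower_bound_asymptotic : ~ exists2 q : nat -> nat,
  (fun n => (q n)%:R : R) =o_\oo (fun n => p n `^ (- (1 / 2 * Delta%:R))) &
  \forall n \near \oo, query_solvable H eps n (p n) (q n).
Proof.
case=> q /eqoP qo Hq.
have [kap kap01 Hkap] := nonedge_prob Hdelta.
have [c c0 Hc] := prob_power_ge.
case/andP: (kap01) => kap0 kap1.
have e1 : eps < 1 by case/andP: eps01.
have I1 : (1 < #|'I_k|)%N by rewrite card_ord.
have D1 : forall n, p n `^ (1 / 2 * Delta%:R) ^+ 2 = p n ^+ Delta.
  move=> n; case/andP: (p01 n) => pn0 _.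
  rewrite -powR_mulrn ?powR_ge0 // -powRrM -powR_mulrn //; congr (_ `^ _).
  by rewrite mulrAC mul1r mulVf ?mul1r // pnatr_eq0.
have [v0 Hv0] : {v0 | Delta = degree (adj H) v0}.
  by apply: bigop.eq_bigmax; rewrite card_ord ltnW.
pose bf : R := block_factor 'I_k kap eps.
have bf0 : 0 <= bf by apply: ltW; apply: block_factor_gt0.
pose A : R := (20 * k + 2)%:R * (bf + 1).
pose B : R := 40 * (bf + 1).
have bf1 : 0 < bf + 1 by exact: (ltr_wpDl bf0 ltr01).
have A0 : 0 < A by apply: mulr_gt0 => //; rewrite ltr0n addn2.
have B0 : 0 < B by apply: mulr_gt0.
(* Planting works for [p] below [pc], where [A * p ^ Delta <= A * pc = 1 / 4] as soon as [Delta] is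
   positive. *)
pose pc : R := 1 / (4 * A).
have pc0 : 0 < pc by apply: divr_gt0 => //; apply: mulr_gt0.
pose sc := Num.sqrt c.
have sc0 : 0 < sc by rewrite sqrtr_gt0.
(* The first two terms bound [B * q * p ^ Delta] and [B * q / n] by 1/4; the third forces [q < 1]
   when [p] is at least [pc]. *)
pose h : R := Num.min (Num.min (1 / (4 * B)) (sc / (4 * B))) (pc ^+ Delta / 2).
have h0 : 0 < h by rewrite !lt_min !divr_gt0 ?mulr_gt0 ?exprn_gt0.
have ho := qo h h0.
near \oo => n.
have [pn0 pnc] : 0 < p n /\ c <= p n ^+ Delta * n%:R ^+ 2 by near: n.
have n0 : (0 < n)%N by near: n; exact: nbhs_infty_gt.
have nR : 0 < n%:R :> R by rewrite ltr0n.
have kn : (2 * k <= n)%N by near: n; exact: nbhs_infty_ge.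
have kapn : kap <= (1 - p n) ^+ ne by near: n.
have qc : qc_problem (@Gnp R n (p n)) (rho H (p n)) eps by near: n.
have nA : 4 * A <= n%:R by near: n; exact: nbhs_infty_ger.
have sol : query_solvable H eps n (p n) (q n) by near: n.
case/andP: (p01 n) => _ pn1.
have y0 : 0 < p n `^ (1 / 2 * Delta%:R) by rewrite powR_gt0.
have y1 : p n `^ (1 / 2 * Delta%:R) <= 1.
  have d0 : 0 <= 1 / 2 * Delta%:R :> R by rewrite mulr_ge0 // divr_ge0.
  have pn01 : 0 < p n <= 1 by rewrite pn0.
  by have := ger_powR pn01 d0; rewrite powRr0.
have qy : (q n)%:R * p n `^ (1 / 2 * Delta%:R) <= h.
  have : `|(q n)%:R : R| <= h * `|p n `^ (- (1 / 2 * Delta%:R))| by near: n.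
  rewrite !ger0_norm ?powR_ge0 // powRN => Hqn.
  by rewrite -ler_pdivlMr.
have [hB hsc hpc] : [/\ B * h <= 1 / 4, B * h <= sc / 4 & h <= pc ^+ Delta / 2].
  have [h1 h2 h3] : [/\ h <= 1 / (4 * B), h <= sc / (4 * B) & h <= pc ^+ Delta / 2].
    by rewrite /h !ge_min !lexx /= ?orbT.
  split=> //.
    by apply: le_trans (ler_wpM2l (ltW B0) h1) _; rewrite le_eqVlt; apply/orP; left; apply/eqP; field; rewrite lt0r_neq0.
  by apply: le_trans (ler_wpM2l (ltW B0) h2) _; rewrite le_eqVlt; apply/orP; left; apply/eqP; field; rewrite lt0r_neq0.
(* Here [q <= 1 / 2], so there are no queries at all. The case [Delta = 0] is included, where both
   powers are 1. *)
have big_p : pc ^+ Delta <= p n ^+ Delta -> False.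
  move=> Hp; apply: (@no_query_unsolvable R _ H n (p n) eps I1 e1).
  rewrite (_ : 0%N = q n) //; apply/eqP; rewrite eq_sym -leqn0 -ltnS -(ltr_nat R).
  have yl : pc ^+ Delta <= p n `^ (1 / 2 * Delta%:R).
    by apply: le_trans Hp _; rewrite -D1 expr2 ler_piMr // ltW.
  have : (q n)%:R * pc ^+ Delta <= pc ^+ Delta / 2.
    by apply: le_trans hpc; apply: le_trans qy; rewrite ler_wpM2l.
  rewrite mulrC ler_pM2l ?exprn_gt0 // => q2.
  by apply: le_lt_trans q2 _; rewrite invf_lt1 // ltr1n.
have [pp|pp] := leP pc (p n).
  by apply: big_p; apply: lerXn2r; rewrite ?nnegrE // ltW.
have [D0|D0] := posnP Delta; first by apply: big_p; rewrite D0 !expr0.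
apply: (@planted_unsolvable R _ H v0 n (q n) (p n) kap eps) => //; rewrite ?card_ord //.
rewrite -/bf -Hv0 natrD mulrDl -/A natrM mulrAC -/B.
apply: (@sum_le1_arith R A B (q n)%:R n%:R _ (p n `^ (1 / 2 * Delta%:R)) h sc) => //.
- by rewrite /sc -[leRHS]ger0_norm ?mulr_ge0 ?(ltW y0) // -sqrtr_sqr ler_wsqrtr // exprMn D1.
- exact: ltW.
- by rewrite ler_pdivlMr // mulrC.
apply: le_trans (_ : A * pc <= _).
  rewrite ler_pM2l //; apply: le_trans (ltW pp); rewrite -[leRHS]expr1.
  by rewrite ler_wiXn2l // ltW.
by rewrite /pc le_eqVlt; apply/orP; left; apply/eqP; field; rewrite lt0r_neq0.
Unshelve. all: by end_near.
Qed.

End MainTheorem.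

Theorem theorem4p1 (R : realType) :
  exists c1 c2 c3 : R, [/\ 0 < c1, 0 < c2 & 0 < c3] /\
  forall (k : nat) (H : sgraph 'I_k) (eps : R) (p : nat -> R),
    (1 < k)%N ->
    0 < eps < 1 ->
    (forall n, 0 <= p n <= 1) ->
    (complete H \/
     exists2 delta : R, 0 < delta & \forall n \near \oo, p n <= 1 - delta) ->
    p \is 'Omega_\oo (fun n => n%:R `^ (- (m_star R H)^-1)) ->
    (\forall n \near \oo, qc_problem (@Gnp R n (p n)) (rho H (p n)) eps) ->
    let Delta : R := (maxdeg (adj H))%:R in
    [/\
      exists2 q : nat -> nat,
        (fun n => (q n)%:R : R) =O_\oo (fun n => p n `^ (- (c1 * Delta))) &
        \forall n \near \oo, query_solvable H eps n (p n) (q n),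
      p \is 'Omega_\oo
        (fun n => (ln n%:R / n%:R) `^ (4 * sigma R H - 1)^-1) ->
      exists (A : ram_alg) (T : nat -> nat),
        (fun n => (T n)%:R : R) =O_\oo (fun n => p n `^ (- (c3 * Delta))) /\
        \forall n \near \oo, ram_solves H eps n (p n) A (T n) &
      ~ exists2 q : nat -> nat,
        (fun n => (q n)%:R : R) =o_\oo (fun n => p n `^ (- (c2 * Delta))) &
        \forall n \near \oo, query_solvable H eps n (p n) (q n)].
Proof.
(* The tester costs a constant times [p ^ - (4 * b)], and [b <= 2 * Delta]. The exponent 1/2 matches
   [p ^ Delta * n ^ 2] being bounded below. *)
exists 8, (1 / 2), 8; split; first by split.
move=> k H eps p k1 eps01 p01 Hdelta Omega1 Hqc Delta; split.
- exact: query_upper_bound.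
- exact: ram_upper_bound.
- exact: query_lower_bound_asymptotic.
Qed.
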